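(* For an orthogonal projection $P$ and a unitary $U$ acting on $\mathbb C^d$, the set $\mathcal W_{PU+U^*P^\perp}$ is an algebraic variety that always intersects $\Gamma$. Moreover, the following are equivalent: (1) $\mathcal W_{PU+U^*P^\perp}$ is a distinguished variety; (2) $PU+U^*P^\perp$ is completely non-unitary, or equivalently, $\sigma(PU+U^*P^\perp)\cap\mathbb T=\emptyset$; (3) there is no non-trivial $U$-reducing subspace contained either in $\operatorname{Range}P$ or in $\operatorname{Range}P^\perp$; (4) $\mathcal W_{PU+U^*P^\perp}\subset\pi(\mathbb D^2\cup\mathbb T^2\cup\mathbb E^2)$; (5) every irreducible component of $\mathcal W_{PU+U^*P^\perp}$ intersects $\mathbb G$. Conversely, if $\mathcal W$ is any distinguished variety such that each of its irreducible components meets $\mathbb G$, then there exist an orthogonal projection $P$ and a unitary $U$ (acting on some finite-dimensional Hilbert space) such that $PU+U^*P^\perp$ is completely non-unitary and $\mathcal W=\mathcal W_{PU+U^*P^\perp}$.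
   Context: For a square complex matrix $F$, $\mathcal W_F=\{(s,p)\in\mathbb C^2:\det(F^*+pF-sI)=0\}$. $P^\perp=I-P$. A non-trivial subspace means a nonzero subspace. A matrix is completely non-unitary if it has no nonzero reducing subspace on which it is unitary; $\sigma(\cdot)$ denotes the spectrum. $\mathbb D$ is the open unit disk, $\mathbb T$ the unit circle, $\mathbb E=\mathbb C\setminus\overline{\mathbb D}$, and $\pi(z_1,z_2)=(z_1+z_2,z_1z_2)$. $\mathbb G=\pi(\mathbb D^2)$ is the symmetrized bidisk, $\Gamma=\pi(\overline{\mathbb D}^2)$ its closure, $\partial\mathbb G$ its topological boundary, and $b\mathbb G=\pi(\mathbb T^2)$ its distinguished boundary. A distinguished variety is the zero set $Z(\xi)\subset\mathbb C^2$ of a polynomial $\xi$ in two variables such that $Z(\xi)\cap\mathbb G\ne\emptyset$ and $Z(\xi)\cap\partial\mathbb G=Z(\xi)\cap b\mathbb G$. *)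

(* Defs.v *)
From HB Require Import structures.
From mathcomp Require Import all_boot all_order all_algebra.
From mathcomp Require Import sesquilinear spectral complex.
From mathcomp Require Import all_classical all_reals topology normedtype.

Set Implicit Arguments.
Unset Strict Implicit.
Unset Printing Implicit Defensive.

Import Order.TTheory GRing.Theory Num.Theory.
Import numFieldNormedType.Exports.

Local Open Scope classical_set_scope.
Local Open Scope ring_scope.
Local Open Scope sesquilinear_scope.

(* The definitions only use the field, conjugation, modulus and topology of a
   [numClosedFieldType]; the theorem instantiates it with [R[i]], [R] the reals. *)

Section SymmetrizedBidisk.
Variable C : numClosedFieldType.

Definition unit_disk : set C := [set z | `|z| < 1].
Definition closed_unit_disk : set C := [set z | `|z| <= 1].
Definition unit_circle : set C := [set z | `|z| = 1].
Definition exterior_disk : set C := ~` closed_unit_disk.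

Definition symmetrization (z : C * C) : C * C := (z.1 + z.2, z.1 * z.2).

Definition sym_bidisk : set (C * C) :=
  symmetrization @` (unit_disk `*` unit_disk).
Definition closed_sym_bidisk : set (C * C) :=
  symmetrization @` (closed_unit_disk `*` closed_unit_disk).
Definition dist_boundary_sym_bidisk : set (C * C) :=
  symmetrization @` (unit_circle `*` unit_circle).

End SymmetrizedBidisk.

Arguments unit_disk : clear implicits.
Arguments closed_unit_disk : clear implicits.
Arguments unit_circle : clear implicits.
Arguments exterior_disk : clear implicits.
Arguments sym_bidisk : clear implicits.
Arguments closed_sym_bidisk : clear implicits.
Arguments dist_boundary_sym_bidisk : clear implicits.

Definition boundary (T : topologicalType) (A : set T) : set T :=
  closure A `\` interior A.

Section PlaneVarieties.
Variable C : numClosedFieldType.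
Implicit Types (xi : {poly {poly C}}) (V W : set (C * C)).

Definition zero_set xi : set (C * C) := [set z | xi.[z.1, z.2] = 0].

Definition algebraic_variety V : Prop :=
  exists S : set {poly {poly C}}, V = \bigcap_(xi in S) zero_set xi.

Definition irreducible_variety V : Prop :=
  [/\ algebraic_variety V, V !=set0 &
    forall V1 V2, algebraic_variety V1 -> algebraic_variety V2 ->
      V = V1 `|` V2 -> V = V1 \/ V = V2].

Definition irreducible_component W V : Prop :=
  [/\ irreducible_variety V, V `<=` W &
    forall V', irreducible_variety V' -> V `<=` V' -> V' `<=` W -> V' = V].

Definition distinguished_variety W : Prop :=
  [/\ exists xi, W = zero_set xi,
      W `&` sym_bidisk C !=set0 &
      W `&` boundary (sym_bidisk C) = W `&` dist_boundary_sym_bidisk C].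

End PlaneVarieties.

Section Operators.
Variables (C : numClosedFieldType) (d : nat).
Implicit Types (F P U : 'M[C]_d) (M : {vspace 'cV[C]_d}).

Definition orthogonal_projection P : Prop := P *m P = P /\ P ^t* = P.

Definition det_variety F : set (C * C) :=
  [set sp | \det (F ^t* + sp.2 *: F - sp.1%:M) = 0].

Definition spectrum F : set C := [set a | F - a%:M \notin unitmx].

(* A matrix acts on column vectors by left multiplication. *)
Definition mx_fun F : 'End('cV[C]_d) := linfun (mulmx F).
Definition mx_range F : {vspace 'cV[C]_d} := limg (mx_fun F).

Definition reducing F M : bool :=
  ((mx_fun F @: M <= M) && (mx_fun (F ^t*) @: M <= M))%VS.

(* For a reducing [M], the adjoint of [F] restricted to [M] is the restriction
   of [F ^t*], so this says that the restriction is a unitary operator on [M]. *)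
Definition unitary_on F M : Prop :=
  forall v, v \in M -> F ^t* *m (F *m v) = v /\ F *m (F ^t* *m v) = v.

Definition completely_nonunitary F : Prop :=
  ~ exists M, [/\ M != 0%VS, reducing F M & unitary_on F M].

Definition pencil_mx P U : 'M[C]_d := P *m U + U ^t* *m (1%:M - P).

End Operators.

(* Main.v *)
(* With Phi = (P^perp + p P) U and Psi = U^* (P + p P^perp) one has Phi Psi = p and
   Phi + Psi = F^* + p F for F = P U + U^* P^perp, and on the unit disk Phi, Psi are
   contractions.  So a point (z + w, z w) of W_F comes with a vector v such that
   (w P + P^perp) U v = (P + z P^perp) v; comparing norms locates z and w, the only
   obstruction being a common eigenvector of U and P, which splits off from W_F a
   line missing the symmetrized bidisk.

   Conversely let W = Z(xi) be distinguished.  For |p| < 1, xi(u + p/u, p) has no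
   zeros on |u| = 1, so the sums P_l(p) of z^l + w^l over the roots z + w of
   xi(., p) with zw = p and |z|, |w| < 1 are limits of averages over roots of unity
   of rational functions of p, hence are approximable by polynomials on smaller disks.
   Since P_l - p^l conj(P_l) tends to 0 at |p| = 1, P_l is a polynomial of degree at
   most l.  By Newton's identities these roots are those of a monic polynomial g in
   C[p][s], and W = Z(g).  Each irreducible factor f of g, of degree d in s, other
   than s^2 - 4p, has simple roots s_j = z_j + w_j with |z_j| = |w_j| = 1 over almost
   all |p| = 1.  Doubling the companion module of f so that z becomes available, the
   Hermitian form that makes multiplication by z isometric over |p| = 1 factors as
   X^* X by the matrix Fejer-Riesz theorem with det X free of zeros in the disk;
   conjugating by X turns multiplication by z into a matrix polynomial of degree one
   in p that is unitary on the circle, that is (P^perp + p P) U. *)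
Require Import Defs.
From HB Require Import structures.
From mathcomp Require Import all_boot all_order all_algebra.
From mathcomp Require Import sesquilinear spectral complex cyclic separable cyclotomic qpoly.
From mathcomp Require Import all_classical all_reals topology normedtype sequences.
From mathcomp Require Import ring lra zify.

Set Implicit Arguments.
Unset Strict Implicit.
Unset Printing Implicit Defensive.

Import Order.TTheory GRing.Theory Num.Theory.
Import numFieldNormedType.Exports.

Local Open Scope classical_set_scope.
Local Open Scope ring_scope.
Local Open Scope sesquilinear_scope.

(** * Polynomials in two variables *)

Section Bivariate.
Variable C : numClosedFieldType.
Implicit Types (f g h : {poly {poly C}}) (c q : {poly C}).

(** The converse turns conditions on the circle into statements about polynomials. Each identity
    there is only asked off finitely many points ([generic_circle]), which suffices for polynomial
    identities and lets roots be taken simple. The root [z] is not a function of [(s, p)], only of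
    the double cover [z^2 - s z + p = 0]. Doubling the module costs a square, [f^2] in place of [f],
    which has the same zero set. On [s^2 = 4 p] the cover is ramified everywhere and the Hermitian
    form degenerates, so that curve gets an explicit pencil. Conjugation by [X] introduces the
    denominator [det X]. Its zeros inside the disk are removed beforehand, a zero on the circle
    cancels because the conjugate is bounded there, and a zero outside cancels by reflection. The
    conjugates of multiplication by [z] and by [w] are then both polynomial, and on the circle one
    is [p] times the adjoint of the other; this forces degree one. Uniform limits of polynomials
    stand in for holomorphic functions, and means over roots of unity with explicit error bounds for
    contour integrals. *)

Lemma poly_eq0_inj_seq (u : nat -> C) q :
  injective u -> (forall n, q.[u n] = 0) -> q = 0.
Proof.
move=> uI q0; apply/eqP/negPn/negP => /max_poly_roots maxq.
have := maxq [seq u i | i <- iota 0 (size q)].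
rewrite map_inj_uniq // iota_uniq size_map size_iota ltnn => H.
suff: false by []. apply: H => //.
by apply/allP => _ /mapP[i _ ->]; apply/eqP/q0.
Qed.

Lemma poly_neq0_horner q : q != 0 -> exists x, q.[x] != 0.
Proof.
move=> q0; apply/not_existsP => H; case/eqP: q0.
apply: (@poly_eq0_inj_seq (fun n => n%:R)) => [m n /eqP|n].
  by rewrite eqr_nat => /eqP.
by apply/eqP/negPn/negP/H.
Qed.

Definition fibre (p : C) f : {poly C} := map_poly (horner_eval p) f.

Lemma hornerXY_fibre s p f : f.[s, p] = (fibre p f).[s].
Proof.
have e : horner_eval p s%:P = s by rewrite /horner_eval hornerC.
by have := horner_map (horner_eval p) f s%:P; rewrite /= e => ->.
Qed.

Lemma coef_fibre p f i : (fibre p f)`_i = (f`_i).[p].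
Proof. by rewrite coef_map. Qed.

Lemma fibreM p f g : fibre p (f * g) = fibre p f * fibre p g.
Proof. exact: rmorphM. Qed.

Lemma fibreD p f g : fibre p (f + g) = fibre p f + fibre p g.
Proof. exact: rmorphD. Qed.

Lemma fibreZ p c f : fibre p (c *: f) = c.[p] *: fibre p f.
Proof. by rewrite /fibre map_polyZ. Qed.

Lemma fibre_monic p f : f \is monic -> fibre p f \is monic.
Proof. exact: monic_map. Qed.

Lemma size_fibre_monic p f : f \is monic -> size (fibre p f) = size f.
Proof.
move=> fm; apply: size_map_poly_id0.
by rewrite (monicP fm) /horner_eval hornerC oner_eq0.
Qed.

Lemma fibre_eq0 p f : fibre p f = 0 -> exists g, f = ('X - p%:P) *: g.
Proof.
move=> f0; have dv i : 'X - p%:P %| f`_i.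
  by rewrite dvdp_XsubCl /root -coef_fibre f0 coef0.
exists (\poly_(i < size f) (f`_i %/ ('X - p%:P))).
apply/polyP => i; rewrite coefZ coef_poly; case: ltnP => [_|le].
  by rewrite mulrC divpK.
by rewrite mulr0 nth_default.
Qed.

Lemma polyXY_scalerI c f g : c != 0 -> c *: f = c *: g -> f = g.
Proof.
by move=> c0; rewrite -!mul_polyC; apply: mulfI; rewrite polyC_eq0.
Qed.

(* If [c f] splits then at each root [a] of [c] one of the two factors vanishes
   identically on the fibre over [a], hence is divisible by [X - a]. *)
Lemma monic_split c f g h : c != 0 -> f \is monic -> c *: f = g * h ->
  exists g' h', [/\ g' \is monic, h' \is monic, f = g' * h',
    size g' = size g & size h' = size h].
Proof.
move=> + fm; have [n] := ubnP (size c); elim: n => // n IHn in c g h *.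
rewrite ltnS => sc c0 e.
have [/eqP/size_poly1P[a a0 ca]|s1] := eqVneq (size c) 1%N.
  have e' : lead_coef g * lead_coef h = a%:P.
    by rewrite -lead_coefM -e lead_coefZ (monicP fm) mulr1 ca.
  have [gu hu] : lead_coef g \is a GRing.unit /\ lead_coef h \is a GRing.unit.
    apply/andP; rewrite -unitrM e'.
    by rewrite poly_unitE coefC eqxx size_polyC a0 unitfE a0.
  exists ((lead_coef g)^-1 *: g), ((lead_coef h)^-1 *: h).
  have V0 (x : {poly C}) : x \is a GRing.unit -> x^-1 != 0.
    by move=> xu; apply: contraTneq xu => x0; rewrite -unitrV x0 unitr0.
  split.
  - by rewrite monicE lead_coefZ mulVr.
  - by rewrite monicE lead_coefZ mulVr.
  - rewrite -scalerAl -scalerAr -e ca scalerA scalerA -invrM // mulrC.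
    rewrite [lead_coef h * _]mulrC e' -ca divrr ?scale1r // ca.
    by rewrite poly_unitE coefC eqxx size_polyC a0 unitfE a0.
  - by rewrite size_scale // V0.
  - by rewrite size_scale // V0.
have /closed_rootP[a ra] := s1; have /factor_theorem[c1 ec] := ra.
have Xa0 : ('X - a%:P : {poly C}) != 0 by rewrite polyXsubC_eq0.
have c10 : c1 != 0 by apply: contraNneq c0 => c10; rewrite ec c10 mul0r.
have sc1 : (size c1 < n)%N.
  by apply: leq_trans sc; rewrite ec size_Mmonic ?monicXsubC // size_XsubC addn2.
have : fibre a g * fibre a h = 0.
  by rewrite -fibreM -e fibreZ (rootP ra) scale0r.
move/eqP; rewrite mulf_eq0 => /orP[] /eqP /fibre_eq0[k ek].
  have [|g' [h' [? ? ? sg sh]]] := IHn c1 k h sc1 c10.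
    apply: (polyXY_scalerI Xa0).
    by rewrite scalerA mulrC -ec e ek scalerAl.
  by exists g', h'; split; rewrite ?ek ?size_scale.
have [|g' [h' [? ? ? sg sh]]] := IHn c1 g k sc1 c10.
  apply: (polyXY_scalerI Xa0).
  by rewrite scalerA mulrC -ec e ek scalerAr.
by exists g', h'; split; rewrite ?ek ?size_scale.
Qed.

(** Over [{poly C}], [%|] is divisibility up to a nonzero scalar of [{poly C}], so
    [irreducible_poly] means irreducible over the field of fractions. This is the needed form of
    Gauss's lemma: [monic_split] removes the scalar. *)
Lemma monic_reducible f : f \is monic -> (1 < size f)%N ->
  ~ irreducible_poly f ->
  exists g h, [/\ g \is monic, h \is monic, f = g * h,
    (1 < size g < size f)%N & (1 < size h < size f)%N].
Proof.
move=> fm sf nirr.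
have [k [sq qf nqf]] : exists k : {poly {poly C}}, [/\ size k != 1%N, k %| f & ~~ (k %= f)].
  apply/not_existsP => H; apply: nirr; split=> // k sq qf.
  by apply/negPn/negP => nqf; apply: (H k).
have f0 : f != 0 by rewrite monic_neq0.
have q0 : k != 0 by apply: contraNneq f0 => q0; rewrite q0 dvd0p in qf.
have sqf : (size k < size f)%N.
  by rewrite ltn_neqAle dvdp_leq // andbT dvdp_size_eqp.
have sq1 : (1 < size k)%N by rewrite ltn_neqAle eq_sym sq size_poly_gt0.
have /Pdiv.Idomain.dvdpP[[c r] /= c0 e] := qf.
have [g [h [gm hm fgh sg sh]]] := monic_split c0 fm e.
have esz : size f = (size r + size k).-1 by rewrite fgh size_Mmonic ?monic_neq0 // sg sh.
move: esz sqf sq1; rewrite -sg -sh.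
move=> esz sqf sq1; exists g, h; split=> //.
  by move: (size g) (size h) (size f) esz sqf sq1 => a b d *; apply/andP; lia.
by move: (size g) (size h) (size f) esz sqf sq1 => a b d *; apply/andP; lia.
Qed.

Lemma monic_irreducible_factorization f : f \is monic ->
  exists s : seq {poly {poly C}},
    [/\ f = \prod_(g <- s) g, all (mem monic) s &
     forall g, g \in s -> irreducible_poly g].
Proof.
have [n] := ubnP (size f); elim: n f => // n IHn f; rewrite ltnS => sf fm.
have [s1|s1] := leqP (size f) 1.
  exists [::]; split=> //; rewrite big_nil.
  have /size1_polyC e := s1; move: (monicP fm); rewrite e lead_coefC => ->.
  by [].
have [irr|nirr] := pselect (irreducible_poly f).
  exists [:: f]; split; rewrite ?big_seq1 //= ?fm // => g.
  by rewrite inE => /eqP->.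
have [g [h [gm hm fgh /andP[_ sg] /andP[_ sh]]]] := monic_reducible fm s1 nirr.
have [||s [es sm si]] := IHn g => //; first exact: leq_trans sg sf.
have [||t [et tm ti]] := IHn h => //; first exact: leq_trans sh sf.
exists (s ++ t); split; first by rewrite big_cat /= -es -et.
  by rewrite all_cat sm.
by move=> k; rewrite mem_cat => /orP[/si|/ti].
Qed.

Lemma irreducible_coprimep f g :
  irreducible_poly f -> ~~ (f %| g) -> coprimep f g.
Proof.
move=> [sf irr] nfg; apply/negPn/negP => nco; case/negP: nfg.
have := irr (gcdp f g) nco (dvdp_gcdl f g) => /eqp_dvdl <-.
exact: dvdp_gcdr.
Qed.

Lemma coprimep_bezout f g : coprimep f g ->
  exists c u v, c != 0 /\ u * f + v * g = c%:P.
Proof.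
move=> /Pdiv.Idomain.Bezout_coprimepP[[u v] /= e].
have : size (u * f + v * g) == 1%N by rewrite size_poly_eq1.
by move=> /size_poly1P[c c0 ec]; exists c, u, v.
Qed.

(** The Bezout constant [c] acts as a resultant: the two curves can meet only over its finitely many
    roots. *)
Lemma coprimep_fibre_coprime f g : coprimep f g ->
  exists2 c : {poly C}, c != 0 &
    forall s p, c.[p] != 0 -> f.[s, p] = 0 -> g.[s, p] != 0.
Proof.
move=> /coprimep_bezout[c [u [v [c0 e]]]]; exists c => // s p cp f0.
apply: contraNneq cp => g0.
have := congr1 (fun k : {poly {poly C}} => k.[s, p]) e.
by rewrite !hornerE f0 g0 !mulr0 addr0 => <-.
Qed.

Lemma monic_fibre_root f p : f \is monic -> (1 < size f)%N ->
  exists s, f.[s, p] = 0.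
Proof.
move=> fm sf; have /closed_rootP[s rs] : size (fibre p f) != 1%N.
  by rewrite size_fibre_monic // gtn_eqF.
by exists s; rewrite hornerXY_fibre; apply/rootP.
Qed.

(** Nullstellensatz for one monic irreducible polynomial. If [f] did not divide [g], they would have
    no common zero over a generic [p], whereas a monic [f] has a zero over every [p]. *)
Lemma irreducible_dvdp_vanish f g : f \is monic -> irreducible_poly f ->
  (forall s p, f.[s, p] = 0 -> g.[s, p] = 0) -> f %| g.
Proof.
move=> fm irr van; apply/negPn/negP => /(irreducible_coprimep irr).
case/coprimep_fibre_coprime => c /poly_neq0_horner[p cp] /(_ _ p cp).
have [s s0] := monic_fibre_root p fm irr.1.
by move=> /(_ s s0); rewrite van ?eqxx.
Qed.

Lemma irreducible_prime f g h : irreducible_poly f ->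
  f %| g * h -> (f %| g) || (f %| h).
Proof.
move=> irr fgh; have [//|/(irreducible_coprimep irr) co] := boolP (f %| g).
by rewrite -(Gauss_dvdpr h co).
Qed.

Lemma monic_dvdp_vanish f g s p : f \is monic -> f %| g ->
  f.[s, p] = 0 -> g.[s, p] = 0.
Proof.
by move=> fm /Pdiv.IdomainMonic.dvdpP -/(_ fm)[q ->] f0; rewrite !hornerE f0 mulr0.
Qed.

End Bivariate.

(** * The symmetrized bidisk *)

Section PairTopology.
Variable C : numClosedFieldType.
Implicit Types (A B : set (C * C)).

Lemma nbhs_pairP (s p : C) B : nbhs (s, p) B <->
  exists2 e : C, 0 < e &
    forall s' p', `|s - s'| < e -> `|p - p'| < e -> B (s', p').
Proof.
split=> [/nbhs_ballP[e e0 H]|[e e0 H]].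
  by exists e => // s' p' ss pp; apply: H; split.
by apply/nbhs_ballP; exists e => // -[s' p'] [/= ss pp]; exact: H.
Qed.

Lemma closure_pairP (s p : C) A : closure A (s, p) <->
  forall e : C, 0 < e ->
    exists s' p', [/\ A (s', p'), `|s - s'| < e & `|p - p'| < e].
Proof.
split=> [clA e e0|H B /nbhs_pairP[e e0 eB]].
  have /clA[[s' p'] [As' [/= ss pp]]] :
      nbhs (s, p) [set x : C * C | `|s - x.1| < e /\ `|p - x.2| < e].
    by apply/nbhs_pairP; exists e.
  by exists s', p'.
by have [s' [p' [As' ss pp]]] := H e e0; exists (s', p'); split=> //; exact: eB.
Qed.

Lemma interior_pairP (s p : C) A : interior A (s, p) <->
  exists2 e : C, 0 < e &
    forall s' p', `|s - s'| < e -> `|p - p'| < e -> A (s', p').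
Proof. exact: nbhs_pairP. Qed.

Lemma symmetrizationP (s p : C) : exists z, symmetrization z = (s, p).
Proof.
pose d := sqrtC (s ^+ 2 - 4 * p).
exists ((s + d) / 2, (s - d) / 2); rewrite /symmetrization /=; congr pair.
  by field.
have e : d ^+ 2 = s ^+ 2 - 4 * p by rewrite sqrtCK.
transitivity ((s ^+ 2 - d ^+ 2) / 4); first by field.
by rewrite e; field.
Qed.

End PairTopology.

(** * The modulus as a real-valued function *)

Section Modulus.
Variable R : realType.
Local Notation C := R[i].
Implicit Types (x y z w : C) (a b : R).

Definition modulus z : R := complex.Re `|z|.

Lemma normE z : `|z| = ((modulus z)%:C)%C.
Proof. by rewrite /modulus RRe_real ?normr_real. Qed.

Lemma modulus_ge0 z : 0 <= modulus z.
Proof. by rewrite -ler0c -normE. Qed.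

Lemma modulus_realc a : modulus (a%:C)%C = `|a|.
Proof. by rewrite /modulus normc_def /= expr0n addr0 sqrtr_sqr. Qed.

Lemma modulusM z w : modulus (z * w) = modulus z * modulus w.
Proof.
by apply: complexI; rewrite -normE normrM !normE rmorphM.
Qed.

Lemma modulusD z w : modulus (z + w) <= modulus z + modulus w.
Proof. by rewrite -lecR rmorphD /= -!normE ler_normD. Qed.

Lemma modulus0 : modulus 0 = 0.
Proof. by rewrite /modulus normr0. Qed.

Lemma modulus1 : modulus 1 = 1.
Proof. by rewrite /modulus normr1. Qed.

Lemma modulusN z : modulus (- z) = modulus z.
Proof. by rewrite /modulus normrN. Qed.

Lemma modulusBC z w : modulus (z - w) = modulus (w - z).
Proof. by rewrite -modulusN opprB. Qed.

Lemma modulusB z w : modulus (z - w) <= modulus z + modulus w.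
Proof. by rewrite -[modulus w]modulusN modulusD. Qed.

Lemma modulusB_ge z w : modulus z - modulus w <= modulus (z - w).
Proof. by rewrite lerBlDr -{1}[z](subrK w) modulusD. Qed.

Lemma modulusJ z : modulus z^* = modulus z.
Proof. by rewrite /modulus norm_conjC. Qed.

Lemma modulusX z n : modulus (z ^+ n) = modulus z ^+ n.
Proof. by elim: n => [|n IH]; rewrite ?expr0 ?modulus1 // !exprS modulusM IH. Qed.

Lemma modulus_eq0 z : (modulus z == 0) = (z == 0).
Proof. by rewrite -[RHS]normr_eq0 normE -[0 in RHS]/(((0:R)%:C)%C) (inj_eq (@complexI R)). Qed.

Lemma modulus_gt0 z : (0 < modulus z) = (z != 0).
Proof. by rewrite lt_neqAle modulus_ge0 andbT eq_sym modulus_eq0. Qed.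

Lemma modulusV z : modulus z^-1 = (modulus z)^-1.
Proof.
have [->|z0] := eqVneq z 0; first by rewrite invr0 modulus0 invr0.
have m0 : modulus z != 0 by rewrite modulus_eq0.
by apply: (mulIf m0); rewrite -modulusM !mulVf ?modulus1.
Qed.

Lemma modulus_sum (I : Type) (r : seq I) (P : pred I) (F : I -> C) :
  modulus (\sum_(i <- r | P i) F i) <= \sum_(i <- r | P i) modulus (F i).
Proof.
elim/big_rec2 : _ => [|i y z _ H]; first by rewrite modulus0.
by rewrite (le_trans (modulusD _ _)) // lerD2l.
Qed.

Lemma modulus_prod (I : Type) (r : seq I) (P : pred I) (F : I -> C) :
  modulus (\prod_(i <- r | P i) F i) = \prod_(i <- r | P i) modulus (F i).
Proof. exact: (big_morph _ modulusM modulus1). Qed.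

Lemma mulJ_modulus z : z * z^* = ((modulus z ^+ 2)%:C)%C.
Proof. by rewrite -normCK normE rmorphXn. Qed.

Lemma norm_lt_modulus z a : (`|z| < (a%:C)%C) = (modulus z < a).
Proof. by rewrite normE ltcR. Qed.

Lemma norm_le_modulus z a : (`|z| <= (a%:C)%C) = (modulus z <= a).
Proof. by rewrite normE lecR. Qed.

Lemma norm_lt1 z : (`|z| < 1) = (modulus z < 1).
Proof. exact: (norm_lt_modulus z 1). Qed.

Lemma norm_le1 z : (`|z| <= 1) = (modulus z <= 1).
Proof. exact: (norm_le_modulus z 1). Qed.

Lemma norm_eq1 z : `|z| = 1 <-> modulus z = 1.
Proof.
by rewrite normE; split=> [/(congr1 (@complex.Re R))|->].
Qed.

Lemma gt0c_real (e : C) : 0 < e -> exists2 a : R, 0 < a & e = (a%:C)%C.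
Proof.
move=> e0; have er : e = ((complex.Re e)%:C)%C by rewrite RRe_real // gtr0_real.
by exists (complex.Re e) => //; rewrite -ltcR -er.
Qed.

Lemma modulus1_conj z : modulus z = 1 -> z^* = z^-1.
Proof.
move=> z1; have z0 : z != 0 by rewrite -modulus_gt0 z1.
by apply: (mulfI z0); rewrite mulJ_modulus z1 expr1n divff.
Qed.

End Modulus.

Section Bidisk.
Variable R : realType.
Local Notation C := R[i].
Implicit Types (s p : C) (z w : C * C).

Lemma symmetrization_inj z w : symmetrization z = symmetrization w ->
  w = z \/ w = (z.2, z.1).
Proof.
case: z w => [z1 z2] [w1 w2] [/= e1 e2].
have : (w1 - z1) * (w1 - z2) = 0.
  transitivity (w1 ^+ 2 - (z1 + z2) * w1 + z1 * z2); first by ring.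
  by rewrite e1 e2; ring.
move/eqP; rewrite mulf_eq0 !subr_eq0 => /orP[] /eqP ew; [left|right].
  by rewrite ew; congr pair; apply: (addrI w1); rewrite -e1 ew.
by rewrite ew; congr pair; apply: (addrI w1); rewrite -e1 ew addrC.
Qed.

Lemma sym_image_mem (A : set C) z :
  (@symmetrization _ @` (A `*` A)) (symmetrization z) <-> A z.1 /\ A z.2.
Proof.
split=> [[w [/= A1 A2] /esym /symmetrization_inj[] e]|[A1 A2]].
- by rewrite e in A1 A2.
- by rewrite e /= in A1 A2.
- by exists z.
Qed.

Lemma sym_bidisk_mem z : sym_bidisk C (symmetrization z) <->
  modulus z.1 < 1 /\ modulus z.2 < 1.
Proof. by rewrite -!norm_lt1; exact: (sym_image_mem (unit_disk C)). Qed.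

Lemma closed_sym_bidisk_mem z : closed_sym_bidisk C (symmetrization z) <->
  modulus z.1 <= 1 /\ modulus z.2 <= 1.
Proof. by rewrite -!norm_le1; exact: (sym_image_mem (closed_unit_disk C)). Qed.

Lemma dist_boundary_mem z : dist_boundary_sym_bidisk C (symmetrization z) <->
  modulus z.1 = 1 /\ modulus z.2 = 1.
Proof.
rewrite -(norm_eq1 z.1) -(norm_eq1 z.2).
exact: (sym_image_mem (unit_circle C)).
Qed.

Lemma sym_bidisk_closed_boundary z :
  modulus z.1 <= 1 -> modulus z.2 <= 1 ->
  closure (sym_bidisk C) (symmetrization z).
Proof.
move=> z1 z2; apply/closure_pairP => _ /gt0c_real[e e0 ->].
have [t [t0 t1 te te']] :
    exists t : R, [/\ 0 < t, t < 1, 1 - t ^+ 2 < e & 2 * (1 - t) < e].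
  by exists (1 - Num.min e 1 / 4); case: (leP e 1) => h; split; nra.
pose w := ((t%:C)%C * z.1, (t%:C)%C * z.2).
have mt : modulus (t%:C)%C = t by rewrite modulus_realc gtr0_norm.
exists (w.1 + w.2), (w.1 * w.2); split.
- apply/(sym_bidisk_mem w); rewrite /w /= !modulusM mt.
  by have := modulus_ge0 z.1; have := modulus_ge0 z.2; split; nra.
- rewrite norm_lt_modulus.
  have -> : (symmetrization z).1 - (w.1 + w.2) = ((1 - t)%:C)%C * (z.1 + z.2).
    rewrite /w rmorphB rmorph1 /=. by move: (t%:C)%C => tc; ring.
  rewrite modulusM modulus_realc ger0_norm ?subr_ge0 ?ltW //.
  apply: le_lt_trans te'; rewrite mulrC ler_wpM2r ?subr_ge0 ?(ltW t1) //.
  by apply: le_trans (modulusD _ _) _; lra.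
rewrite norm_lt_modulus.
have -> : (symmetrization z).2 - (w.1 * w.2) = ((1 - t ^+ 2)%:C)%C * (z.1 * z.2).
  by rewrite /w rmorphB rmorphXn rmorph1 /=; move: (t%:C)%C => tc; ring.
rewrite !modulusM modulus_realc ger0_norm; last by nra.
apply: le_lt_trans te; rewrite ler_piMr //; first by nra.
by apply: mulr_ile1; rewrite ?modulus_ge0.
Qed.

(* [w1] is a root of [x^2 - s' x + p'], so evaluating the other quadratic there
   measures the distance between the two pairs of roots. *)
Lemma symmetrization_dist z w :
  modulus (w.1 - z.1) * modulus (w.1 - z.2) <=
  modulus ((symmetrization z).1 - (symmetrization w).1) * modulus w.1 +
  modulus ((symmetrization z).2 - (symmetrization w).2).
Proof.
rewrite -modulusM.
have -> : (w.1 - z.1) * (w.1 - z.2) =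
  - (((symmetrization z).1 - (symmetrization w).1) * w.1) +
  ((symmetrization z).2 - (symmetrization w).2) by rewrite /=; ring.
by apply: le_trans (modulusD _ _) _; rewrite modulusN modulusM.
Qed.

Lemma closure_sym_bidisk_le1 z : closure (sym_bidisk C) (symmetrization z) ->
  modulus z.1 <= 1.
Proof.
move=> /closure_pairP cl; rewrite leNgt; apply/negP => z1.
(* As [|z1| = m > 1], both [|z1 - w1|] and [|z1 - w2|] exceed [m - 1], while [symmetrization_dist]
   keeps their product below [e * (m + 1)]; this [e] makes the two bounds equal. *)
pose m := modulus z.1; pose e : R := (m - 1) ^+ 2 / (m + 1).
have e0 : 0 < e by rewrite divr_gt0 ?exprn_gt0 ?subr_gt0 // addr_gt0 // (lt_trans _ z1).
have [|s' [p' [[w [w1 w2] sw]]]] := cl ((e%:C)%C); first by rewrite ltcR.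
move: w1 w2; rewrite /unit_disk /= !norm_lt1 => w1 w2.
rewrite !norm_lt_modulus /= => ds dp.
have : modulus (z.1 - w.1) * modulus (z.1 - w.2) <=
       modulus ((symmetrization w).1 - (symmetrization z).1) * modulus z.1 +
       modulus ((symmetrization w).2 - (symmetrization z).2).
  exact: symmetrization_dist.
rewrite sw /= (modulusBC s') (modulusBC p') -/m.
have := modulusB_ge z.1 w.1; have := modulusB_ge z.1 w.2; rewrite -/m => h1 h2.
have em : e * (m + 1) = (m - 1) ^+ 2.
  by rewrite mulfVK // gt_eqF // addr_gt0 // (lt_trans _ z1).
rewrite -/m in z1; clearbody e m; move=> H.
have hcd : (m - 1) * (m - 1) <= modulus (z.1 - w.1) * modulus (z.1 - w.2).
  by apply: ler_pM; lra.
have am : modulus (z.1 + z.2 - s') * m <= e * m.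
  by apply: ler_wpM2r; [lra|exact: ltW].
rewrite expr2 in em; lra.
Qed.

Lemma sym_bidisk_open z : modulus z.1 < 1 -> modulus z.2 < 1 ->
  interior (sym_bidisk C) (symmetrization z).
Proof.
move=> z1 z2; apply/interior_pairP.
pose r := Num.max (modulus z.1) (modulus z.2).
have r1 : r < 1 by rewrite gt_max z1.
(* If [m = |w1| >= 1], then [|w1 - zi| >= m - r >= m * (1 - r)], so the product of the two distances
   is at least [m^2 (1 - r)^2]; but it is below [e * (m + 1) <= 2 * e * m]. *)
pose e : R := (1 - r) ^+ 2 / 2.
have e0 : 0 < e by rewrite divr_gt0 // exprn_gt0 // subr_gt0.
exists ((e%:C)%C); first by rewrite ltcR.
have r0 : 0 <= r by rewrite le_max modulus_ge0.
have main (w : C * C) :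
    modulus ((symmetrization z).1 - (symmetrization w).1) < e ->
    modulus ((symmetrization z).2 - (symmetrization w).2) < e ->
    modulus w.1 < 1.
  move=> ds dp; rewrite ltNge; apply/negP => w1.
  have := symmetrization_dist z w.
  have := modulusB_ge w.1 z.1; have := modulusB_ge w.1 z.2.
  have : modulus z.1 <= r by rewrite le_max lexx.
  have : modulus z.2 <= r by rewrite le_max lexx orbT.
  move: w1 ds dp; rewrite -/e; move: (modulus (w.1 - z.1)) (modulus (w.1 - z.2)).
  move: (modulus (_ - _)) (modulus (_ - _)) (modulus w.1) => b a m c d.
  move=> m1 ae be z2r z1r h1 h2 H.
  have hcd : (m * (1 - r)) * (m * (1 - r)) <= c * d.
    by apply: ler_pM; nra.
  have em : 2 * e = (1 - r) ^+ 2 by rewrite /e; field.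
  clearbody e; have am : a * m <= e * m by nra.
  have : m * (1 - r) ^+ 2 <= m * m * (1 - r) ^+ 2.
    by apply: ler_wpM2r; [exact: sqr_ge0|nra].
  rewrite -em; nra.
move=> s' p'; have [w] := symmetrizationP s' p' => /esym e'; rewrite !norm_lt_modulus.
have [-> ->] : s' = (symmetrization w).1 /\ p' = (symmetrization w).2.
  by case: e' => -> ->.
move=> ds dp; apply/(sym_bidisk_mem w); split; first exact: main.
by apply: (main (w.2, w.1)); rewrite /= ?(addrC w.2) ?(mulrC w.2).
Qed.
End Bidisk.

Section BidiskBoundary.
Variable R : realType.
Local Notation C := R[i].

Lemma boundary_sym_bidisk_mem (z : C * C) :
  boundary (sym_bidisk C) (symmetrization z) <->
  (modulus z.1 <= 1 /\ modulus z.2 <= 1) /\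
  ~ (modulus z.1 < 1 /\ modulus z.2 < 1).
Proof.
split=> [[clz niz]|[[z1 z2] nz]].
  split; last by case=> z1 z2; apply: niz; exact: sym_bidisk_open.
  split; first exact: closure_sym_bidisk_le1 clz.
  apply: (@closure_sym_bidisk_le1 _ (z.2, z.1)).
  by move: clz; rewrite /symmetrization addrC mulrC.
split; first exact: sym_bidisk_closed_boundary.
by move=> /interior_subset /(sym_bidisk_mem z).
Qed.
End BidiskBoundary.

(** * The pencil of a projection and a unitary *)

Section LinearAlgebra.
Variable C : numClosedFieldType.

Lemma det0_colP n (A : 'M[C]_n) :
  \det A = 0 <-> exists2 v : 'cV_n, v != 0 & A *m v = 0.
Proof.
rewrite -det_tr; split=> [/eqP/det0P[v v0 vA]|[v v0 Av]].
  exists v^T; first by rewrite trmx_eq0.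
  by apply: trmx_inj; rewrite trmx_mul trmxK vA trmx0.
apply/eqP/det0P; exists v^T; first by rewrite trmx_eq0.
by rewrite -trmx_mul Av trmx0.
Qed.

(** By Cayley-Hamilton a product of factors [A - a] kills [v]. Apply them one at a time, staying in
    [Q]; the last nonzero vector is an eigenvector. *)
Lemma stable_eigenvector n (A : 'M[C]_n) (Q : 'cV[C]_n -> Prop) v :
  (forall w, Q w -> Q (A *m w)) ->
  (forall a w w', Q w -> Q w' -> Q (a *: w + w')) ->
  v != 0 -> Q v -> exists a w, [/\ w != 0, Q w & A *m w = a *: w].
Proof.
case: n => [|n] in A Q v *; first by rewrite [v]flatmx0 eqxx.
move=> QA Qlin.
have [l el] := closed_field_poly_normal (char_poly A).
rewrite (monicP (char_poly_monic A)) scale1r in el.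
have : horner_mx A (\prod_(z <- l) ('X - z%:P)) *m v = 0.
  by rewrite -el Cayley_Hamilton mul0mx.
elim: l v {el} => [|a l IHl] v.
  by rewrite big_nil rmorph1 mul1mx => -> ; rewrite eqxx.
rewrite big_cons mulrC rmorphM -mulmxA => e v0 Qv.
have eX : horner_mx A ('X - a%:P) *m v = A *m v - a *: v.
  by rewrite rmorphB /= horner_mx_X horner_mx_C mulmxBl mul_scalar_mx.
have [w0|w0] := eqVneq (A *m v - a *: v) 0.
  by exists a, v; split=> //; apply/eqP; rewrite -subr_eq0 w0.
apply: (IHl _ _ w0); first by rewrite -eX.
by rewrite addrC -scaleNr; apply: Qlin; [exact: Qv|exact: QA].
Qed.

Definition sqnorm n (v : 'cV[C]_n) : C := (v^t* *m v) 0 0.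

Lemma sqnormE n (v : 'cV[C]_n) : sqnorm v = \sum_i `|v i 0| ^+ 2.
Proof.
by rewrite /sqnorm mxE; apply: eq_bigr => i _; rewrite !mxE normCK mulrC.
Qed.

Lemma sqnorm_ge0 n (v : 'cV[C]_n) : 0 <= sqnorm v.
Proof. by rewrite sqnormE sumr_ge0 // => i _; rewrite exprn_ge0. Qed.

Lemma sqnorm_eq0 n (v : 'cV[C]_n) : (sqnorm v == 0) = (v == 0).
Proof.
apply/eqP/eqP => [|->]; last by rewrite /sqnorm mulmx0 mxE.
rewrite sqnormE => /psumr_eq0P H; apply/matrixP => i j; rewrite ord1 mxE.
have /eqP := H (fun i _ => exprn_ge0 2 (normr_ge0 _)) i isT.
by rewrite expf_eq0 /= normr_eq0 => /eqP.
Qed.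

Lemma sqnormZ n a (v : 'cV[C]_n) : sqnorm (a *: v) = `|a| ^+ 2 * sqnorm v.
Proof.
by rewrite !sqnormE mulr_sumr; apply: eq_bigr => i _; rewrite mxE normrM exprMn.
Qed.

Lemma adjmxM m n p (A : 'M[C]_(m, n)) (B : 'M[C]_(n, p)) :
  (A *m B)^t* = B^t* *m A^t*.
Proof. by rewrite trmx_mul map_mxM. Qed.

Lemma adjmxD m n (A B : 'M[C]_(m, n)) : (A + B)^t* = A^t* + B^t*.
Proof. by rewrite linearD /= map_mxD. Qed.

Lemma adjmxB m n (A B : 'M[C]_(m, n)) : (A - B)^t* = A^t* - B^t*.
Proof. by rewrite linearB /= map_mxB. Qed.

Lemma adjmxZ m n a (A : 'M[C]_(m, n)) : (a *: A)^t* = a^* *: A^t*.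
Proof. by rewrite linearZ /= map_mxZ. Qed.

Lemma adjmx1 n : (1%:M : 'M[C]_n)^t* = 1%:M.
Proof. by rewrite trmx1 map_mx1. Qed.

Lemma adjmxE m n (A : 'M[C]_(m, n)) i j : (A^t* ) i j = (A j i)^*.
Proof. by rewrite !mxE. Qed.

Lemma reducing_line n (A : 'M[C]_n) (v : 'cV[C]_n) a b :
  A *m v = a *: v -> A^t* *m v = b *: v -> reducing A <[v]>%VS.
Proof.
move=> Av Bv; rewrite /reducing !limg_line !lfunE /= Av Bv.
by rewrite -!memvE !memvZ ?memv_line.
Qed.

Lemma mem_mx_range n (P : 'M[C]_n) v : P *m v = v -> v \in mx_range P.
Proof. by move=> Pv; rewrite -{1}Pv -[P *m v](lfunE (mulmx P)) memv_img ?memvf. Qed.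

Lemma mx_rangeP n (P : 'M[C]_n) v : P *m P = P -> v \in mx_range P -> P *m v = v.
Proof. by move=> PP /memv_imgP[w _ ->]; rewrite lfunE /= mulmxA PP. Qed.

Lemma orthogonal_projection_compl n (P : 'M[C]_n) :
  orthogonal_projection P -> orthogonal_projection (1%:M - P).
Proof.
move=> [PP Ps]; split; last by rewrite adjmxB adjmx1 Ps.
by rewrite mulmxBl mul1mx mulmxBr mulmx1 PP subrr subr0.
Qed.

Lemma unitarymx_adj n (U : 'M[C]_n) : U \is unitarymx -> U^t* *m U = 1%:M.
Proof. by move=> Uu; rewrite -invmx_unitary // mulVmx // unitarymx_unit. Qed.

Lemma unitary_eigen n (U : 'M[C]_n) (v : 'cV[C]_n) a : U \is unitarymx -> v != 0 ->
  U *m v = a *: v -> `|a| = 1 /\ U^t* *m v = a^* *: v.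
Proof.
move=> Uu v0 Uv.
have a1 : `|a| = 1.
  have : sqnorm (U *m v) = sqnorm v.
    by rewrite /sqnorm adjmxM -mulmxA [U^t* *m _]mulmxA unitarymx_adj // mul1mx.
  rewrite Uv sqnormZ -[RHS]mul1r => /mulIf; rewrite sqnorm_eq0 => /(_ v0) /eqP.
  by rewrite sqrp_eq1 // => /eqP.
split=> //.
have aa : a^* * a = 1 by rewrite mulrC -normCK a1 expr1n.
have : U^t* *m (U *m v) = v by rewrite mulmxA unitarymx_adj // mul1mx.
rewrite Uv -scalemxAr => e.
by rewrite -[LHS]scale1r -aa -scalerA e.
Qed.

End LinearAlgebra.

(** * Eigenvectors of the pencil and comparison of norms *)

Section Pencil.
Variables (C : numClosedFieldType) (d : nat) (P U : 'M[C]_d).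
Implicit Types (v : 'cV[C]_d).
Hypothesis Pproj : orthogonal_projection P.
Hypothesis Uunit : U \is unitarymx.
Local Notation F := (pencil_mx P U).
Local Notation Q := (1%:M - P).

Let PP : P *m P = P := Pproj.1.
Let Ps : P^t* = P := Pproj.2.
Let QQ : Q *m Q = Q := (orthogonal_projection_compl Pproj).1.
Let Qs : Q^t* = Q := (orthogonal_projection_compl Pproj).2.
Let UU : U^t* *m U = 1%:M := unitarymx_adj Uunit.
Let UU' : U *m U^t* = 1%:M. Proof. exact/unitarymxP. Qed.
Let PQ : P *m Q = 0. Proof. by rewrite mulmxBr mulmx1 PP subrr. Qed.
Let QP : Q *m P = 0. Proof. by rewrite mulmxBl mul1mx PP subrr. Qed.
Let PQ1 : P + Q = 1%:M. Proof. by rewrite addrC subrK. Qed.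

Lemma pencil_adj : F^t* = U^t* *m P + Q *m U.
Proof. by rewrite /pencil_mx adjmxD !adjmxM Ps Qs trmxCK. Qed.

Lemma pencil_range v a : U *m v = a *: v -> P *m v = v -> F *m v = a *: v.
Proof.
move=> Uv Pv; rewrite /pencil_mx mulmxDl -!mulmxA Uv -scalemxAr Pv.
by rewrite -{2}Pv [Q *m _]mulmxA QP mul0mx mulmx0 addr0.
Qed.

Lemma pencil_range_compl v a : v != 0 -> U *m v = a *: v -> Q *m v = v ->
  F *m v = a^* *: v.
Proof.
move=> v0 Uv Qv; have [_ Usv] := unitary_eigen Uunit v0 Uv.
rewrite /pencil_mx mulmxDl -!mulmxA Uv Qv Usv -scalemxAr.
by rewrite -{1}Qv [P *m _]mulmxA PQ mul0mx scaler0 add0r.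
Qed.

(* The numerical range of the pencil lies in the closed unit disk, and equality
   in the Cauchy-Schwarz estimate behind this forces the eigenvalue equations. *)
Lemma pencil_unimodular_eigen v a : `|a| = 1 -> F *m v = a *: v ->
  F^t* *m v = a^* *: v.
Proof.
move=> a1 Fv; have aa : a^* * a = 1 by rewrite mulrC -normCK a1 expr1n.
have vF : v^t* *m F^t* = a^* *: v^t* by rewrite -adjmxM Fv adjmxZ.
(* [x] and [y] measure the failure of [P U v = a P v] and of [Q U v = conj(a) Q v]. Expanding with
   [F v = a v] and its adjoint gives [|x|^2 + |y|^2 = (1 - |a|^2) |v|^2 = 0]. *)
pose x := P *m (U *m v - a *: v); pose y := Q *m (U *m v - a^* *: v).
have proj_sq (E : 'M[C]_d) w : E *m E = E -> E^t* = E ->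
    (E *m w)^t* *m (E *m w) = w^t* *m E *m w.
  by move=> EE Es; rewrite adjmxM Es mulmxA -[w^t* *m E *m E]mulmxA EE.
have decomp (z w : 'cV[C]_d) : z^t* *m Q *m w = z^t* *m w - z^t* *m P *m w.
  by rewrite mulmxBr mulmx1 mulmxBl.
have xy : x^t* *m x + y^t* *m y = 0.
  rewrite /x /y !proj_sq // !adjmxB !adjmxZ conjCK.
  set u := U *m v.
  have uu : u^t* *m u = v^t* *m v by rewrite /u adjmxM -mulmxA [U^t* *m _]mulmxA UU mul1mx.
  have k1 : u^t* *m P *m v + v^t* *m Q *m u = a^* *: (v^t* *m v).
    rewrite scalemxAl -vF pencil_adj /u adjmxM; move: Q => q.
    by rewrite mulmxDr mulmxDl !mulmxA.
  have k2 : v^t* *m P *m u + u^t* *m Q *m v = a *: (v^t* *m v).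
    rewrite scalemxAr -Fv /pencil_mx /u adjmxM; move: Q => q.
    by rewrite mulmxDl mulmxDr !mulmxA.
  move: k1 k2 decomp; move: Q => q k1 k2 decomp.
  rewrite !mulmxBl -!scalemxAl !mulmxBr -!scalemxAr !scalerBr !scalerA.
  have {}k1 : v^t* *m q *m u = a^* *: (v^t* *m v) - u^t* *m P *m v.
    by rewrite -k1 addrAC subrr add0r.
  have {}k2 : u^t* *m q *m v = a *: (v^t* *m v) - v^t* *m P *m u.
    by rewrite -k2 addrAC subrr add0r.
  rewrite k1 k2 !decomp uu.
  move: (u^t* *m P *m u) (u^t* *m P *m v) (v^t* *m P *m u) (v^t* *m P *m v).
  move: (v^t* *m v) => t5 t1 t2 t3 t4; apply/matrixP => i j; rewrite !mxE.
  transitivity ((1 - a^* * a) * t5 i j); first by ring.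
  by rewrite aa subrr mul0r.
have [x0 y0] : x = 0 /\ y = 0.
  have : sqnorm x + sqnorm y = 0.
    by have := congr1 (fun A : 'M[C]_1 => A 0 0) xy; rewrite [LHS]mxE [RHS]mxE.
  move=> /eqP; rewrite paddr_eq0 ?sqnorm_ge0 // !sqnorm_eq0.
  by case/andP=> /eqP-> /eqP->.
have PUv : P *m (U *m v) = a *: (P *m v).
  by apply/eqP; rewrite -subr_eq0 scalemxAr -mulmxBr; apply/eqP.
have QUv : Q *m (U *m v) = a^* *: (Q *m v).
  by apply/eqP; rewrite -subr_eq0 scalemxAr -mulmxBr; apply/eqP.
have split1 w : P *m w + Q *m w = w by rewrite -mulmxDl PQ1 mul1mx.
have Uv : U *m v = a *: (P *m v) + a^* *: (Q *m v) by rewrite -PUv -QUv split1.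
have UQ : U^t* *m (Q *m v) = a *: (Q *m v).
  move: Fv; rewrite /pencil_mx mulmxDl -!mulmxA PUv -{3}(split1 _ v) scalerDr.
  exact: addrI.
have UP : U^t* *m (P *m v) = a^* *: (P *m v).
  have : U^t* *m (U *m v) = v by rewrite mulmxA UU mul1mx.
  rewrite Uv mulmxDr -!scalemxAr UQ scalerA aa scale1r -{3}(split1 _ v).
  by move=> /addIr e; rewrite -{2}e scalerA aa scale1r.
by rewrite pencil_adj mulmxDl -!mulmxA UP QUv -scalerDr split1.
Qed.

(** The two components, on the ranges of [P] and [Q], of [(z' P + Q) U v = (P + z Q) v]. In contrast
    with [Phi v = z v], they lose nothing when [z = 0]. *)
Definition pencil_eigvec v (z z' : C) :=
  [/\ v != 0, z' *: (P *m (U *m v)) = P *m v & Q *m (U *m v) = z *: (Q *m v)].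

Let Phi p := (Q + p *: P) *m U.
Let Psi p := U^t* *m (P + p *: Q).

Lemma pencil_factor_sum p : F^t* + p *: F = Phi p + Psi p.
Proof.
rewrite pencil_adj /Phi /Psi /pencil_mx; move: Q => q.
rewrite !mulmxDr !mulmxDl -!scalemxAl -!scalemxAr scalerDr.
by rewrite [U^t* *m P + _]addrC addrACA.
Qed.

Lemma pencil_factor_mul p : Phi p *m Psi p = p%:M.
Proof.
rewrite /Phi /Psi mulmxA -[_ *m U *m _]mulmxA UU' mulmx1.
move: PQ QP QQ PQ1; move: Q => q Pq qP qq Pq1.
rewrite !mulmxDr !mulmxDl -!scalemxAl -!scalemxAr PP qq Pq qP.
by rewrite !scaler0 addr0 add0r -scalerDr Pq1 scalemx1.
Qed.

Let Phi_eig v z z' : v != 0 -> z != 0 -> Phi (z * z') *m v = z *: v ->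
  pencil_eigvec v z z'.
Proof.
move=> v0 z0; rewrite /Phi -mulmxA => e; split=> //.
  have := congr1 (mulmx P) e.
  rewrite mulmxA [P *m _]mulmxDr PQ -scalemxAr PP add0r -scalemxAl -scalemxAr.
  by rewrite -scalerA => /(scalerI z0).
have := congr1 (mulmx Q) e.
by rewrite mulmxA [Q *m (_ + _)]mulmxDr QQ -scalemxAr QP scaler0 addr0 -scalemxAr.
Qed.

Let det_variety_factor z z' : det_variety F (symmetrization (z, z')) ->
  exists v, [/\ v != 0,
    Phi (z * z') *m v + Psi (z * z') *m v = (z + z') *: v &
    Phi (z * z') *m (Phi (z * z') *m v - z *: v) =
      z' *: (Phi (z * z') *m v - z *: v)].
Proof.
rewrite /det_variety /= => /det0_colP[v v0]; rewrite mulmxBl mul_scalar_mx.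
move/eqP; rewrite subr_eq0 pencil_factor_sum mulmxDl => /eqP e.
exists v; split=> //.
have eP := congr1 (mulmx (Phi (z * z'))) e.
rewrite mulmxDr -scalemxAr in eP.
rewrite [Phi _ *m (Psi _ *m _)]mulmxA pencil_factor_mul mul_scalar_mx in eP.
rewrite mulmxBr -scalemxAr (canRL (addrK _) eP).
move: (Phi _ *m v) => y.
by apply/matrixP => i j; rewrite !mxE; ring.
Qed.

(** At [p = 0], [Phi v] is an eigenvector of [Phi] for [z] if it is nonzero. Otherwise
    [Psi v = z v], and applying [U] gives [P v = z U v]. *)
Let det_variety_eigvec0 z : z != 0 -> det_variety F (symmetrization (0, z)) ->
  (exists v, pencil_eigvec v 0 z) \/ (exists v, pencil_eigvec v z 0).
Proof.
move=> z0 /det_variety_factor[v [v0]]; rewrite mul0r add0r scale0r subr0 => e ew.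
have [w0|w0] := eqVneq (Phi 0 *m v) 0; last first.
  by right; exists (Phi 0 *m v); apply: Phi_eig; rewrite ?mulr0.
left; exists v; split=> //.
  move: e; rewrite w0 add0r /Psi scale0r addr0 -mulmxA => e.
  have := congr1 (mulmx U) e; rewrite mulmxA UU' mul1mx -scalemxAr => e'.
  by rewrite scalemxAr -e' mulmxA PP.
by move: w0; rewrite /Phi scale0r addr0 scale0r -mulmxA.
Qed.

(* [(Phi - z) (Phi - z') = Phi (Phi + Psi - (z + z'))], since [Phi Psi = z z']. *)
Lemma det_variety_eigvec z z' :
  det_variety F (symmetrization (z, z')) ->
  [\/ exists v, pencil_eigvec v z z', exists v, pencil_eigvec v z' z |
      z = 0 /\ z' = 0].
Proof.
have [->|z0] := eqVneq z 0; have [->|z'0] := eqVneq z' 0.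
- by constructor 3.
- by case/(det_variety_eigvec0 z'0); [constructor 1|constructor 2].
- rewrite /symmetrization /= addrC mulrC.
  by case/(det_variety_eigvec0 z0); [constructor 2|constructor 1].
case/det_variety_factor=> v [v0 _ ew].
have [w0|w0] := eqVneq (Phi (z * z') *m v - z *: v) 0.
  constructor 1; exists v; apply: Phi_eig => //.
  by apply/eqP; rewrite -subr_eq0 w0.
constructor 2; exists (Phi (z * z') *m v - z *: v).
by apply: Phi_eig => //; rewrite mulrC.
Qed.

(** Pythagoras for [P] and [Q] on both sides of [|U v|^2 = |v|^2]. When both vectors are nonzero,
    [1 - |z|] and [1 - |z'|] therefore have the same sign. *)
Lemma pencil_eigvec_sqnorm v z z' : pencil_eigvec v z z' ->
  (1 - `|z'| ^+ 2) * sqnorm (P *m (U *m v)) = (1 - `|z| ^+ 2) * sqnorm (Q *m v).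
Proof.
move=> [_ eP eQ].
have pyth w : sqnorm w = sqnorm (P *m w) + sqnorm (Q *m w).
  have proj_sq (E : 'M[C]_d) : E *m E = E -> E^t* = E ->
      sqnorm (E *m w) = (w^t* *m E *m w) 0 0.
    by move=> EE Es; rewrite /sqnorm adjmxM Es mulmxA -[w^t* *m E *m E]mulmxA EE.
  rewrite !proj_sq //; transitivity ((w^t* *m (P + Q) *m w) 0 0).
    by rewrite PQ1 mulmx1.
  by move: Q => q; rewrite mulmxDr mulmxDl mxE.
have : sqnorm (U *m v) = sqnorm v.
  by rewrite /sqnorm adjmxM -mulmxA [U^t* *m _]mulmxA UU mul1mx.
rewrite [LHS]pyth [RHS]pyth eQ -eP !sqnormZ => e.
apply/eqP; rewrite -subr_eq0; apply/eqP.
rewrite -(subrr (`|z'| ^+ 2 * sqnorm (P *m (U *m v)) + sqnorm (Q *m v))) -{1}e.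
by ring.
Qed.

(** The degenerate cases of the norm comparison: here and in the next lemma [v] becomes a common
    eigenvector of [P] and [U]. *)
Lemma pencil_eigvec_range v z z' : pencil_eigvec v z z' ->
  Q *m v = 0 -> P *m v = v /\ exists a, U *m v = a *: v.
Proof.
move=> [v0 eP eQ] Qv; have Pv : P *m v = v.
  by rewrite -[RHS]mul1mx -PQ1 mulmxDl Qv addr0.
have Uv : U *m v = P *m (U *m v).
  by rewrite -[LHS]mul1mx -PQ1 mulmxDl eQ Qv scaler0 addr0.
split=> //; exists z'^-1; rewrite Uv; rewrite Pv in eP.
have z'0 : z' != 0 by apply: contraNneq v0 => z'0; rewrite -eP z'0 scale0r.
by rewrite -{2}eP scalerA mulVf // scale1r.
Qed.

Lemma pencil_eigvec_range_compl v z z' : pencil_eigvec v z z' ->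
  P *m (U *m v) = 0 -> Q *m v = v /\ exists a, U *m v = a *: v.
Proof.
move=> [v0 eP eQ] PUv; have Pv : P *m v = 0 by rewrite -eP PUv scaler0.
have Qv : Q *m v = v by rewrite mulmxBl mul1mx Pv subr0.
split=> //; exists z.
by rewrite -[LHS]mul1mx -PQ1 mulmxDl PUv add0r eQ Qv.
Qed.

End Pencil.

(** * Varieties and irreducible components *)

Section PencilPolynomial.
Variables (C : numClosedFieldType) (d : nat).
Implicit Types (F : 'M[C]_d).

(** The characteristic polynomial agrees with the determinant up to sign and is monic in [s], so no
    fibre over [p] loses degree. *)
Definition pencil_poly F : {poly {poly C}} :=
  char_poly (map_mx polyC (F^t*) + 'X *: map_mx polyC F).

Lemma pencil_poly_monic F : pencil_poly F \is monic.
Proof. exact: char_poly_monic. Qed.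

Lemma size_pencil_poly F : size (pencil_poly F) = d.+1.
Proof. exact: size_char_poly. Qed.

Lemma fibre_pencil_poly F p :
  fibre p (pencil_poly F) = char_poly (F^t* + p *: F).
Proof.
rewrite /fibre /pencil_poly map_char_poly; congr char_poly.
apply/matrixP => i j; rewrite !mxE /horner_eval.
by rewrite /= /horner_eval !hornerE.
Qed.

Lemma pencil_poly_eq0 F s p :
  (pencil_poly F).[s, p] = 0 <-> \det (F^t* + p *: F - s%:M) = 0.
Proof.
rewrite hornerXY_fibre fibre_pencil_poly; split=> [/eqP|/det0_colP[v v0 Fv]].
  rewrite -[_ == 0]/(root _ _) -eigenvalue_root_char.
  case/eigenvalueP=> v vF v0; apply/eqP/det0P; exists v => //.
  by rewrite mulmxBr vF mul_mx_scalar subrr.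
apply/eqP; rewrite -[_ == 0]/(root _ _) -eigenvalue_root_char.
have /eqP/det0P[w w0 wF] : \det (F^t* + p *: F - s%:M) = 0.
  by apply/det0_colP; exists v.
apply/eigenvalueP; exists w => //; apply/eqP.
by rewrite -subr_eq0 -[s *: w]mul_mx_scalar -mulmxBr wF.
Qed.

Lemma det_varietyE F : det_variety F = zero_set (pencil_poly F).
Proof. by apply/seteqP; split=> -[s p] /pencil_poly_eq0. Qed.

End PencilPolynomial.

Section Varieties.
Variable C : numClosedFieldType.
Implicit Types (f g xi : {poly {poly C}}) (V W : set (C * C)).

Lemma zero_set_algebraic xi : algebraic_variety (zero_set xi).
Proof. by exists [set xi]; rewrite bigcap_set1. Qed.

Lemma zero_setM f g : zero_set (f * g) = zero_set f `|` zero_set g.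
Proof.
apply/seteqP; split=> z; rewrite /zero_set /= !hornerM.
  by move/eqP; rewrite mulf_eq0 => /orP[]/eqP; [left|right].
by case=> ->; rewrite ?mul0r ?mulr0.
Qed.

Lemma algebraic_varietyI V1 V2 : algebraic_variety V1 ->
  algebraic_variety V2 -> algebraic_variety (V1 `&` V2).
Proof. by move=> [S1 ->] [S2 ->]; exists (S1 `|` S2); rewrite bigcap_setU. Qed.

Lemma algebraic_separate V z : algebraic_variety V -> ~ V z ->
  exists2 xi, V `<=` zero_set xi & ~ zero_set xi z.
Proof.
move=> [S ->] nz; apply/not_exists2P => H; apply: nz => xi Sxi.
by have [nV|/contrapT] := H xi; first by case: nV => w; apply.
Qed.

Lemma irreducible_varietyU V V1 V2 : irreducible_variety V ->
  algebraic_variety V1 -> algebraic_variety V2 -> V `<=` V1 `|` V2 ->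
  V `<=` V1 \/ V `<=` V2.
Proof.
move=> [aV _ irr] a1 a2 sV.
have [] := irr (V `&` V1) (V `&` V2).
- exact: algebraic_varietyI.
- exact: algebraic_varietyI.
- by rewrite -setIUr; apply/esym/setIidPl.
- by move=> e; left; rewrite e; exact: subIsetr.
- by move=> e; right; rewrite e; exact: subIsetr.
Qed.

Lemma irreducible_variety_prod V (s : seq {poly {poly C}}) :
  irreducible_variety V -> V `<=` zero_set (\prod_(f <- s) f) ->
  exists2 f, f \in s & V `<=` zero_set f.
Proof.
move=> irr; elim: s => [|f s IHs].
  have [_ [z Vz] _] := irr; rewrite big_nil => /(_ z Vz).
  by rewrite /zero_set /= !hornerE => /eqP; rewrite oner_eq0.
rewrite big_cons zero_setM => /(irreducible_varietyU irr).
case=> [|||/IHs[g gs Vg]]; try exact: zero_set_algebraic.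
  by exists f => //; rewrite mem_head.
by exists g => //; rewrite inE gs orbT.
Qed.

(** If neither part were everything, each would satisfy an equation not divisible by [f]; the
    product of the two vanishes on [zero_set f], against the primality of [f]. *)
Lemma zero_set_irreducible f : f \is monic -> irreducible_poly f ->
  irreducible_variety (zero_set f).
Proof.
move=> fm irr; split.
- exact: zero_set_algebraic.
- by have [s s0] := monic_fibre_root 0 fm irr.1; exists (s, 0).
move=> V1 V2 a1 a2 e; apply/or_asboolP/negPn; rewrite negb_or.
apply/negP => /andP[/asboolPn n1 /asboolPn n2].
have separate V : algebraic_variety V -> V `<=` zero_set f ->
    zero_set f <> V -> exists2 g, V `<=` zero_set g & ~~ (f %| g).
  move=> aV sV neV; have [z fz nVz] : exists2 z, zero_set f z & ~ V z.
    by apply/not_exists2P => H; apply: neV; apply/seteqP; split=> // z fz;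
      case: (H z) => [|/contrapT].
  have [g Vg ngz] := algebraic_separate aV nVz; exists g => //.
  by apply/negP => fg; apply: ngz; apply: monic_dvdp_vanish fz.
have [g1 V1g ng1] : exists2 g, V1 `<=` zero_set g & ~~ (f %| g).
  by apply: separate => //; rewrite e; exact: subsetUl.
have [g2 V2g ng2] : exists2 g, V2 `<=` zero_set g & ~~ (f %| g).
  by apply: separate => //; rewrite e; exact: subsetUr.
have : f %| g1 * g2.
  apply: irreducible_dvdp_vanish => // s p f0.
  have : (V1 `|` V2) (s, p) by rewrite -e.
  move=> H; suff : zero_set (g1 * g2) (s, p) by [].
  by rewrite zero_setM; case: H => [/V1g|/V2g]; [left|right].
by move/(irreducible_prime irr); rewrite (negPf ng1) (negPf ng2).
Qed.

Lemma monic_irreducible_eq f g : f \is monic -> g \is monic ->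
  irreducible_poly f -> irreducible_poly g ->
  zero_set f `<=` zero_set g -> f = g.
Proof.
move=> fm gm irrf irrg sfg.
have fg : f %| g by apply: irreducible_dvdp_vanish => // s p; exact: (sfg (s, p)).
have := irrg.2 f _ fg; rewrite gtn_eqF ?irrf.1 // => /(_ isT) efg.
have /Pdiv.IdomainMonic.dvdpP -/(_ fm)[q gq] := fg.
have sq : size q = 1%N.
  have := eqp_size efg; rewrite gq size_Mmonic //; last first.
    by apply: contraTneq gm => q0; rewrite gq q0 mul0r monicE lead_coef0 eq_sym oner_eq0.
  by have := irrf.1; case: (size q) => [|[|n]] //; lia.
have qm : q \is monic by rewrite -(monicMr q fm) -gq.
have /size1_polyC eq : (size q <= 1)%N by rewrite sq.
by move: (monicP qm); rewrite gq eq lead_coefC => ->; rewrite mul1r.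
Qed.

End Varieties.

(** * Existence and form of irreducible components *)

Section Components.
Variable C : numClosedFieldType.
Implicit Types (f g xi : {poly {poly C}}) (V W S : set (C * C)).

Definition zariski_closure S : set (C * C) :=
  \bigcap_(xi in [set xi | S `<=` zero_set xi]) zero_set xi.

Lemma zariski_closure_algebraic S : algebraic_variety (zariski_closure S).
Proof. by eexists. Qed.

Lemma sub_zariski_closure S : S `<=` zariski_closure S.
Proof. by move=> z Sz xi; apply. Qed.

Lemma zariski_closure_min S V : algebraic_variety V -> S `<=` V ->
  zariski_closure S `<=` V.
Proof.
by move=> [T ->] SV z clz xi Txi; apply: clz => w /SV; apply.
Qed.

(** If the chain is not contained in [V1], some member [V] is not, so [V] lies in [V2]. A member
    inside [V1] cannot contain [V], hence lies in [V]; so every member lies in [V2]. *)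
Lemma chain_irreducible (K : set (set (C * C))) : K !=set0 ->
  (forall V, K V -> irreducible_variety V) ->
  (forall V1 V2, K V1 -> K V2 -> V1 `<=` V2 \/ V2 `<=` V1) ->
  irreducible_variety (zariski_closure (\bigcup_(V in K) V)).
Proof.
move=> [V0 KV0] irrK chain; split.
- exact: zariski_closure_algebraic.
- have [_ [z V0z] _] := irrK _ KV0; exists z.
  by apply: sub_zariski_closure; exists V0.
move=> V1 V2 a1 a2 e.
have sub V : K V -> V `<=` V1 \/ V `<=` V2.
  move=> KV; apply: (irreducible_varietyU (irrK _ KV)) => //.
  by rewrite -e => z Vz; apply: sub_zariski_closure; exists V.
have [all1|/existsNP[V /not_implyP[KV nV1]]] :=
    pselect (forall V, K V -> V `<=` V1).
  left; apply/seteqP; split; last by rewrite e; exact: subsetUl.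
  by apply: zariski_closure_min => // z [V KV Vz]; exact: all1 Vz.
right; apply/seteqP; split; last by rewrite e; exact: subsetUr.
apply: zariski_closure_min => // z [V' KV' V'z].
have [V1'|] := sub V' KV'; last exact.
have [V'V|VV'] := chain V' V KV' KV.
  by have [/nV1|] := sub V KV; [|apply; exact: V'V].
by case: nV1; exact: subset_trans V1'.
Qed.

(** Zorn's lemma. The union of a chain need not be algebraic, so its Zariski closure serves as upper
    bound; it stays inside [W] because [W] is algebraic. *)
Lemma irreducible_component_exists W V0 : algebraic_variety W ->
  irreducible_variety V0 -> V0 `<=` W ->
  exists2 V, irreducible_component W V & V0 `<=` V.
Proof.
move=> aW irr0 V0W.
pose good V := [/\ irreducible_variety V, V0 `<=` V & V `<=` W].
pose T := {V | good V}.
pose rel_sub (s t : T) := `[< sval s `<=` sval t >].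
have rr t : rel_sub t t by apply/asboolP.
have rt r s t : rel_sub r s -> rel_sub s t -> rel_sub r t.
  by move=> /asboolP rs /asboolP st; apply/asboolP/(subset_trans rs).
have ra s t : rel_sub s t -> rel_sub t s -> s = t.
  move: s t => [s Ps] [t Pt] /asboolP st /asboolP ts; apply: eq_exist.
  by apply/seteqP.
have rc (A : set T) : total_on A (fun s t => rel_sub s t) ->
    exists t, forall s, A s -> rel_sub s t.
  move=> totA; have [A0|/set0P[t0 At0]] := eqVneq A set0.
    have P0 : [/\ irreducible_variety V0, V0 `<=` V0 & V0 `<=` W] by split.
    by exists (exist good V0 P0) => s; rewrite A0.
  pose K : set (set (C * C)) := [set sval t | t in A].
  have irrK : irreducible_variety (zariski_closure (\bigcup_(V in K) V)).
    apply: chain_irreducible; first by exists (sval t0); exists t0.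
      by move=> _ [[t [? ? ?]] _ <-].
    move=> _ _ [s As <-] [t At <-].
    by have [/asboolP|/asboolP] := totA s t As At; [left|right].
  have PK : [/\ irreducible_variety (zariski_closure (\bigcup_(V in K) V)),
      V0 `<=` zariski_closure (\bigcup_(V in K) V) &
      zariski_closure (\bigcup_(V in K) V) `<=` W].
    split=> //.
      move=> z V0z; apply: sub_zariski_closure; exists (sval t0); first by exists t0.
      by case: (svalP t0) => _ + _; apply.
    apply: zariski_closure_min => // z [_ [t At <-]].
    by case: (svalP t) => _ _; apply.
  exists (exist good _ PK) => s As; apply/asboolP => z sz /=.
  by apply: sub_zariski_closure; exists (sval s) => //; exists s.
have [[V [irrV V0V VW]] maxV] := Zorn rr rt ra rc.
exists V => //; split=> // V' irr' VV' V'W.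
have P' : [/\ irreducible_variety V', V0 `<=` V' & V' `<=` W].
  by split=> //; exact: subset_trans VV'.
have := maxV (exist good V' P'); rewrite /rel_sub /= => H.
by have [] : exist good V' P' = exist good V (And3 irrV V0V VW)
  by apply: H; apply/asboolP.
Qed.

Lemma monic_component f V : f \is monic ->
  irreducible_component (zero_set f) V ->
  exists g, [/\ g \is monic, irreducible_poly g & V = zero_set g].
Proof.
move=> fm [irrV Vf maxV].
have [s [es sm si]] := monic_irreducible_factorization fm.
rewrite es in Vf maxV; have [g gs Vg] := irreducible_variety_prod irrV Vf.
have gm : g \is monic by apply: (allP sm).
exists g; split=> //; first exact: si.
apply/esym/maxV => //; first by apply: zero_set_irreducible => //; exact: si.
rewrite (perm_big _ (perm_to_rem gs)) big_cons zero_setM; exact: subsetUl.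
Qed.

Lemma irreducible_factor_component f g : f \is monic -> g \is monic ->
  irreducible_poly g -> zero_set g `<=` zero_set f ->
  irreducible_component (zero_set f) (zero_set g).
Proof.
move=> fm gm irrg gf; split=> //; first exact: zero_set_irreducible.
move=> V irrV gV Vf; have [s [es sm si]] := monic_irreducible_factorization fm.
rewrite es in Vf; have [h hs Vh] := irreducible_variety_prod irrV Vf.
have hm : h \is monic by apply: (allP sm).
have gh : g = h.
  apply: monic_irreducible_eq => //; first exact: si.
  exact: subset_trans Vh.
by apply/seteqP; split=> //; rewrite gh.
Qed.

Lemma irreducible_linear (c : {poly C}) : irreducible_poly ('X - c%:P).
Proof. 
split; first by rewrite size_XsubC.
move=> q sq qd.
have q0 : q != 0 by apply: contraTneq qd => ->; rewrite dvd0p polyXsubC_eq0.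
rewrite -dvdp_size_eqp // size_XsubC eqn_leq.
have := dvdp_leq _ qd; rewrite polyXsubC_eq0 size_XsubC => /(_ isT) -> /=.
by rewrite ltn_neqAle eq_sym sq size_poly_gt0.
Qed.

End Components.

Lemma mulr_eq0_gt1 (R : realType) (x y : R) : x * y = 0 -> ~ (1 < x /\ 1 < y).
Proof. by move=> e [x1 y1]; nra. Qed.

(** * The equivalent conditions for one pencil *)

Section PencilEquivalences.
Variables (R : realType) (d : nat) (P U : 'M[R[i]]_d).
Hypothesis d_gt0 : (0 < d)%N.
Hypothesis Pproj : orthogonal_projection P.
Hypothesis Uunit : U \is unitarymx.
Local Notation C := R[i].
Local Notation F := (pencil_mx P U).
Local Notation W := (det_variety (pencil_mx P U)).
Local Notation Q := (1%:M - P).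

(** A reducing subspace on which [F] is unitary contains an eigenvector with [|a| = 1]. Then the
    symmetrization of [(conj(a), 0)] is a point of the variety on the topological boundary but off
    the distinguished one. *)
Lemma pencil_distinguished_cnu : distinguished_variety W ->
  completely_nonunitary F.
Proof.
move=> [_ _ eW] [M [M0 /andP[FM _] uM]].
have vM := memv_pick M; rewrite -vpick0 in M0.
have [a [v [v0 wM Fv]]] : exists a v, [/\ v != 0, v \in M & F *m v = a *: v].
  apply: (stable_eigenvector (Q := fun v => v \in M) _ _ M0 vM) => [w wM|a w w' *].
    by rewrite -[F *m w](lfunE (mulmx F)); apply/(subvP FM)/memv_img.
  by rewrite memvD ?memvZ.
have [FsFv _] := uM v wM.
have a1 : `|a| = 1.
  have : sqnorm (F *m v) = sqnorm v by rewrite /sqnorm adjmxM -mulmxA FsFv.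
  rewrite Fv sqnormZ -[RHS]mul1r => /mulIf; rewrite sqnorm_eq0 => /(_ v0) /eqP.
  by rewrite sqrp_eq1 // => /eqP.
have Fsv : F^t* *m v = a^* *: v.
  move: FsFv; rewrite Fv -scalemxAr => e.
  by rewrite -{2}e scalerA mulrC -normCK a1 expr1n scale1r.
have m0 : modulus (0 : C) = 0 := modulus0 R.
have ma : modulus a^* = 1 by rewrite modulusJ; apply/norm_eq1.
have : (W `&` boundary (sym_bidisk C)) (symmetrization (a^*, 0)).
  split; last first.
    apply/boundary_sym_bidisk_mem; rewrite /= m0 ma; split; first by rewrite lexx ler01.
    by case; rewrite ltxx.
  rewrite /det_variety /symmetrization /= mulr0 addr0 scale0r addr0.
  by apply/det0_colP; exists v => //; rewrite mulmxBl mul_scalar_mx Fsv subrr.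
rewrite eW => -[_ /dist_boundary_mem[_ /=]]; rewrite m0 => /eqP.
by rewrite eq_sym oner_eq0.
Qed.

(** By [pencil_unimodular_eigen], an eigenvector for a unimodular eigenvalue is also one of the
    adjoint, so its line reduces [F] to a unitary. *)
Lemma pencil_cnu_spectrum : completely_nonunitary F ->
  spectrum F `&` unit_circle C = set0.
Proof.
move=> cnu; apply/seteqP; split=> // a [].
rewrite /spectrum /unit_circle /= unitmxE unitfE negbK => /eqP/det0_colP[v v0].
rewrite mulmxBl mul_scalar_mx => /eqP; rewrite subr_eq0 => /eqP Fv a1; apply: cnu.
have Fsv := pencil_unimodular_eigen Pproj Uunit a1 Fv.
have aa : a * a^* = 1 by rewrite -normCK a1 expr1n.
exists <[v]>%VS; split; [by rewrite -dimv_eq0 dim_vline v0|exact: reducing_line Fv Fsv|].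
move=> _ /vlineP[k ->].
rewrite -!scalemxAr Fv Fsv -!scalemxAr Fv Fsv !scalerA -!mulrA aa.
by rewrite [a^* * a]mulrC aa mulr1.
Qed.

Definition range_eigenvector (v : 'cV[C]_d) a :=
  [/\ v != 0, U *m v = a *: v & P *m v = v \/ Q *m v = v].

Lemma pencil_spectrum_eigenvector v a :
  spectrum F `&` unit_circle C = set0 -> ~ range_eigenvector v a.
Proof.
move=> sp0 [v0 Uv Pv]; have [a1 _] := unitary_eigen Uunit v0 Uv.
have [b b1 Fv] : exists2 b : C, `|b| = 1 & F *m v = b *: v.
  case: Pv => [Pv|Qv]; first by exists a => //; exact: (pencil_range Pproj).
  by exists a^*; [rewrite norm_conjC|exact: (pencil_range_compl Pproj)].
suff : (spectrum F `&` unit_circle C) b by rewrite sp0.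
split=> //; rewrite /spectrum /= unitmxE unitfE negbK; apply/eqP/det0_colP.
by exists v => //; rewrite mulmxBl mul_scalar_mx Fv subrr.
Qed.

Lemma no_eigenvector_no_reducing :
  (forall v a, ~ range_eigenvector v a) <->
  ~ exists M : {vspace 'cV[C]_d}, [/\ M != 0%VS, reducing U M &
      (M <= mx_range P)%VS || (M <= mx_range Q)%VS].
Proof.
have [QQ _] := orthogonal_projection_compl Pproj.
split=> [noev [M [M0 /andP[UM _] MP]]|nored v a [v0 Uv Pv]]; last first.
  have [_ Usv] := unitary_eigen Uunit v0 Uv; apply: nored; exists <[v]>%VS; split.
  - by rewrite -dimv_eq0 dim_vline v0.
  - exact: reducing_line Uv Usv.
  by apply/orP; rewrite -!memvE; case: Pv => /mem_mx_range; [left|right].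
have vM := memv_pick M; rewrite -vpick0 in M0.
have [a [w [w0 wM Uw]]] : exists a w, [/\ w != 0, w \in M & U *m w = a *: w].
  apply: (stable_eigenvector (Q := fun v => v \in M) _ _ M0 vM) => [w wM|a w w' *].
    by rewrite -[U *m w](lfunE (mulmx U)); apply/(subvP UM)/memv_img.
  by rewrite memvD ?memvZ.
apply: (noev w a); split=> //.
case/orP: MP => /subvP/(_ w wM) wR; [left|right]; apply: mx_rangeP => //.
by case: Pproj.
Qed.

Lemma pencil_variety_location (z : C * C) :
  (forall v a, ~ range_eigenvector v a) -> W (symmetrization z) ->
  [\/ modulus z.1 < 1 /\ modulus z.2 < 1, modulus z.1 = 1 /\ modulus z.2 = 1 |
      1 < modulus z.1 /\ 1 < modulus z.2].
Proof.
move=> noev; case: z => z z' Wz.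
have main (x y : C) v : pencil_eigvec P U v x y ->
    [\/ modulus x < 1 /\ modulus y < 1, modulus x = 1 /\ modulus y = 1 |
        1 < modulus x /\ 1 < modulus y].
  move=> ev; have := pencil_eigvec_sqnorm Pproj Uunit ev.
  have := sqnorm_ge0 (P *m (U *m v)); have := sqnorm_ge0 (Q *m v).
  have : sqnorm (Q *m v) <> 0.
    move=> /eqP; rewrite sqnorm_eq0 => /eqP /(pencil_eigvec_range ev)[Pv [a Uv]].
    by apply: (noev v a); split; [case: ev|by []|left].
  have : sqnorm (P *m (U *m v)) <> 0.
    move=> /eqP; rewrite sqnorm_eq0 => /eqP.
    case/(pencil_eigvec_range_compl ev) => Qv [a Uv].
    by apply: (noev v a); split; [case: ev|by []|right].
  move: (sqnorm _) (sqnorm _) => B A /eqP A0 /eqP B0 B1 A1.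
  have [b b0 eb] : exists2 b : R, 0 < b & B = (b%:C)%C.
    by apply: gt0c_real; rewrite lt0r B0.
  have [a a0 ea] : exists2 a : R, 0 < a & A = (a%:C)%C.
    by apply: gt0c_real; rewrite lt0r A0.
  rewrite ea eb !normE -!rmorphXn -(rmorph1 (real_complex R)) -!rmorphB -!rmorphM.
  move=> /complexI e; have := modulus_ge0 x; have := modulus_ge0 y => y0 x0.
  have [x1|x1|x1] := ltgtP (modulus x) 1.
  - constructor 1; split=> //.
    have : 0 < (1 - modulus x ^+ 2) * b by rewrite mulr_gt0 //; nra.
    by rewrite -e pmulr_lgt0 //; nra.
  - constructor 3; split=> //.
    have : (1 - modulus x ^+ 2) * b < 0 by rewrite pmulr_llt0 //; nra.
    by rewrite -e pmulr_llt0 //; nra.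
  constructor 2; split=> //.
  move: e; rewrite x1 expr1n subrr mul0r => /eqP; rewrite mulf_eq0 (gt_eqF a0) orbF.
  by rewrite subr_eq0 eq_sym sqrp_eq1 // => /eqP.
case/(det_variety_eigvec Pproj Uunit): Wz => [[v /main //]|[v /main]|[-> ->]] /=.
  by case=> -[? ?]; [constructor 1|constructor 2|constructor 3].
by constructor 1; rewrite modulus0.
Qed.

Lemma pencil_location_range :
  (forall z, W (symmetrization z) ->
    [\/ modulus z.1 < 1 /\ modulus z.2 < 1, modulus z.1 = 1 /\ modulus z.2 = 1 |
      1 < modulus z.1 /\ 1 < modulus z.2]) <->
  W `<=` @symmetrization C @`
    ((unit_disk C `*` unit_disk C) `|` (unit_circle C `*` unit_circle C) `|`
     (exterior_disk C `*` exterior_disk C)).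
Proof.
have ext (z : C) : exterior_disk C z <-> 1 < modulus z.
  by rewrite /exterior_disk /closed_unit_disk /setC /= norm_le1 ltNge; split=> /negP.
split=> [loc [s p]|sub z /sub[w Hw /symmetrization_inj ezw]].
  have [z <-] := symmetrizationP s p; move=> /loc H; exists z => //.
  case: H => -[h1 h2]; [left; left|left; right|right].
  - by split; rewrite /unit_disk /= norm_lt1.
  - by split; apply/norm_eq1.
  - by split; apply/ext.
have Hw' : [\/ modulus w.1 < 1 /\ modulus w.2 < 1,
      modulus w.1 = 1 /\ modulus w.2 = 1 | 1 < modulus w.1 /\ 1 < modulus w.2].
  case: Hw => [[[h1 h2]|[/norm_eq1 h1 /norm_eq1 h2]]|[/ext h1 /ext h2]].
  - by constructor 1; rewrite -!norm_lt1.
  - by constructor 2.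
  - by constructor 3.
by case: ezw => -> //=; case: Hw' => -[]; [constructor 1|constructor 2|constructor 3].
Qed.

Hypothesis loc : forall z, W (symmetrization z) ->
    [\/ modulus z.1 < 1 /\ modulus z.2 < 1, modulus z.1 = 1 /\ modulus z.2 = 1 |
      1 < modulus z.1 /\ 1 < modulus z.2].

(** Every monic factor has a zero over [p = 0]. There the product of the two parameters is [0],
    which excludes the torus and the exterior and leaves the bidisk. *)
Lemma pencil_location_components V : irreducible_component W V ->
  V `&` sym_bidisk C !=set0.
Proof.
rewrite det_varietyE => comp.
have [g [gm irrg eV]] := monic_component (pencil_poly_monic F) comp.
have [s s0] := monic_fibre_root 0 gm irrg.1.
exists (s, 0); split; first by rewrite eV.
have [z ez] := symmetrizationP s 0; rewrite -ez.
have : W (symmetrization z).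
  by rewrite ez det_varietyE; case: comp => _ sub _; apply: sub; rewrite eV.
have : modulus z.1 * modulus z.2 = 0.
  by case: ez => _ e; rewrite -modulusM e modulus0.
move=> e /loc[]; first by move/sym_bidisk_mem.
  by case=> h1 h2; move: e; rewrite h1 h2 mulr1 => /eqP; rewrite oner_eq0.
by move=> h; case: (mulr_eq0_gt1 e h).
Qed.

Lemma pencil_location_distinguished : distinguished_variety W.
Proof.
have sizeF : (1 < size (pencil_poly F))%N by rewrite size_pencil_poly ltnS.
split.
- by exists (pencil_poly F); exact: det_varietyE.
- have [s s0] := monic_fibre_root 0 (pencil_poly_monic F) sizeF.
  exists (s, 0); have Ws : W (s, 0) by rewrite det_varietyE.
  split=> //; have [z ez] := symmetrizationP s 0; rewrite -ez in Ws *.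
  apply/sym_bidisk_mem; have : modulus z.1 * modulus z.2 = 0.
    by case: ez => _ e; rewrite -modulusM e modulus0.
  move=> e; case: (loc Ws) => // [|h]; last by case: (mulr_eq0_gt1 e h).
  move=> [h1 h2].
  by move: e; rewrite h1 h2 mulr1 => /eqP; rewrite oner_eq0.
apply/seteqP; split=> -[s p]; have [z <-] := symmetrizationP s p.
  move=> [Wz /boundary_sym_bidisk_mem[[z1 z2] nz]]; split=> //.
  by apply/dist_boundary_mem; case: (loc Wz) => // -[h1 _]; rewrite ltNge z1 in h1.
move=> [Wz /dist_boundary_mem[z1 z2]]; split=> //.
by apply/boundary_sym_bidisk_mem; rewrite z1 z2 ltxx; split => // -[].
Qed.

End PencilEquivalences.

Section PencilComponents.
Variables (R : realType) (d : nat) (P U : 'M[R[i]]_d).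
Hypothesis Pproj : orthogonal_projection P.
Hypothesis Uunit : U \is unitarymx.
Local Notation C := R[i].
Local Notation F := (pencil_mx P U).
Local Notation W := (det_variety (pencil_mx P U)).

(* An eigenvector of [U] in the range of [P] or of [1 - P] is a common
   eigenvector of [F] and [F^*], which puts a whole complex line
   [{pi (b^*, b p)}] into the variety; that line is a component missing the
   symmetrized bidisk. *)
Lemma pencil_components_no_eigenvector v a :
  (forall V, irreducible_component W V -> V `&` sym_bidisk C !=set0) ->
  ~ range_eigenvector P U v a.
Proof.
move=> comps [v0 Uv Pv]; have [a1 _] := unitary_eigen Uunit v0 Uv.
have [b b1 Fv] : exists2 b : C, `|b| = 1 & F *m v = b *: v.
  case: Pv => [Pv|Qv]; first by exists a => //; exact: (pencil_range Pproj).
  by exists a^*; [rewrite norm_conjC|exact: (pencil_range_compl Pproj)].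
have Fsv := pencil_unimodular_eigen Pproj Uunit b1 Fv.
pose c : {poly C} := (b^*)%:P + b *: 'X.
have cE s p : ('X - c%:P).[s, p] = s - (b^* + b * p).
  by rewrite !hornerE.
have : irreducible_component W (zero_set ('X - c%:P)).
  rewrite det_varietyE; apply: irreducible_factor_component.
  - exact: pencil_poly_monic.
  - exact: monicXsubC.
  - exact: irreducible_linear.
  move=> [s p]; rewrite /zero_set /= cE => /eqP; rewrite subr_eq0 => /eqP ->.
  apply/pencil_poly_eq0/det0_colP; exists v => //.
  rewrite mulmxBl mulmxDl Fsv -scalemxAl Fv mul_scalar_mx scalerDl scalerA.
  by rewrite [p * b]mulrC subrr.
move/comps => [[s p] []]; rewrite /zero_set /= cE => /eqP; rewrite subr_eq0.
move=> /eqP ->; have bb : b^* * b = 1 by rewrite mulrC -normCK b1 expr1n.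
have -> : (b^* + b * p, p) = symmetrization (b^*, b * p).
  by rewrite /symmetrization /= mulrA bb mul1r.
by move=> /sym_bidisk_mem[/=]; rewrite modulusJ (norm_eq1 b).1 // ltxx.
Qed.

(** At [p = 1] the pencil is [U] plus its adjoint, so an eigenvalue [a] of [U] gives the point with
    parameters [a] and [conj(a)]. *)
Lemma det_variety_meets_closed : (0 < d)%N -> W `&` closed_sym_bidisk C !=set0.
Proof.
move=> d0.
have [a [v [v0 _ Uv]]] : exists a (v : 'cV[C]_d), [/\ v != 0, True & U *m v = a *: v].
  have c0 : const_mx 1 != 0 :> 'cV[C]_d.
    apply/eqP => /matrixP/(_ (Ordinal d0) 0); rewrite !mxE => /eqP.
    by rewrite oner_eq0.
  exact: (@stable_eigenvector _ _ U (fun=> True) _ (fun _ _ => I)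
    (fun _ _ _ _ _ => I) c0 I).
have [a1 Usv] := unitary_eigen Uunit v0 Uv.
have aa : a * a^* = 1 by rewrite -normCK a1 expr1n.
exists (symmetrization (a, a^*)); split.
  apply/det0_colP; exists v => //; rewrite /= aa (pencil_factor_sum _ Pproj) !scale1r.
  rewrite subrK mul1mx [P + _]addrC subrK mulmx1 mulmxBl mulmxDl Uv Usv mul_scalar_mx.
  by rewrite -scalerDl subrr.
have m1 : modulus a = 1 by apply/norm_eq1.
by apply/closed_sym_bidisk_mem; rewrite /= modulusJ m1 lexx.
Qed.

End PencilComponents.

(** * Fejer-Riesz factorization on the unit circle *)

Section GenericCircle.
Variable C : numClosedFieldType.
Implicit Types (p : C) (a b c e : {poly C}).

Lemma norm1_conjC p : `|p| = 1 -> p^* = p^-1.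
Proof.
move=> p1; have p0 : p != 0 by rewrite -normr_gt0 p1 ltr01.
by apply: (mulfI p0); rewrite -normCK p1 expr1n divff.
Qed.

(** The Cayley transform of the natural numbers: infinitely many points of the circle, converging to
    [1]. *)
Definition circle_point (n : nat) : C := (n%:R + 'i) / (n%:R - 'i).

Lemma circle_point_prod n : (n%:R + 'i) * (n%:R - 'i) = (n ^ 2)%N.+1%:R :> C.
Proof.
transitivity ((n%:R ^+ 2 - 'i ^+ 2) : C); first by ring.
by rewrite sqrCi opprK -natrX natr1.
Qed.

Lemma circle_point_den n : (n%:R - 'i : C) != 0.
Proof.
have := circle_point_prod n => /eqP; apply: contraTneq => ->.
by rewrite mulr0 eq_sym pnatr_eq0.
Qed.

Lemma circle_point_norm n : `|circle_point n| = 1.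
Proof.
rewrite /circle_point normrM normfV.
have e : n%:R - 'i = (n%:R + 'i : C)^* by rewrite rmorphD /= conjC_nat conjCi.
rewrite e norm_conjC mulfV // normr_eq0.
by have := circle_point_den n; rewrite e conjC_eq0.
Qed.

Lemma circle_pointB1 n : circle_point n - 1 = 2 * 'i / (n%:R - 'i).
Proof. by rewrite /circle_point; have := circle_point_den n => d0; field. Qed.

Lemma circle_point_inj : injective circle_point.
Proof.
move=> m n /(congr1 (fun z => z - 1)); rewrite !circle_pointB1.
move/mulfI; rewrite mulf_eq0 pnatr_eq0 /= neq0Ci => /(_ isT).
by move=> /invr_inj /addIr /eqP; rewrite eqr_nat => /eqP.
Qed.

(** Validity off finitely many points of the circle. With the exceptions given as zeros of a
    polynomial, conjunctions correspond to products. *)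
Definition generic_circle (A : C -> Prop) :=
  exists2 c, c != 0 & forall p, `|p| = 1 -> c.[p] != 0 -> A p.

Lemma generic_circle_mono (A B : C -> Prop) :
  (forall p, `|p| = 1 -> A p -> B p) -> generic_circle A -> generic_circle B.
Proof. by move=> AB [c c0 cA]; exists c => // p p1 /(cA p p1); apply: AB. Qed.

Lemma generic_circleI (A B : C -> Prop) : generic_circle A ->
  generic_circle B -> generic_circle (fun p => A p /\ B p).
Proof.
move=> [c c0 cA] [e e0 eB]; exists (c * e); first by rewrite mulf_neq0.
by move=> p p1; rewrite hornerM mulf_eq0 negb_or => /andP[/(cA p p1) ? /(eB p p1)].
Qed.

Lemma generic_circleT (A : C -> Prop) :
  (forall p, `|p| = 1 -> A p) -> generic_circle A.
Proof. by move=> H; exists 1; rewrite ?oner_neq0 // => p p1 _; exact: H. Qed.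

Lemma generic_circle_neq0 c : c != 0 -> generic_circle (fun p => c.[p] != 0).
Proof. by exists c. Qed.

Lemma generic_circle_poly_eq a b : generic_circle (fun p => a.[p] = b.[p]) -> a = b.
Proof.
move=> [c c0 cab]; apply/eqP; rewrite -subr_eq0.
suff /eqP : (a - b) * c = 0 by rewrite mulf_eq0 (negPf c0) orbF.
apply: (poly_eq0_inj_seq circle_point_inj) => n; rewrite hornerM.
have [->|cn] := eqVneq c.[circle_point n] 0; first by rewrite mulr0.
by rewrite hornerD hornerN (cab _ (circle_point_norm n) cn) subrr mul0r.
Qed.

Lemma generic_circle_absurd : ~ generic_circle (fun _ => False).
Proof.
move=> [c c0 H]; case/eqP: (c0); apply: (poly_eq0_inj_seq circle_point_inj) => n.
by apply/eqP/negPn/negP => /(H _ (circle_point_norm n)).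
Qed.

(** The polynomial [p^L conj(a(1 / conj(p)))]; on the circle it stands for [conj(a(p))] up to the
    factor [p^L]. *)
Definition poly_reflect (L : nat) a : {poly C} := \poly_(i < L.+1) (a`_(L - i))^*.

Lemma poly_reflectE L a p : (size a <= L.+1)%N -> p != 0 ->
  (poly_reflect L a).[p] = p ^+ L * (a.[(p^*)^-1])^*.
Proof.
move=> sa p0; rewrite horner_poly (horner_coef_wide _ sa).
rewrite rmorph_sum /= mulr_sumr (reindex_inj rev_ord_inj) /=; apply: eq_bigr => i _.
have iL : (i <= L)%N by rewrite -ltnS ltn_ord.
rewrite subSS subKn // rmorphM rmorphXn /= fmorphV /= conjCK.
rewrite mulrCA; congr (_ * _); rewrite exprVn.
have e : p ^+ L = p ^+ (L - i) * p ^+ i by rewrite -exprD subnK.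
by rewrite e mulfK // expf_neq0.
Qed.

Lemma poly_reflect_circle L a p : (size a <= L.+1)%N -> `|p| = 1 ->
  (poly_reflect L a).[p] = p ^+ L * (a.[p])^*.
Proof.
move=> sa p1; have p0 : p != 0 by rewrite -normr_gt0 p1 ltr01.
by rewrite poly_reflectE // (norm1_conjC p1) invrK.
Qed.

End GenericCircle.

Section Circle.
Variable R : realType.
Local Notation C := R[i].
Implicit Types (p q u x y : C) (a b c e : {poly C}).

Lemma horner_continuous a x (eps : R) : 0 < eps ->
  exists2 del : R, 0 < del &
    forall y, modulus (y - x) < del -> modulus (a.[y] - a.[x]) < eps.
Proof.
move=> eps0; have [q eq] : exists q : {poly C}, a - (a.[x])%:P = q * ('X - x%:P).
  by apply/factor_theorem; rewrite /root !hornerE subrr.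
pose B : R := \sum_(i < size q) modulus q`_i * (modulus x + 1) ^+ i.
have B0 : 0 <= B.
  by apply: sumr_ge0 => i _; rewrite mulr_ge0 ?modulus_ge0 // exprn_ge0 // addr_ge0 ?modulus_ge0.
exists (Num.min 1 (eps / (B + 1))).
  by rewrite lt_min ltr01 divr_gt0 // ltr_wpDl.
move=> y; rewrite lt_min => /andP[y1 yB].
have -> : a.[y] - a.[x] = q.[y] * (y - x).
  by have := congr1 (fun f => f.[y]) eq; rewrite !hornerE.
have qB : modulus q.[y] <= B.
  rewrite horner_coef; apply: le_trans (modulus_sum _ _ _) _.
  apply: ler_sum => i _; rewrite modulusM modulusX ler_wpM2l ?modulus_ge0 //.
  rewrite lerXn2r ?nnegrE ?addr_ge0 ?modulus_ge0 //.
  by have := modulusD (y - x) x; rewrite subrK; lra.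
rewrite modulusM; apply: (@le_lt_trans _ _ (B * modulus (y - x))).
  by rewrite ler_wpM2r ?modulus_ge0.
apply: (@le_lt_trans _ _ ((B + 1) * modulus (y - x))).
  by rewrite ler_wpM2r ?modulus_ge0 // lerDl.
by rewrite mulrC -ltr_pdivlMr // ltr_wpDl.
Qed.

Lemma ge0c_real x : 0 <= x -> exists2 r : R, 0 <= r & x = (r%:C)%C.
Proof.
move=> x0; have xr : x = ((complex.Re x)%:C)%C by rewrite RRe_real // ger0_real.
by exists (complex.Re x) => //; rewrite -lecR -xr.
Qed.

Lemma modulus_circle_point n : modulus (circle_point C n) = 1.
Proof. by apply/norm_eq1; exact: circle_point_norm. Qed.

Lemma circle_point_near (eps : R) : 0 < eps ->
  exists N, forall n, (N <= n)%N -> modulus (circle_point C n - 1) < eps.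
Proof.
move=> eps0; exists (Num.truncn (2 / eps)).+2 => n Nn.
have n0 : (0 < n%:R - 1 :> R) by rewrite subr_gt0 ltr1n; lia.
rewrite circle_pointB1 !modulusM modulusV.
have -> : modulus (2 : C) = 2.
  by rewrite -[X in modulus X](rmorph_nat (real_complex R)) modulus_realc normr_nat.
have -> : modulus 'i = 1 :> R by rewrite /modulus normCi.
have le : n%:R - 1 <= modulus (n%:R - 'i : C).
  have := modulusB_ge (n%:R : C) 'i.
  rewrite -[X in modulus X - _](rmorph_nat (real_complex R)) modulus_realc normr_nat.
  by rewrite /modulus normCi.
rewrite mulr1 ltr_pdivrMr; last exact: lt_le_trans le.
apply: (@lt_le_trans _ _ (eps * (n%:R - 1))); last by rewrite ler_wpM2l ?(ltW eps0).
rewrite mulrC -ltr_pdivrMr // ltrBrDr.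
apply: (@lt_le_trans _ _ ((Num.truncn (2 / eps)).+1%:R + 1)).
  by rewrite ltrD2r truncnS_gt.
by rewrite natr1 ler_nat.
Qed.

Lemma generic_circle_near (A : C -> Prop) (b : C) (eps : R) : generic_circle A ->
  modulus b = 1 -> 0 < eps ->
  exists2 p, modulus p = 1 /\ modulus (p - b) < eps & A p.
Proof.
move=> [c c0 cA] b1 eps0; have [N hN] := circle_point_near eps0.
have b0 : b != 0 by rewrite -modulus_gt0 b1.
apply: contrapT => nex; case/eqP: c0.
apply: (@poly_eq0_inj_seq _ (fun n => b * circle_point C (N + n))) => [m n /(mulfI b0)|n].
  by move=> /circle_point_inj /addnI.
apply/eqP/negPn/negP => cn; apply: nex; exists (b * circle_point C (N + n)).
  rewrite modulusM b1 modulus_circle_point mulr1; split=> //.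
  have -> : b * circle_point C (N + n) - b = b * (circle_point C (N + n) - 1) by ring.
  by rewrite modulusM b1 mul1r hN ?leq_addr.
apply: cA => //; apply/norm_eq1.
by rewrite modulusM b1 modulus_circle_point mulr1.
Qed.

(* The two nearby points [b u] and [b u^*] lie on opposite sides of [b], where a
   factor [X - b] of a nonnegative trigonometric polynomial changes sign. *)
Lemma circle_root_double a (b : C) m K : modulus b = 1 ->
  generic_circle (fun p => 0 <= (('X - b%:P) * a).[p] * p ^+ m * p ^- K) ->
  a.[b] = 0.
Proof.
move=> b1 [c c0 Hpos]; apply/eqP/negPn/negP => ab.
have b0 : b != 0 by rewrite -modulus_gt0 b1.
pose g := modulus a.[b] ^+ 2.
have g0 : 0 < g by rewrite exprn_gt0 // modulus_gt0.
pose cj (q : {poly C}) := map_poly Num.Def.conjC (q \Po (b *: 'X)).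
have bXE (q : {poly C}) u : (q \Po (b *: 'X)).[u] = q.[b * u] by rewrite horner_comp !hornerE.
have cjE (q : {poly C}) u : (cj q).[u] = (q.[b * u^*])^*.
  by rewrite -bXE -[in LHS](conjCK u) horner_map.
(* On the unit circle the product of the two nonnegative values at [b u] and [b conj(u)] is
   [- |u - 1|^2 G(u) conj(H(u))], where [G(1) = g > 0] and [H(1) = 1]; near [u = 1] this cannot be
   nonnegative. *)
pose G := 'X^((m + m).+1) * (a \Po (b *: 'X)) * cj a.
pose H : {poly C} := 'X^(K + K).
have GE u : G.[u] = u ^+ (m + m).+1 * a.[b * u] * (a.[b * u^*])^*.
  by rewrite /G !hornerM hornerXn bXE cjE.
have G1 : G.[1] = (g%:C)%C.
  rewrite GE conjC1 !mulr1 expr1n mul1r.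
  by rewrite mulJ_modulus.
have H1 : H.[1] = 1 by rewrite hornerXn expr1n.
pose eps := Num.min 1 (g / 4).
have eps0 : 0 < eps by rewrite lt_min ltr01 divr_gt0.
have [d1 d10 hd1] := horner_continuous G 1 eps0.
have eps2 : 0 < 1 / 4 :> R by rewrite divr_gt0 ?ltr0n.
have [d2 d20 hd2] := horner_continuous H 1 eps2.
have [u [u1 ud] [cu [cu' un1]]] : exists2 u,
    modulus u = 1 /\ modulus (u - 1) < Num.min d1 d2 &
    c.[b * u] != 0 /\ c.[b * u^*] != 0 /\ u != 1.
  have comp0 : c \Po (b *: 'X) != 0.
    have [x cx] := poly_neq0_horner c0; apply: contraNneq cx => e0.
    by rewrite -[x](mulVKf b0) -bXE e0 horner0.
  have cj0 : cj c != 0 by rewrite map_poly_eq0.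
  have X0 : ('X - 1%:P : {poly C}) != 0 by rewrite polyXsubC_eq0.
  have gen := generic_circleI (generic_circle_neq0 comp0)
    (generic_circleI (generic_circle_neq0 cj0) (generic_circle_neq0 X0)).
  have d120 : 0 < Num.min d1 d2 by rewrite lt_min d10.
  have [u [u1 ud] [cu [cu' Xu]]] := generic_circle_near gen (modulus1 R) d120.
  exists u; split=> //; first by rewrite -bXE.
  split; first by apply: contraNneq cu' => e0; rewrite cjE e0 conjC0.
  by rewrite !hornerE subr_eq0 in Xu.
move: ud; rewrite lt_min => /andP[/hd1 hG /hd2 hH].
have ubar : modulus u^* = 1 by rewrite modulusJ.
have mb x : modulus x = 1 -> `|b * x| = 1.
  by move=> x1; apply/norm_eq1; rewrite modulusM b1 mul1r.
have Pp := Hpos _ (mb _ u1) cu; have Pm := Hpos _ (mb _ ubar) cu'.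
have u0 : u != 0 by rewrite -modulus_gt0 u1.
have uc := modulus1_conj u1; have bc := modulus1_conj b1.
have : 0 <= - G.[u] * (H.[u])^*.
  have mu0 : 0 < ((modulus (u - 1) ^+ 2)%:C)%C.
    by rewrite ltcR exprn_gt0 // modulus_gt0 subr_eq0.
  rewrite -(pmulr_rge0 _ mu0) -mulJ_modulus.
  have -> : (u - 1) * (u - 1)^* * (- G.[u] * (H.[u])^*) =
     (('X - b%:P) * a).[b * u] * (b * u) ^+ m / (b * u) ^+ K *
     ((('X - b%:P) * a).[b * u^*] * (b * u^*) ^+ m / (b * u^*) ^+ K)^*.
    rewrite GE /H hornerXn !hornerM !hornerXsubC !(rmorphM, rmorphB, rmorphXn, fmorphV) /=.
    rewrite !conjCK conjC1 bc uc !exprMn !exprVn exprS !exprD.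
    have bm0 : b ^+ m != 0 by rewrite expf_neq0.
    have um0 : u ^+ m != 0 by rewrite expf_neq0.
    have bK0 : b ^+ K != 0 by rewrite expf_neq0.
    have uK0 : u ^+ K != 0 by rewrite expf_neq0.
    move: (b ^+ m) (u ^+ m) (b ^+ K) (u ^+ K) bm0 um0 bK0 uK0 => bm um bK uK bm0 um0 bK0 uK0.
    move: (a.[_]) (a.[_]^*) => A B.
    by field; rewrite ?b0 ?u0 ?bm0 ?um0 ?bK0 ?uK0.
  by rewrite mulr_ge0 // conjC_ge0.
move/ge0c_real=> [r r0 w0].
have mH : modulus H.[u] = 1 by rewrite hornerXn modulusX u1 expr1n.
have : g <= modulus (- G.[u] * (H.[u])^* + (g%:C)%C).
  by rewrite w0 -rmorphD modulus_realc ger0_norm; lra.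
have -> : - G.[u] * (H.[u])^* + (g%:C)%C =
    - ((G.[u] - G.[1]) * (H.[u])^* + (g%:C)%C * ((H.[u])^* - 1)).
  by rewrite G1; ring.
rewrite modulusN; have HJ : modulus ((H.[u])^* - 1) = modulus (H.[u] - H.[1]).
  by rewrite H1 -[LHS]modulusJ rmorphB rmorph1 /= conjCK.
move=> /le_trans /(_ (modulusD _ _)).
rewrite !modulusM modulusJ mH mulr1 HJ modulus_realc (ger0_norm (ltW g0)) => h.
have : modulus (G.[u] - G.[1]) < g / 4.
  by apply: lt_le_trans hG _; rewrite ge_min lexx orbT.
have : g * modulus (H.[u] - H.[1]) <= g * (1 / 4) by rewrite ler_wpM2l ?(ltW hH) ?(ltW g0).
by lra.
Qed.

(** Induction on the degree. A real trigonometric polynomial has with each root [b != 0] also the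
    root [1 / conj(b)], and a root on the circle is double by [circle_root_double]; such a pair
    contributes [|p - b|^2] up to a constant and a power of [p]. The exponent [m] absorbs these
    powers. *)
Lemma scalar_fejer_riesz a m K : a != 0 ->
  generic_circle (fun p => 0 <= a.[p] * p ^+ m * p ^- K) ->
  exists2 e, e != 0 & generic_circle (fun p => `|a.[p]| = `|e.[p]| ^+ 2).
Proof.
have [n] := ubnP (size a); elim: n => // n IHn in a m *; rewrite ltnS => sa a0 pos.
have [/eqP/size_poly1P[k k0 ->]|s1] := eqVneq (size a) 1%N.
  exists (sqrtC `|k|)%:P; first by rewrite polyC_eq0 sqrtC_eq0 normr_eq0.
  by apply: generic_circleT => p _; rewrite !hornerC -normrX sqrtCK normr_id.
have /closed_rootP[b rb] := s1.
have [q qe] := factor_theorem _ _ rb.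
have q0 : q != 0 by apply: contraNneq a0 => q0; rewrite qe q0 mul0r.
have sq : (size q < size a)%N.
  by rewrite qe size_Mmonic ?monicXsubC // size_XsubC addn2.
have [b0|b0] := eqVneq b 0.
  have [|e e0 eq] := IHn q m.+1 (leq_trans sq sa) q0.
    apply: generic_circle_mono pos => p /norm_eq1 p1.
    by rewrite qe b0 subr0 hornerM hornerX exprS mulrA.
  exists e => //; apply: generic_circle_mono eq => p /norm_eq1 p1 <-.
  by rewrite qe b0 subr0 hornerM hornerX normrM (norm_eq1 p).2 // mulr1.
pose b' := (b^*)^-1.
have [q1 q1e] : exists q1 : {poly C}, q = q1 * ('X - b'%:P).
  apply/factor_theorem/rootP.
  have [mb|mb] := eqVneq (modulus b) 1.
    have -> : b' = b by rewrite /b' (modulus1_conj mb) invrK.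
    apply: (@circle_root_double q b m K) => //.
    by rewrite mulrC -qe.
  have bJ0 : b^* != 0 by rewrite conjC_eq0.
  have b'b : b' - b != 0.
    rewrite subr_eq0; apply: contraNneq mb => e.
    have : b * b^* = 1 by rewrite -{1}e mulVf.
    rewrite mulJ_modulus => /complexI /eqP.
    by rewrite sqrp_eq1 // modulus_ge0.
  have refl : a * 'X^(m + m + size a) = poly_reflect (size a) a * 'X^(K + K).
    apply: generic_circle_poly_eq; apply: generic_circle_mono pos => p /norm_eq1 p1.
    have p0 : p != 0 by rewrite -modulus_gt0 p1.
    move=> /geC0_conj; rewrite !rmorphM fmorphV !rmorphXn /= (modulus1_conj p1) => e.
    rewrite !hornerM !hornerXn poly_reflect_circle //; last exact/norm_eq1.
    rewrite !exprD.
    have pm0 : p ^+ m != 0 by rewrite expf_neq0.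
    have pK0 : p ^+ K != 0 by rewrite expf_neq0.
    have ea : a.[p] = a.[p] * p ^+ m / p ^+ K * p ^+ K / p ^+ m.
      by rewrite mulfVK // mulfK.
    rewrite [in LHS]ea -e !exprVn invrK.
    by move: (p ^+ m) (p ^+ K) pm0 pK0 => x y x0 y0; field; rewrite x0.
  have : (poly_reflect (size a) a).[b] = 0.
    have := congr1 (fun f : {poly C} => f.[b]) refl; rewrite !hornerM !hornerXn (rootP rb) mul0r.
    by move=> /esym/eqP; rewrite mulf_eq0 expf_eq0 (negPf b0) andbF orbF => /eqP.
  rewrite poly_reflectE // => /eqP; rewrite mulf_eq0 expf_eq0 (negPf b0) andbF /=.
  rewrite conjC_eq0 qe hornerM hornerXsubC -/b' mulf_eq0 (negPf b'b) orbF.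
  by move/eqP.
(* On the circle [p - b' = - p conj(p - b) / conj(b)], so this scalar gives [a = a' p |p - b|^2] and
   positivity passes to [a']. *)
pose a' := - (b^*)^-1 *: q1.
have den p : modulus p = 1 -> p - b' = - (p * (p - b)^* / b^*).
  move=> p1; have p0 : p != 0 by rewrite -modulus_gt0 p1.
  by rewrite /b' rmorphB /= (modulus1_conj p1); field; rewrite ?p0 ?conjC_eq0 ?b0.
have q10 : q1 != 0 by apply: contraNneq q0 => q10; rewrite q1e q10 mul0r.
have aE p : modulus p = 1 -> a.[p] = a'.[p] * p * (p - b) * (p - b)^*.
  move=> p1; rewrite qe q1e !hornerM !hornerXsubC den // hornerZ.
  by ring.
have sa' : (size a' < n)%N.
  rewrite size_scale ?oppr_eq0 ?invr_eq0 ?conjC_eq0 //.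
  apply: leq_trans sa; apply: leq_trans sq; rewrite ltnS.
  by rewrite q1e size_Mmonic ?monicXsubC // size_XsubC addn2 leqnSn.
have a'0 : a' != 0 by rewrite scaler_eq0 negb_or oppr_eq0 invr_eq0 conjC_eq0 b0.
have Xb0 : ('X - b%:P : {poly C}) != 0 by rewrite polyXsubC_eq0.
have [|e e0 eq] := IHn a' m.+1 sa' a'0.
  apply: generic_circle_mono (generic_circleI pos (generic_circle_neq0 Xb0)) => p /norm_eq1 p1.
  rewrite hornerXsubC => -[+ pb0]; rewrite aE //.
  have -> : a'.[p] * p * (p - b) * (p - b)^* * p ^+ m / p ^+ K =
      (p - b) * (p - b)^* * (a'.[p] * p ^+ m.+1 / p ^+ K) by rewrite exprS; ring.
  by rewrite pmulr_rge0 // mulJ_modulus ltcR exprn_gt0 // modulus_gt0.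
exists (e * ('X - b%:P)); first by rewrite mulf_neq0 // polyXsubC_eq0.
apply: generic_circle_mono eq => p /norm_eq1 p1 eq.
rewrite aE // !normrM eq hornerM hornerXsubC normrM norm_conjC (norm_eq1 p).2 //.
by ring.
Qed.

End Circle.

Section PositiveDefinite.
Variable C : numClosedFieldType.

Definition posdefmx n (G : 'M[C]_n) :=
  G^t* = G /\ forall v : 'cV_n, v != 0 -> 0 < (v^t* *m G *m v) 0 0.

Lemma posdefmx_gram n (E : 'M[C]_n) : \det E != 0 -> posdefmx (E^t* *m E).
Proof.
move=> E0; split=> [|v v0]; first by rewrite adjmxM trmxCK.
rewrite mulmxA -adjmxM -mulmxA -[_ 0 0]/(sqnorm (E *m v)) lt_neqAle sqnorm_ge0 andbT.
rewrite eq_sym sqnorm_eq0; apply: contra E0 => /eqP Ev.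
by apply/eqP/det0_colP; exists v.
Qed.

(** Test on [(- b w, a w)], which the first block row annihilates. The Schur complement is scaled by
    [a] so that it stays polynomial when the entries are. *)
Lemma posdefmx_schur n (a : C) (b : 'rV[C]_n) (c : 'cV[C]_n) (D : 'M[C]_n) :
  posdefmx (block_mx a%:M b c D : 'M_(1 + n)) ->
  [/\ 0 < a, c = b^t* & posdefmx (a *: D - c *m b)].
Proof.
move=> [sG pG].
have [sa eb ec sD] : [/\ a^* = a, c^t* = b, b^t* = c & D^t* = D].
  move: sG; rewrite tr_block_mx map_block_mx tr_scalar_mx map_scalar_mx => e.
  have [e1 e2 e3 e4] := eq_block_mx e; split=> //.
  by move/matrixP/(_ 0 0): e1; rewrite !mxE /= !mulr1n.
have a0 : 0 < a.
  have := pG (col_mx 1%:M 0); rewrite tr_col_mx map_row_mx adjmx1 trmx0 map_mx0.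
  rewrite mul_row_block mul_row_col !mul0mx !mul1mx mulmx1 mulmx0 !addr0 mxE mulr1n.
  apply; apply/eqP => /matrixP/(_ (lshift n 0) 0).
  by rewrite col_mxEu !mxE => /eqP; rewrite oner_eq0.
split=> //; split; first by rewrite adjmxB adjmxZ adjmxM sa sD ec eb.
move=> w w0; rewrite -(pmulr_rgt0 _ a0).
have v0 : col_mx (- (b *m w)) (a *: w) != 0 :> 'cV[C]_(1 + n).
  apply: contraNneq w0 => /eqP; rewrite -[0]col_mx0 => /eqP/eq_col_mx[_ /eqP].
  by rewrite scaler_eq0 gt_eqF.
have := pG _ v0; rewrite -mulmxA mul_block_col.
have -> : a%:M *m - (b *m w) + b *m (a *: w) = 0.
  by rewrite mul_scalar_mx scalerN -scalemxAr addNr.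
have -> : c *m - (b *m w) + D *m (a *: w) = (a *: D - c *m b) *m w.
  by rewrite mulmxN -scalemxAr mulmxBl mulmxA -scalemxAl addrC.
rewrite tr_col_mx map_row_mx mul_row_col mulmx0 add0r adjmxZ sa.
by rewrite -scalemxAl mxE mulmxA.
Qed.

End PositiveDefinite.

(** * Matrix Fejer-Riesz factorization by elimination *)

Section MatrixFejerRiesz.
Variable C : numClosedFieldType.
(* The scalar factorization is only available over [R[i]]; as a hypothesis it keeps
   the matrix computations over an abstract field. *)
Hypothesis scalar_fejer_riesz : forall (a : {poly C}) (m K : nat), a != 0 ->
  generic_circle (fun p => 0 <= a.[p] * p ^+ m * p ^- K) ->
  exists2 e, e != 0 & generic_circle (fun p => `|a.[p]| = `|e.[p]| ^+ 2).

Definition evmx (p : C) m n (A : 'M[{poly C}]_(m, n)) : 'M[C]_(m, n) :=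
  map_mx (horner_eval p) A.

Lemma evmxE p m n (A : 'M[{poly C}]_(m, n)) i j : evmx p A i j = (A i j).[p].
Proof. by rewrite mxE. Qed.

Lemma evmxM p m n k (A : 'M[{poly C}]_(m, n)) (B : 'M[{poly C}]_(n, k)) :
  evmx p (A *m B) = evmx p A *m evmx p B.
Proof. exact: map_mxM. Qed.

Lemma evmxD p m n (A B : 'M[{poly C}]_(m, n)) :
  evmx p (A + B) = evmx p A + evmx p B.
Proof. exact: map_mxD. Qed.

Lemma evmxB p m n (A B : 'M[{poly C}]_(m, n)) :
  evmx p (A - B) = evmx p A - evmx p B.
Proof. exact: map_mxB. Qed.

Lemma evmxZ p m n (a : {poly C}) (A : 'M[{poly C}]_(m, n)) :
  evmx p (a *: A) = a.[p] *: evmx p A.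
Proof. exact: map_mxZ. Qed.

Lemma evmx_scalar p n (a : {poly C}) :
  evmx p (a%:M : 'M_n) = (a.[p])%:M.
Proof. by apply/matrixP => i j; rewrite !mxE /horner_eval hornerMn. Qed.

Lemma det_evmx p n (A : 'M[{poly C}]_n) : \det (evmx p A) = (\det A).[p].
Proof. exact: det_map_mx. Qed.

(** Cholesky elimination without division. Clearing denominators multiplies the Schur complement by
    the pivot, the scalar theorem writes the pivot as [|e|^2] on the circle, and [c] collects the
    denominators. *)
Lemma matrix_fejer_riesz n (A : 'M[{poly C}]_n) K :
  generic_circle (fun p => posdefmx (p ^- K *: evmx p A)) ->
  exists X c, [/\ \det X != 0, c != 0 &
    generic_circle (fun p => (evmx p X)^t* *m evmx p X =
      (`|c.[p]| ^+ 2 * p ^- K) *: evmx p A)].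
Proof.
elim: n A K => [|n IHn] A K pos.
  exists 0, 1; split; rewrite ?det_mx00 ?oner_neq0 //.
  by apply: generic_circleT => p _; apply/matrixP => -[].
rewrite -[n.+1]/(1 + n)%N in A pos *.
pose a := A 0 0; pose b := ursubmx A; pose c := dlsubmx A; pose D := drsubmx A.
have eA : A = block_mx a%:M b c D.
  rewrite -[LHS]submxK; congr block_mx; apply/matrixP => i j.
  by rewrite !ord1 !mxE mulr1n; congr (A _ _); apply/val_inj.
have evA p : p ^- K *: evmx p A =
    block_mx (p ^- K * a.[p])%:M (p ^- K *: evmx p b) (p ^- K *: evmx p c)
      (p ^- K *: evmx p D).
  by rewrite eA /evmx map_block_mx scale_block_mx map_scalar_mx scale_scalar_mx.
have schur : generic_circle (fun p => [/\ 0 < p ^- K * a.[p],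
    p ^- K *: evmx p c = (p ^- K *: evmx p b)^t* &
    posdefmx (p ^- (K + K) *: evmx p (a *: D - c *m b))]).
  apply: generic_circle_mono pos => p p1; rewrite evA => Gpos.
  have [h1 h2 h3] := @posdefmx_schur _ n (p ^- K * a.[p]) (p ^- K *: evmx p b)
    (p ^- K *: evmx p c) (p ^- K *: evmx p D) Gpos; split=> //.
  have -> : p ^- (K + K) *: evmx p (a *: D - c *m b) =
      (p ^- K * a.[p]) *: (p ^- K *: evmx p D) -
      (p ^- K *: evmx p c) *m (p ^- K *: evmx p b).
    rewrite evmxB evmxZ evmxM -!scalemxAl -!scalemxAr !scalerA scalerBr scalerA.
    by rewrite exprD invfM mulrAC.
  exact: h3.
have a0 : a != 0.
  apply/eqP => a0; apply: (@generic_circle_absurd C).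
  by apply: generic_circle_mono schur => p p1 []; rewrite a0 horner0 mulr0 ltxx.
have [|e e0 He] := @scalar_fejer_riesz a 0 K a0.
  by apply: generic_circle_mono schur => p p1 [/ltW + _ _]; rewrite expr0 mulr1 mulrC.
have [|X' [c' [X'0 c'0 HX']]] := IHn (a *: D - c *m b) (K + K).
  by apply: generic_circle_mono schur => p p1 [].
exists (block_mx (c' * a)%:M (c' *: b) 0 X'), (c' * e); split.
- by rewrite det_ublock det_scalar1 !mulf_neq0.
- by rewrite mulf_neq0.
apply: generic_circle_mono (generic_circleI schur (generic_circleI He HX')) => p p1.
move=> [[a_gt0 cb _] [ea eX]].
have p0 : p != 0 by rewrite -normr_gt0 p1 ltr01.
have pK0 : p ^+ K != 0 by rewrite expf_neq0.
have pKJ : (p ^+ K)^* = p ^- K by rewrite rmorphXn /= (norm1_conjC p1) exprVn.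
have aJ : a.[p]^* = p ^- (K + K) * a.[p].
  have := geC0_conj (ltW a_gt0); rewrite rmorphM fmorphV /= pKJ invrK => e'.
  by rewrite -[LHS](mulKf pK0) e' exprD invfM; ring.
have ae : p ^- K * a.[p] = `|e.[p]| ^+ 2.
  rewrite -ea -[LHS](ger0_norm (ltW a_gt0)) normrM normfV normrX.
  by rewrite p1 expr1n invr1 mul1r.
rewrite -scalerA evA.
have -> : evmx p (block_mx (c' * a)%:M (c' *: b) 0 X' : 'M_(1 + n)) =
    block_mx (c'.[p] * a.[p])%:M (c'.[p] *: evmx p b) 0 (evmx p X').
  rewrite {1}/evmx map_block_mx map_scalar_mx map_mx0 /= /horner_eval hornerM.
  by rewrite -[map_mx _ (c' *: b)]/(evmx p (c' *: b)) evmxZ.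
rewrite tr_block_mx map_block_mx tr_scalar_mx map_scalar_mx trmx0 map_mx0.
rewrite mulmx_block !mul0mx !mulmx0 !addr0 scale_block_mx.
rewrite eX evmxB evmxZ evmxM.
have ceq : evmx p c = p ^+ (K + K) *: (evmx p b)^t*.
  have := congr1 (fun M => p ^+ K *: M) cb; rewrite scalerA mulfV // scale1r => ->.
  by rewrite adjmxZ fmorphV /= pKJ invrK scalerA exprD.
have ccJ : `|c'.[p]| ^+ 2 = c'.[p] * c'.[p]^* by rewrite normCK.
have sq2 : `|(c' * e).[p]| ^+ 2 = c'.[p] * c'.[p]^* * (p ^- K * a.[p]).
  by rewrite hornerM normrM exprMn ccJ -ae.
rewrite sq2 ceq ccJ adjmxZ !mul_scalar_mx mul_mx_scalar -!scalemxAl -!scalemxAr.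
have caJ : (c'.[p] * a.[p])^* = c'.[p]^* * (p ^- (K + K) * a.[p]).
  by rewrite rmorphM /= aJ.
rewrite /= caJ !scale_scalar_mx !scalerA exprD invfM.
move: (p ^+ K) pK0 ((evmx p b)^t* ) => q q0 B.
congr block_mx.
- by congr (_%:M); field.
- by congr (_ *: _); field.
- by congr (_ *: _); field.
rewrite scalerBr !scalerA addrCA.
have -> : c'.[p] * c'.[p]^* * (q^-1 / q) * (q * q) = c'.[p]^* * c'.[p] by field.
by rewrite subrr addr0; congr (_ *: _); field.
Qed.

End MatrixFejerRiesz.

(** * Moving zeros of the determinant out of the disk *)

Section ZeroRemoval.
Variable C : numClosedFieldType.

(** The matrix determinant lemma; the extra factor [c] avoids a division and the exponent
    [n - 1]. *)
Lemma det_rank_one_update (K : comNzRingType) n (b c : K) (u : 'cV[K]_n) (v : 'rV[K]_n) :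
  v *m u = 1%:M -> c * \det (c%:M + (b - c) *: (u *m v)) = b * c ^+ n.
Proof.
move=> vu; pose M := block_mx 1%:M (- ((b - c) *: v)) u c%:M : 'M_(1 + n).
have e1 : \det M = \det (c%:M + (b - c) *: (u *m v)).
  have -> : M = block_mx 1%:M 0 u 1%:M *m
      block_mx 1%:M (- ((b - c) *: v)) 0 (c%:M + (b - c) *: (u *m v)).
    rewrite mulmx_block !(mul1mx, mul0mx, mulmx0, mulmx1, addr0) mulmxN -scalemxAr.
    by rewrite addrCA addNr addr0.
  by rewrite det_mulmx det_lblock det_ublock !det1 !mul1r.
have e2 : \det M * c = b * c ^+ n.
  transitivity (\det (M *m block_mx c%:M 0 (- u) 1%:M)).
    by rewrite det_mulmx det_lblock det_scalar1 det1 mulr1.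
  rewrite mulmx_block !(mul1mx, mulmx0, mulmx1, add0r) mulNmx mulmxN opprK.
  rewrite -scalemxAl vu mul_scalar_mx mul_mx_scalar scalerN subrr.
  rewrite det_ublock det_scalar scalemx1 -raddfD /= det_scalar1.
  by rewrite addrCA subrr addr0.
by rewrite -e1 mulrC.
Qed.

Lemma blaschke_modulus (a p : C) : `|p| = 1 -> `|1 - a^* * p| = `|p - a|.
Proof.
move=> p1; rewrite -[RHS]norm_conjC rmorphB /= (norm1_conjC p1).
have p0 : p != 0 by rewrite -normr_gt0 p1 ltr01.
have -> : 1 - a^* * p = p * (p^-1 - a^*) by rewrite mulrBr divff // mulrC.
by rewrite normrM p1 mul1r.
Qed.

(* Multiplication by the elementary Blaschke factor acting along [v], the left
   null vector of [X] at [a], moves the zero [a] of [det X] to its reflection. *)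
Lemma remove_zero n (X : 'M[{poly C}]_n) a : (\det X).[a] = 0 ->
  exists Y, ('X - a%:P) * \det Y = (1 - a^* *: 'X) * \det X /\
    forall p, `|p| = 1 ->
      (evmx p Y)^t* *m evmx p Y = (evmx p X)^t* *m evmx p X.
Proof.
rewrite -det_evmx => /eqP/det0P[v0 v00 v0X].
have nz : sqnorm (v0^t* ) != 0 by rewrite sqnorm_eq0 map_mx_eq0 trmx_eq0.
pose k := (sqrtC (sqnorm (v0^t* )))^-1; pose v := k *: v0.
have vX : v *m evmx a X = 0 by rewrite -scalemxAl v0X scaler0.
have vv : v *m v^t* = 1%:M.
  have k0 : 0 <= k by rewrite invr_ge0 sqrtC_ge0 sqnorm_ge0.
  rewrite /v adjmxZ -scalemxAl -scalemxAr scalerA (geC0_conj k0).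
  have -> : v0 *m v0^t* = (sqnorm (v0^t* ))%:M.
    by apply/matrixP => i j; rewrite !ord1 /sqnorm trmxCK [RHS]mxE mulr1n.
  by rewrite scale_scalar_mx /k -invfM -expr2 sqrtCK mulVf.
clearbody v.
pose V : 'rV[{poly C}]_n := map_mx polyC v.
pose W : 'cV[{poly C}]_n := map_mx polyC (v^t* ).
have evV p : evmx p V = v by apply/matrixP => i j; rewrite !mxE /horner_eval hornerC.
have evW p : evmx p W = v^t* by apply/matrixP => i j; rewrite !mxE /horner_eval hornerC.
have VW : V *m W = 1%:M by rewrite -map_mxM vv map_mx1.
pose Q : 'rV[{poly C}]_n := \row_j ((V *m X) 0 j %/ ('X - a%:P)).
have VX : V *m X = ('X - a%:P) *: Q.
  apply/matrixP => i j; rewrite ord1 [RHS]mxE [Q _ _]mxE mulrC divpK //.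
  rewrite dvdp_XsubCl /root -evmxE evmxM evV vX mxE.
  by [].
pose Y := X - W *m (V *m X) + (1 - a^* *: 'X) *: (W *m Q).
have Xa0 : ('X - a%:P : {poly C}) != 0 by rewrite polyXsubC_eq0.
exists Y; split.
  have XaY : ('X - a%:P) *: Y =
      (('X - a%:P)%:M + ((1 - a^* *: 'X) - ('X - a%:P)) *: (W *m V)) *m X.
    rewrite mulmxDl mul_scalar_mx -scalemxAl -mulmxA VX -scalemxAr.
    rewrite /Y VX -scalemxAr scalerDr scalerBr !scalerA -addrA; congr (_ + _).
    by rewrite -scaleNr -scalerDl; congr (_ *: _); ring.
  have := congr1 determinant XaY; rewrite detZ det_mulmx => e.
  have Xan : ('X - a%:P : {poly C}) ^+ n != 0 by rewrite expf_neq0.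
  apply: (mulfI Xan); rewrite mulrCA e mulrA.
  by rewrite (det_rank_one_update (1 - a^* *: 'X) ('X - a%:P) VW) -mulrA mulrCA.
move=> p p1; rewrite /Y evmxD evmxB evmxZ !evmxM evV evW.
have vXp : v *m evmx p X = (p - a) *: evmx p Q.
  by rewrite -[v](evV p) -evmxM VX evmxZ hornerXsubC.
have -> : (1 - a^* *: 'X).[p] = 1 - a^* * p by rewrite !hornerE.
move: (evmx p X) (evmx p Q) vXp => x q vx.
have cc : (1 - a^* * p) * (1 - a^* * p)^* = (p - a) * (p - a)^*.
  by rewrite -!normCK blaschke_modulus.
move: (1 - a^* * p) cc => c cc.
have wv := trmxCK v; move: (v^t* ) wv vv => w wv vw.
pose y := x - w *m (v *m x) + c *: (w *m q).
have vy : v *m y = c *: q.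
  by rewrite /y mulmxDr mulmxBr -scalemxAr !mulmxA vw !mul1mx subrr add0r.
have yJ : y^t* = x^t* - x^t* *m w *m v + c^* *: (q^t* *m v).
  by rewrite /y adjmxD adjmxB adjmxZ !adjmxM wv -wv trmxCK wv.
rewrite -/y yJ mulmxDl mulmxBl -scalemxAl -!mulmxA vy.
rewrite -!scalemxAr scalerA [c^* * c]mulrC cc /y mulmxDr mulmxBr -!scalemxAr.
rewrite addrK -addrA -[RHS]addr0; congr (_ + _).
have -> : x^t* *m (w *m (v *m x)) = (v *m x)^t* *m (v *m x).
  by rewrite adjmxM -wv trmxCK mulmxA.
by rewrite vx adjmxZ -scalemxAl -scalemxAr scalerA mulrC addNr.
Qed.

Lemma remove_zeros n (X : 'M[{poly C}]_n) : \det X != 0 ->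
  exists Y, (forall a, `|a| < 1 -> (\det Y).[a] != 0) /\
    forall p, `|p| = 1 ->
      (evmx p Y)^t* *m evmx p Y = (evmx p X)^t* *m evmx p X.
Proof.
move=> X0; have [l el] := closed_field_poly_normal (\det X).
(* In the induction [q] collects the factors with no zero in the open disk: the reflected ones and
   those of the roots with [|b| >= 1]. *)
have [q [eq q0]] : exists q, \det X = q * \prod_(z <- l) ('X - z%:P) /\
    forall a, `|a| < 1 -> q.[a] != 0.
  exists (lead_coef (\det X))%:P; split; first by rewrite mul_polyC.
  by move=> a _; rewrite hornerC lead_coef_eq0.
elim: l X q eq q0 {X0 el} => [|b l IHl] X q.
  by rewrite big_nil mulr1 => eX q0; exists X; split=> // a a1; rewrite eX q0.
rewrite big_cons => eX q0; have [b1|b1] := boolP (`|b| < 1); last first.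
  apply: (IHl X (q * ('X - b%:P))); first by rewrite eX mulrA.
  move=> a a1; rewrite hornerM mulf_neq0 ?q0 // hornerXsubC subr_eq0.
  by apply: contraNneq b1 => <-.
have [|Y [eY YX]] := @remove_zero n X b.
  by rewrite eX !hornerM hornerXsubC subrr mul0r mulr0.
have [||Z [Z0 ZY]] := IHl Y (q * (1 - b^* *: 'X)).
- have Xb0 : ('X - b%:P : {poly C}) != 0 by rewrite polyXsubC_eq0.
  by apply: (mulfI Xb0); rewrite eY eX; ring.
- move=> a a1; rewrite hornerM mulf_neq0 ?q0 // !hornerE subr_eq0.
  apply: contraTneq b1 => e; rewrite -real_leNgt ?real1 ?normr_real //.
  have : `|b| * `|a| = 1 by rewrite -norm_conjC -normrM -e normr1.
  move=> <-; rewrite ler_piMr // ltW //.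
by exists Z; split=> // p p1; rewrite ZY // YX.
Qed.

End ZeroRemoval.

(** * Realization of irreducible factors *)

Section CircleDivision.
Variable R : realType.
Local Notation C := R[i].
Implicit Types (d f g : {poly C}).

Lemma circle_dominated_root f d (b : C) : `|b| = 1 ->
  generic_circle (fun p => `|f.[p]| <= `|d.[p]|) -> d.[b] = 0 -> f.[b] = 0.
Proof.
move=> /norm_eq1 b1 fd db; apply/eqP/negPn/negP => fb.
have m0 : 0 < modulus f.[b] / 2 by rewrite divr_gt0 // modulus_gt0.
have [e1 e10 h1] := horner_continuous f b m0.
have [e2 e20 h2] := horner_continuous d b m0.
have e120 : 0 < Num.min e1 e2 by rewrite lt_min e10.
have [p [p1 +]] := generic_circle_near fd b1 e120.
rewrite lt_min => /andP[/h1 + /h2]; rewrite db subr0 !normE lecR modulusBC.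
have := modulusB_ge f.[b] f.[p]; lra.
Qed.

(** On the circle [g / d] is [p] times the conjugate of [f / d]. A root of [d] on the circle is
    shared because [|f|] and [|g|] are at most [|d|]. At a root [b] with [|b| > 1] the reflected
    identity gives [g(b) = 0], since [d] does not vanish at [1 / conj(b)]; the relation is symmetric
    in [f] and [g], so [f(b) = 0] too. *)
Lemma circle_divide d f g : d != 0 -> (forall a, `|a| < 1 -> d.[a] != 0) ->
  generic_circle (fun p => p * d.[p] * f.[p]^* = d.[p]^* * g.[p]) ->
  generic_circle (fun p => `|f.[p]| <= `|d.[p]|) ->
  exists f' g', f = d * f' /\ g = d * g'.
Proof.
have [n] := ubnP (size d); elim: n => // n IHn in d f g *; rewrite ltnS => sd.
move=> d0 dD fg fd.
have [/eqP/size_poly1P[k k0 ->]|s1] := eqVneq (size d) 1%N.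
  exists (k^-1 *: f), (k^-1 *: g).
  by rewrite !mul_polyC !scalerA divff // !scale1r.
have /closed_rootP[b rb] := s1; have db := rootP rb.
have gf : generic_circle (fun p => p * d.[p] * g.[p]^* = d.[p]^* * f.[p]).
  apply: generic_circle_mono fg => p p1 /(congr1 (fun x => p * x^*)).
  rewrite !rmorphM /= !conjCK (norm1_conjC p1) => e.
  have p0 : p != 0 by rewrite -normr_gt0 p1 ltr01.
  by rewrite -mulrA -e; field.
have refl (f1 g1 : {poly C}) : `|b| != 1 ->
    generic_circle (fun p => p * d.[p] * f1.[p]^* = d.[p]^* * g1.[p]) ->
    g1.[b] = 0.
  move=> b1 fg1; pose L := (size d + size f1)%N.
  have sdL : (size d <= L.+1)%N by rewrite /L; lia.
  have sfL : (size f1 <= L.+1)%N by rewrite /L; lia.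
  have : 'X * d * poly_reflect L f1 = poly_reflect L d * g1.
    apply: generic_circle_poly_eq; apply: generic_circle_mono fg1 => p p1 e.
    rewrite !hornerM hornerX !poly_reflect_circle // mulrCA mulrA.
    by rewrite -!mulrA -e; ring.
  move/(congr1 (fun h : {poly C} => h.[b])); rewrite !hornerM db mulr0 mul0r.
  have nb : ~~ (`|b| < 1) by apply/negP => /dD; rewrite db eqxx.
  have b0 : b != 0 by apply: contraNneq nb => ->; rewrite normr0 ltr01.
  rewrite poly_reflectE // => /esym/eqP; rewrite !mulf_eq0 expf_eq0 (negPf b0) andbF.
  rewrite conjC_eq0 (negPf (dD _ _)) //=; first by move/eqP.
  rewrite normfV norm_conjC invf_lt1 ?normr_gt0 // lt_neqAle eq_sym b1 /=.
  by rewrite real_leNgt ?real1 ?normr_real.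
have fgE : generic_circle (fun p => `|g.[p]| <= `|d.[p]|).
  have := generic_circleI (generic_circleI fg fd) (generic_circle_neq0 d0).
  apply: generic_circle_mono => p p1 [[e le] dp].
  have := congr1 Num.norm e; rewrite !normrM p1 mul1r !norm_conjC.
  by move/mulfI; rewrite normr_eq0 => /(_ dp) <-.
have [fb gb] : f.[b] = 0 /\ g.[b] = 0.
  have [b1|b1] := eqVneq `|b| 1; last by split; apply: refl b1 _; eassumption.
  by split; apply: (circle_dominated_root b1) db.
have [d1 ed] := factor_theorem _ _ rb.
have /factor_theorem[f1 ef] : root f b by apply/rootP.
have /factor_theorem[g1 eg] : root g b by apply/rootP.
have Xb0 : ('X - b%:P : {poly C}) != 0 by rewrite polyXsubC_eq0.
have d10 : d1 != 0 by apply: contraNneq d0 => d10; rewrite ed d10 mul0r.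
have [||||f' [g' [ef' eg']]] := IHn d1 f1 g1 _ d10.
- by apply: leq_trans sd; rewrite ed size_Mmonic ?monicXsubC // size_XsubC addn2.
- by move=> a /dD; rewrite ed hornerM mulf_eq0 negb_or => /andP[].
- have := generic_circleI fg (generic_circle_neq0 Xb0).
  apply: generic_circle_mono => p p1 [].
  rewrite ed ef eg !hornerM hornerXsubC !rmorphM => e pb.
  have pbJ : (p - b)^* != 0 by rewrite conjC_eq0.
  apply: (mulfI pb); apply: (mulfI pbJ).
  transitivity (p * (d1.[p] * (p - b)) * (f1.[p]^* * (p - b)^*)).
    by rewrite rmorphB; ring.
  by move: e; rewrite !rmorphB /= => ->; ring.
- have := generic_circleI fd (generic_circle_neq0 Xb0).
  apply: generic_circle_mono => p p1 [].
  rewrite ed ef !hornerM hornerXsubC !normrM => + pb.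
  by rewrite ler_pM2r ?normr_gt0.
by exists f', g'; rewrite ef eg ef' eg' ed; split; ring.
Qed.

End CircleDivision.

Section PencilRealization.
Variable C : numClosedFieldType.
Hypothesis circle_divide : forall d f g : {poly C}, d != 0 ->
  (forall a, `|a| < 1 -> d.[a] != 0) ->
  generic_circle (fun p => p * d.[p] * f.[p]^* = d.[p]^* * g.[p]) ->
  generic_circle (fun p => `|f.[p]| <= `|d.[p]|) ->
  exists f' g', f = d * f' /\ g = d * g'.

(** On the circle [p conj(f)] has exponents at most [1] and [g] has exponents at least [0];
    comparing Fourier coefficients leaves only [0] and [1]. *)
Lemma circle_reflect_linear (f g : {poly C}) :
  generic_circle (fun p => p * f.[p]^* = g.[p]) ->
  f = (f`_0)%:P + f`_1 *: 'X /\ g = ((f`_1)^*)%:P + ((f`_0)^*) *: 'X.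
Proof.
move=> fg; pose L := (size f).+1.
have sf : (size f <= L.+1)%N by rewrite /L; lia.
have e : 'X * poly_reflect L f = 'X^L * g.
  apply: generic_circle_poly_eq; apply: generic_circle_mono fg => p p1 e.
  by rewrite !hornerM hornerX hornerXn poly_reflect_circle // -e; ring.
have co k : (if (L + k == 0)%N then 0 else (poly_reflect L f)`_(L + k).-1) = g`_k.
  by have := congr1 (fun h : {poly C} => h`_(L + k)) e;
    rewrite coefXM coefXnM addKn ltnNge leq_addr.
have f2 i : (1 < i)%N -> f`_i = 0.
  move=> i1; have [iL|iL] := leqP i L; last by rewrite nth_default // (leq_trans _ (ltnW iL)).
  have := congr1 (fun h : {poly C} => h`_(L - i).+1) e.
  rewrite coefXM coefXnM /= coef_poly ltnS leq_subr subKn //.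
  have -> : ((L - i).+1 < L)%N by lia.
  by move/eqP; rewrite conjC_eq0 => /eqP.
have lin (h : {poly C}) : (forall i, (1 < i)%N -> h`_i = 0) ->
    h = (h`_0)%:P + h`_1 *: 'X.
  move=> h2; apply/polyP => -[|[|i]]; rewrite coefD coefC coefZ coefX /=.
  - by rewrite mulr0 addr0.
  - by rewrite mulr1 add0r.
  - by rewrite mulr0 addr0 h2.
split; first exact: lin.
have -> : (f`_1)^* = g`_0.
  by rewrite -co addn0 /= coef_poly leqnSn /L subSn // subnn.
have -> : (f`_0)^* = g`_1.
  by rewrite -co addn1 /= coef_poly ltnSn subnn.
apply: lin => -[|[|i]] // _; rewrite -co addnS /= coef_poly.
by rewrite ltnS addnS ltnNge leq_addr.
Qed.

Lemma gram_entry_le n (A : 'M[C]_n) c i j :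
  A^t* *m A = c%:M -> `|A i j| ^+ 2 <= c.
Proof.
move=> /matrixP/(_ j j); rewrite mxE [RHS]mxE eqxx mulr1n => <-.
rewrite (bigD1 i) //= !mxE [X in X + _]mulrC -normCK lerDl sumr_ge0 // => k _.
by rewrite !mxE mulrC -normCK exprn_ge0.
Qed.

(** At generic points of the circle the conjugate [F1] of [Z1] by [X] is unitary, so the conjugate
    [F2] of [Z2], with [F1 F2 = p], is [p] times the adjoint of [F1]. Once both are polynomial,
    [circle_reflect_linear] makes them linear in [p]. *)
Lemma pencil_realization n (X Z1 Z2 : 'M[{poly C}]_n) :
  \det X != 0 -> (forall a, `|a| < 1 -> (\det X).[a] != 0) ->
  Z1 *m Z2 = 'X%:M -> Z2 *m Z1 = 'X%:M ->
  generic_circle (fun p => (evmx p (X *m Z1))^t* *m evmx p (X *m Z1) =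
    (evmx p X)^t* *m evmx p X) ->
  exists P U, [/\ orthogonal_projection P, U \is unitarymx &
    forall p, ((pencil_mx P U)^t* + p *: pencil_mx P U) *m evmx p X =
      evmx p X *m evmx p (Z1 + Z2)].
Proof.
move=> X0 XD Z12 Z21 iso.
(* The adjugate gives [d] times the conjugates; [circle_divide] then divides by [d] entry by
   entry. *)
pose N1 := X *m Z1 *m \adj X; pose N2 := X *m Z2 *m \adj X; pose d := \det X.
have N1N2 : N1 *m N2 = (d ^+ 2 * 'X)%:M.
  rewrite /N1 /N2 -!mulmxA [\adj X *m _]mulmxA mul_adj_mx -/d.
  rewrite mul_scalar_mx -!scalemxAr [Z1 *m (Z2 *m _)]mulmxA Z12 mul_scalar_mx.
  by rewrite -scalemxAr mul_mx_adj -/d scalerA scale_scalar_mx; congr (_%:M); ring.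
have N1s : generic_circle (fun p => (evmx p N1)^t* *m evmx p N1 = (`|d.[p]| ^+ 2)%:M).
  apply: generic_circle_mono iso => p p1 e.
  rewrite /N1 evmxM adjmxM -mulmxA [_ *m (evmx p (X *m Z1) *m _)]mulmxA e.
  rewrite -mulmxA mulmxA -adjmxM -!evmxM mul_mx_adj -/d.
  by rewrite evmx_scalar tr_scalar_mx map_scalar_mx -scalar_mxM normCK mulrC.
have N12 : generic_circle (fun p =>
    (p * d.[p]) *: (evmx p N1)^t* = d.[p]^* *: evmx p N2).
  have := generic_circleI N1s (generic_circle_neq0 X0).
  apply: generic_circle_mono => p p1 [e dp]; apply: (scalerI dp).
  have := congr1 (mulmx ((evmx p N1)^t* )) (congr1 (@evmx C p n n) N1N2).
  rewrite evmxM mulmxA e mul_scalar_mx.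
  rewrite evmx_scalar hornerM hornerX horner_exp mul_mx_scalar !scalerA -normCK => ->.
  by congr (_ *: _); ring.
have bound i j : generic_circle (fun p => `|(N1 i j).[p]| <= `|d.[p]|).
  apply: generic_circle_mono N1s => p p1 /(gram_entry_le i j).
  by rewrite evmxE ler_sqr ?nnegrE ?normr_ge0.
have ent i j : generic_circle (fun p =>
    p * d.[p] * (N1 j i).[p]^* = d.[p]^* * (N2 i j).[p]).
  apply: generic_circle_mono N12 => p p1 /matrixP/(_ i j).
  by rewrite [LHS]mxE [RHS]mxE adjmxE !evmxE.
have quot i j : {fg : {poly C} * {poly C} |
    N1 j i = d * fg.1 /\ N2 i j = d * fg.2}.
  apply: cid; have [f [g fg]] := circle_divide X0 XD (ent i j) (bound j i).
  by exists (f, g).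
pose F1 : 'M[{poly C}]_n := \matrix_(i, j) (sval (quot j i)).1.
pose F2 : 'M[{poly C}]_n := \matrix_(i, j) (sval (quot i j)).2.
have dF1 : N1 = d *: F1.
  by apply/matrixP => i j; rewrite [RHS]mxE [F1 _ _]mxE; case: (svalP (quot j i)).
have dF2 : N2 = d *: F2.
  by apply/matrixP => i j; rewrite [RHS]mxE [F2 _ _]mxE; case: (svalP (quot i j)).
clearbody F1 F2.
have scaleI (k : {poly C}) (A B : 'M[{poly C}]_n) : k != 0 -> k *: A = k *: B -> A = B.
  by move=> k0 /matrixP e; apply/matrixP => i j; move: (e i j); rewrite !mxE; apply: mulfI.
have F1X : F1 *m X = X *m Z1.
  apply: (scaleI d) => //; rewrite scalemxAl -dF1 /N1 -mulmxA mul_adj_mx -/d.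
  by rewrite mul_mx_scalar.
have F2X : F2 *m X = X *m Z2.
  apply: (scaleI d) => //; rewrite scalemxAl -dF2 /N2 -mulmxA mul_adj_mx -/d.
  by rewrite mul_mx_scalar.
have cancelX (A B : 'M[{poly C}]_n) : A *m X = B *m X -> A = B.
  move=> /(congr1 (fun M => M *m \adj X)); rewrite -!mulmxA mul_mx_adj !mul_mx_scalar.
  exact: scaleI.
have F12 : F1 *m F2 = 'X%:M.
  by apply: cancelX; rewrite -mulmxA F2X mulmxA F1X -mulmxA Z12 mul_mx_scalar mul_scalar_mx.
have F21 : F2 *m F1 = 'X%:M.
  by apply: cancelX; rewrite -mulmxA F1X mulmxA F2X -mulmxA Z21 mul_mx_scalar mul_scalar_mx.
have entF i j : generic_circle (fun p => p * (F1 j i).[p]^* = (F2 i j).[p]).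
  have := generic_circleI (ent i j) (generic_circle_neq0 X0).
  apply: generic_circle_mono => p p1 []; 
  have -> : N1 j i = d * F1 j i by rewrite dF1 mxE.
  have -> : N2 i j = d * F2 i j by rewrite dF2 mxE.
  rewrite !hornerM rmorphM /= => e dp.
  have dJ : d.[p]^* != 0 by rewrite conjC_eq0.
  by apply: (mulfI dp); apply: (mulfI dJ); rewrite mulrCA -e; ring.
pose A0 : 'M[C]_n := \matrix_(i, j) (F1 i j)`_0.
pose A1 : 'M[C]_n := \matrix_(i, j) (F1 i j)`_1.
have evF1 p : evmx p F1 = A0 + p *: A1.
  apply/matrixP => i j; have [e _] := circle_reflect_linear (entF j i).
  have -> : (A0 + p *: A1) i j = (F1 i j)`_0 + p * (F1 i j)`_1 by rewrite !mxE.
  by rewrite evmxE {1}e !hornerE mulrC.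
have evF2 p : evmx p F2 = A1^t* + p *: A0^t*.
  apply/matrixP => i j; have [_ e] := circle_reflect_linear (entF i j).
  have -> : (A1^t* + p *: A0^t* ) i j = ((F1 j i)`_1)^* + p * ((F1 j i)`_0)^*.
    by rewrite !mxE.
  by rewrite evmxE e !hornerE mulrC.
have prod12 p : (A0 + p *: A1) *m (A1^t* + p *: A0^t* ) = p%:M.
  by rewrite -evF1 -evF2 -evmxM F12 evmx_scalar hornerX.
have prod21 p : (A1^t* + p *: A0^t* ) *m (A0 + p *: A1) = p%:M.
  by rewrite -evF1 -evF2 -evmxM F21 evmx_scalar hornerX.
have A01 : A0 *m A1^t* = 0.
  by have := prod12 0; rewrite !scale0r !addr0 => ->; rewrite raddf0.
have A10 : A1 *m A0^t* = 0.
  by rewrite -[LHS]trmxCK adjmxM trmxCK A01 trmx0 map_mx0.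
have B10 : A1^t* *m A0 = 0.
  by have := prod21 0; rewrite !scale0r !addr0 => ->; rewrite raddf0.
have B01 : A0^t* *m A1 = 0.
  by rewrite -[LHS]trmxCK adjmxM trmxCK B10 trmx0 map_mx0.
have AA : A0 *m A0^t* + A1 *m A1^t* = 1%:M.
  have := prod12 1; rewrite !scale1r mulmxDl !mulmxDr A01 A10 add0r addr0.
  exact.
have BB : A0^t* *m A0 + A1^t* *m A1 = 1%:M.
  have := prod21 1; rewrite !scale1r mulmxDl !mulmxDr B01 B10 add0r addr0 addrC.
  exact.
(* The target is [A0 + p A1 = (Q + p P) U]. So [U] is the value at [p = 1], and [A1 = P U] gives
   [P = A1 U^* = A1 A1^*] because [A1 A0^* = 0]. *)
pose U := A0 + A1; pose P := A1 *m A1^t*.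
have PU : P *m U = A1.
  rewrite /P /U mulmxDr -!mulmxA B10 mulmx0 add0r.
  have -> : A1^t* *m A1 = 1%:M - A0^t* *m A0 by rewrite -BB addrC addKr.
  by rewrite mulmxBr mulmx1 mulmxA A10 mul0mx subr0.
have QU : (1%:M - P) *m U = A0.
  by rewrite mulmxBl mul1mx PU /U addrK.
have PF : pencil_mx P U = A1 + A0^t*.
  have Qs : (1%:M - P)^t* = 1%:M - P by rewrite adjmxB adjmx1 adjmxM trmxCK.
  by rewrite /pencil_mx PU -{1}Qs -adjmxM QU.
exists P, U; split.
- split; last by rewrite /P adjmxM trmxCK.
  rewrite /P -mulmxA [A1^t* *m _]mulmxA.
  have -> : A1^t* *m A1 = 1%:M - A0^t* *m A0 by rewrite -BB addrC addKr.
  by rewrite mulmxBl mul1mx mulmxBr -mulmxA A01 !mulmx0 subr0.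
- apply/unitarymxP; rewrite /U adjmxD mulmxDl !mulmxDr A01 A10 addr0 add0r.
  exact: AA.
move=> p; rewrite PF evmxD mulmxDr -!evmxM -F1X -F2X !evmxM evF1 evF2.
rewrite -mulmxDl; congr (_ *m _); rewrite adjmxD trmxCK scalerDr.
by rewrite [A1^t* + A0]addrC addrACA.
Qed.

End PencilRealization.

Section IrreducibleFactor.
Variable C : numClosedFieldType.
Implicit Types (f : {poly {poly C}}) (p s : C).

Lemma coprimep_closedP (q r : {poly C}) :
  (forall x, q.[x] = 0 -> r.[x] != 0) -> coprimep q r.
Proof.
move=> H; rewrite coprimep_def; apply/negPn/negP => /closed_rootP[x].
by rewrite root_gcd => /andP[/rootP /H + /rootP rx]; rewrite rx eqxx.
Qed.

(** In characteristic zero the derivative is nonzero of smaller degree, hence coprime to [f]. *)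
Lemma generic_separable f : f \is monic -> irreducible_poly f ->
  exists2 c : {poly C}, c != 0 & forall p, c.[p] != 0 ->
    exists2 l, uniq l & fibre p f = \prod_(z <- l) ('X - z%:P).
Proof.
move=> fm irr; have f0 : f^`() != 0.
  have sf : (size f).-2.+1 = (size f).-1.
    by have := irr.1; move: (size f) => n; lia.
  apply/eqP => /polyP/(_ (size f).-2); rewrite coef_deriv coef0 sf.
  rewrite -lead_coefE (monicP fm) -polyCMn => /eqP.
  by rewrite polyC_eq0 pnatr_eq0 -sf.
have nd : ~~ (f %| f^`()).
  by apply/negP => /(dvdp_leq f0); rewrite leqNgt lt_size_deriv ?monic_neq0.
have [c c0 H] := coprimep_fibre_coprime (irreducible_coprimep irr nd).
exists c => // p cp; have [l el] := closed_field_poly_normal (fibre p f).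
rewrite (monicP (fibre_monic p fm)) scale1r in el; exists l => //.
rewrite -separable_prod_XsubC -el unlock; apply: coprimep_closedP => s.
have -> : (fibre p f)^`() = fibre p f^`() by rewrite /fibre deriv_map.
by rewrite -!hornerXY_fibre; exact: H.
Qed.

(** The discriminant of [x^2 - s x + p]: its zero set is the symmetrization of the diagonal
    [z = w]. *)
Definition royal : {poly {poly C}} := 'X^2 - (4 *: 'X)%:P.

Lemma royalE s p : royal.[s, p] = s ^+ 2 - 4 * p.
Proof. by rewrite /royal !hornerE. Qed.

Lemma royal_monic : royal \is monic.
Proof. exact: monicXnsubC. Qed.

(** A factor linear in [s] would make [4 *: 'X] a square in [{poly C}], which the parity of the
    degree forbids. *)
Lemma royal_factor f : f \is monic -> irreducible_poly f -> f %| royal -> f = royal.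
Proof.
move=> fm irr fr; have /Pdiv.IdomainMonic.dvdpP -/(_ fm)[q rq] := fr.
have qm : q \is monic by rewrite -(monicMr q fm) -rq royal_monic.
have sr : size royal = 3 by rewrite size_XnsubC.
have sqf := sr; rewrite rq size_Mmonic ?monic_neq0 // in sqf.
have [sf|sf] := eqVneq (size f) 3.
  have /size1_polyC eq : (size q <= 1)%N.
    by move: sqf; rewrite sf; move: (size q) => n; lia.
  by move: (monicP qm); rewrite rq eq lead_coefC => ->; rewrite mul1r.
have sf2 : size f = 2.
  have := irr.1; have : (0 < size q)%N by rewrite size_poly_gt0 monic_neq0.
  by move: sqf sf; move: (size q) (size f) => m n; lia.
have ef : f = 'X + (f`_0)%:P.
  apply/polyP => -[|[|i]]; rewrite coefD coefX coefC /=.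
  - by rewrite add0r.
  - by rewrite addr0; have := monicP fm; rewrite lead_coefE sf2.
  - by rewrite addr0 nth_default // sf2.
have : (f`_0) ^+ 2 = 4 *: 'X.
  have f00 : f.[- f`_0] = 0 by rewrite {1}ef hornerD hornerX hornerC addNr.
  have := congr1 (fun h : {poly {poly C}} => h.[- f`_0]) rq.
  rewrite hornerM f00 mulr0 /royal hornerD hornerN hornerXn hornerC sqrrN.
  by move/eqP; rewrite subr_eq0 => /eqP.
move=> /(congr1 (fun h : {poly C} => size h)).
rewrite size_scale ?pnatr_eq0 // size_polyX.
have [->|a0] := eqVneq (f`_0) 0; first by rewrite expr0n size_poly0.
rewrite expr2 size_mul //; have : (0 < size (f`_0)%R)%N by rewrite size_poly_gt0.
by move: (size (f`_0)) => n; lia.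
Qed.

Lemma generic_not_royal f : f \is monic -> irreducible_poly f -> f != royal ->
  exists2 c : {poly C}, c != 0 & forall s p, c.[p] != 0 -> f.[s, p] = 0 ->
    s ^+ 2 - 4 * p != 0.
Proof.
move=> fm irr fr; have nd : ~~ (f %| royal).
  by apply: contra fr => /(royal_factor fm irr) ->.
have [c c0 H] := coprimep_fibre_coprime (irreducible_coprimep irr nd).
by exists c => // s p cp f0; rewrite -royalE; exact: H.
Qed.

Lemma char_poly_intertwine n (A B X : 'M[C]_n) : \det X != 0 ->
  A *m X = X *m B -> char_poly A = char_poly B.
Proof.
move=> X0 AX; have X0' : (\det X)%:P != 0 by rewrite polyC_eq0.
apply: (mulIf X0'); rewrite -det_map_mx [RHS]mulrC -!det_mulmx; congr (\det _).
rewrite /char_poly_mx mulmxBl mulmxBr mul_scalar_mx mul_mx_scalar.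
by rewrite -!map_mxM AX.
Qed.

End IrreducibleFactor.

Lemma horner_monic (K : comNzRingType) (q : {poly K}) n x : q \is monic -> size q = n.+1 ->
  q.[x] = \sum_(j < n) q`_j * x ^+ j + x ^+ n.
Proof.
move=> qm sq; rewrite horner_coef sq big_ord_recr /=; congr (_ + _).
by have := monicP qm; rewrite lead_coefE sq /= => ->; rewrite mul1r.
Qed.

(** * The companion module with the root [z] adjoined *)

Section CompanionForm.
Variable C : numClosedFieldType.
Variable f : {poly {poly C}}.
Hypothesis fm : f \is monic.
Hypothesis sf : (1 < size f)%N.
Local Notation d := (size f).-1.

(** Multiplication by [s] on [C[p][s] / (f)], acting on columns of coordinates in the basis of
    powers of [s]. *)
Definition comp_mx : 'M[{poly C}]_d := (companionmx f)^T.

(** When the parameters are unimodular, [conj(s) = s / p], so the Gram entry, the sum of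
    [conj(s_i)^j s_i^k], is [p^(-j)] times the trace of the power [j + k]; the factor [p^d] makes it
    polynomial. *)
Definition comp_gram : 'M[{poly C}]_d :=
  \matrix_(j, k) ('X^(d - j) * \tr (comp_mx ^+ (j + k))).

(** Multiplication by [z] on the doubled module, in the basis [1, z] with [z^2 = s z - p];
    [comp_root2] is multiplication by [w = s - z]. *)
Definition comp_root1 : 'M[{poly C}]_(d + d) :=
  block_mx 0 (- 'X%:M) 1%:M comp_mx.

Definition comp_root2 : 'M[{poly C}]_(d + d) :=
  block_mx comp_mx 'X%:M (- 1%:M) 0.

(** The Gram form in the basis [1, z], summed over the two choices [z] and [w] and multiplied by
    [p^(d + 1)]. With both unimodular, the diagonal blocks double and the others come from
    [z + w = s] and its conjugate [s / p]. *)
Definition comp_form : 'M[{poly C}]_(d + d) :=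
  block_mx ((2 * 'X) *: comp_gram) ('X *: (comp_gram *m comp_mx))
           (comp_gram *m comp_mx) ((2 * 'X) *: comp_gram).

Lemma comp_root12 : comp_root1 *m comp_root2 = 'X%:M.
Proof.
rewrite /comp_root1 /comp_root2 mulmx_block !(mul0mx, mulmx0, mul1mx, mulmx1, add0r, addr0).
rewrite mulNmx mulmxN mulmx1 opprK mulmxN mulmx1 subrr scalar_mx_block.
by [].
Qed.

Lemma comp_root21 : comp_root2 *m comp_root1 = 'X%:M.
Proof.
rewrite /comp_root1 /comp_root2 mulmx_block !(mul0mx, mulmx0, mul1mx, mulmx1, add0r, addr0).
rewrite mulNmx mul1mx opprK mulmxN mul_mx_scalar mul_scalar_mx addNr.
by rewrite scalar_mx_block.
Qed.

Lemma comp_root_sum : comp_root1 + comp_root2 = block_mx comp_mx 0 0 comp_mx.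
Proof.
by rewrite /comp_root1 /comp_root2 add_block_mx add0r addNr subrr addr0.
Qed.

Lemma char_poly_comp_root_sum p :
  char_poly (evmx p (comp_root1 + comp_root2)) = fibre p (f * f).
Proof.
rewrite /evmx -map_char_poly /fibre; congr map_poly.
rewrite comp_root_sum /char_poly char_block_diag_mx det_ublock -/(char_poly _).
have -> : char_poly comp_mx = f; last by [].
rewrite -[RHS](companionmxK fm) /char_poly -[RHS]det_tr; congr (\det _).
by rewrite /char_poly_mx linearB /= tr_scalar_mx map_trmx.
Qed.

Section AtPoint.
Variables (p : C) (l : seq C).
Hypothesis p1 : `|p| = 1.
Hypothesis fl : fibre p f = \prod_(z <- l) ('X - z%:P).
Hypothesis ul : uniq l.

Let size_l : size l = d.
Proof. by rewrite -(size_fibre_monic p fm) fl size_prod_XsubC. Qed.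

Let s : 'rV[C]_d := \row_i l`_i.
Let S := diag_mx s.
Let V : 'M[C]_d := (Vandermonde d s)^T.

Let s_root i : (fibre p f).[s 0 i] = 0.
Proof.
rewrite fl; apply/rootP; rewrite root_prod_XsubC mxE mem_nth // size_l.
exact: ltn_ord.
Qed.

Let VE i k : V i k = s 0 i ^+ k.
Proof. by rewrite !mxE. Qed.

Let V_unit : V \in unitmx.
Proof.
rewrite unitmxE unitfE det_tr det_Vandermonde.
apply/prodf_neq0 => i _; apply/prodf_neq0 => j ij; rewrite subr_eq0 !mxE.
by rewrite nth_uniq ?size_l ?ltn_ord // gtn_eqF.
Qed.

Let VT : V *m evmx p comp_mx = S *m V.
Proof.
apply/matrixP => i k; rewrite mul_diag_mx [RHS]mxE mxE.
have [kd|kd] := eqVneq (k : nat) d.-1.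
  transitivity (- \sum_(j < d) s 0 i ^+ j * (f`_j).[p]).
    rewrite -sumrN; apply: eq_bigr => j _; rewrite VE evmxE !mxE kd eqxx.
    by rewrite hornerN mulrN.
  have sfp : size (fibre p f) = d.+1.
    by rewrite size_fibre_monic // prednK // ltnW.
  have := s_root i; rewrite (horner_monic _ (fibre_monic p fm) sfp).
  rewrite addrC => /eqP; rewrite addr_eq0 => /eqP e.
  rewrite VE kd -exprS prednK; last by rewrite -ltnS prednK // ltnW.
  by rewrite e; congr (- _); apply: eq_bigr => j _; rewrite coef_fibre mulrC.
have kd' : (k.+1 < d)%N.
  by have := ltn_ord k; move: kd; move: (size f).-1 (k : nat) => a b /eqP; lia.
rewrite (bigD1 (Ordinal kd')) //= big1 ?addr0; last first.
  move=> j jk; rewrite VE evmxE !mxE (negPf kd).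
  rewrite (_ : (k.+1 == j) = false) ?horner0 ?mulr0 //.
  by apply: contraNF jk => /eqP e; apply/eqP/val_inj.
by rewrite !VE evmxE !mxE (negPf kd) eqxx hornerC mulr1 exprS.
Qed.

Let V_pow m : V *m evmx p (comp_mx ^+ m) = diag_mx (\row_i s 0 i ^+ m) *m V.
Proof.
elim: m => [|m IHm].
  rewrite expr0 /evmx map_mx1 mulmx1 (_ : diag_mx _ = 1%:M) ?mul1mx //.
  by apply/matrixP => i j; rewrite !mxE expr0.
rewrite exprSr evmxM mulmxA IHm -mulmxA VT mulmxA mulmx_diag.
by congr (diag_mx _ *m _); apply/rowP => i; rewrite !mxE exprSr.
Qed.

Let trace_pow m : (\tr (comp_mx ^+ m)).[p] = \sum_i s 0 i ^+ m.
Proof.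
have -> : (\tr (comp_mx ^+ m)).[p] = \tr (evmx p (comp_mx ^+ m)).
  exact: (esym (trace_map_mx (horner_eval p) _)).
rewrite -[evmx p _](mulKmx V_unit) V_pow mxtrace_mulC -mulmxA mulmxV // mulmx1.
by rewrite mxtrace_diag; apply: eq_bigr => i _; rewrite mxE.
Qed.

Hypothesis torus : forall z w, z * w = p -> f.[z + w, p] = 0 -> `|z| = 1 /\ `|w| = 1.
Hypothesis off_royal : forall z, z \in l -> z ^+ 2 - 4 * p != 0.

Let pair_exists i : exists z : C * C,
  [/\ z.1 + z.2 = s 0 i, z.1 * z.2 = p, `|z.1| = 1, `|z.2| = 1 & z.1 != z.2].
Proof.
have [z [e1 e2]] := symmetrizationP (s 0 i) p; exists z; rewrite e1 e2.
have [n1 n2] : `|z.1| = 1 /\ `|z.2| = 1.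
  by apply: torus => //; rewrite e1 hornerXY_fibre.
split=> //; have : s 0 i ^+ 2 - 4 * p != 0.
  by apply: off_royal; rewrite mxE mem_nth // size_l ltn_ord.
by apply: contraNneq => z12; rewrite -e1 -e2 z12; apply/eqP; ring.
Qed.

Let p0 : p != 0.
Proof. by rewrite -normr_gt0 p1 ltr01. Qed.

(** [E] evaluates an element of the doubled module at the [2 d] points [(s_i, z_i)] and
    [(s_i, w_i)]. It diagonalizes multiplication by [z] with unimodular eigenvalues, and is
    invertible because the [s_i] are distinct and [z_i != w_i]. *)
Lemma comp_form_gram : exists E D : 'M[C]_(d + d),
  [/\ \det E != 0, E^t* *m E = p ^- d.+1 *: evmx p comp_form,
     D^t* *m D = 1%:M & E *m evmx p comp_root1 = D *m E].
Proof.
have [z hz] := choice pair_exists.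
pose D1 : 'M[C]_d := diag_mx (\row_i (z i).1).
pose D2 : 'M[C]_d := diag_mx (\row_i (z i).2).
have D12 : D1 + D2 = S.
  rewrite -raddfD; congr diag_mx; apply/rowP => i.
  transitivity ((z i).1 + (z i).2); first by rewrite !mxE.
  by case: (hz i).
have D1D2 : D1 *m D2 = p%:M.
  rewrite mulmx_diag -diag_const_mx; congr diag_mx; apply/rowP => i.
  by rewrite !mxE; case: (hz i).
have adj_diag (r : 'rV[C]_d) : (diag_mx r)^t* = diag_mx (map_mx Num.Def.conjC r).
  by rewrite tr_diag_mx map_diag_mx.
have D1u : D1^t* *m D1 = 1%:M.
  rewrite adj_diag mulmx_diag -diag_const_mx; congr diag_mx; apply/rowP => i.
  by rewrite !mxE mulrC -normCK; case: (hz i) => _ _ -> _ _; rewrite expr1n.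
have D2u : D2^t* *m D2 = 1%:M.
  rewrite adj_diag mulmx_diag -diag_const_mx; congr diag_mx; apply/rowP => i.
  by rewrite !mxE mulrC -normCK; case: (hz i) => _ _ _ -> _; rewrite expr1n.
(* On the torus [conj(z + w) = 1 / z + 1 / w = (z + w) / (z w)]. *)
have sJ i : (s 0 i)^* = p^-1 * s 0 i.
  have [<- <- n1 n2 _] := hz i; rewrite rmorphD /= !norm1_conjC //.
  have z10 : (z i).1 != 0 by rewrite -normr_gt0 n1 ltr01.
  have z20 : (z i).2 != 0 by rewrite -normr_gt0 n2 ltr01.
  by field; rewrite z10 z20.
have SJ : S^t* = p^-1 *: S.
  by rewrite adj_diag -linearZ; congr diag_mx; apply/rowP => i; rewrite [LHS]mxE [RHS]mxE sJ.
pose H := V^t* *m V.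
have gramE : evmx p comp_gram = p ^+ d *: H.
  apply/matrixP => j k; rewrite evmxE [comp_gram _ _]mxE hornerM hornerXn trace_pow.
  rewrite [RHS]mxE [H _ _]mxE !mulr_sumr; apply: eq_bigr => i _.
  rewrite adjmxE !VE rmorphXn /= sJ exprMn exprD exprVn.
  have jd : (j <= d)%N := ltnW (ltn_ord j).
  have -> : p ^+ d = p ^+ (d - j) * p ^+ j by rewrite -exprD subnK.
  have pj0 : p ^+ j != 0 by rewrite expf_neq0.
  by move: (p ^+ j) pj0 => pj pj0; field.
have HT : H *m evmx p comp_mx = V^t* *m S *m V by rewrite -!mulmxA VT.
exists (block_mx V (D1 *m V) V (D2 *m V)), (block_mx D1 0 0 D2); split.
- have -> : block_mx V (D1 *m V) V (D2 *m V) = block_mx 1%:M 0 1%:M 1%:M *m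
      block_mx V (D1 *m V) 0 ((D2 - D1) *m V).
    rewrite mulmx_block !(mul1mx, mul0mx, mulmx0, addr0) mulmxBl.
    by rewrite addrC subrK.
  rewrite det_mulmx det_lblock det_ublock !det1 !mul1r det_mulmx.
  have V0 : \det V != 0 by rewrite -unitfE -unitmxE.
  rewrite !mulf_neq0 // -raddfB det_diag; apply/prodf_neq0 => i _.
  by rewrite !mxE subr_eq0 eq_sym; case: (hz i).
- rewrite tr_block_mx map_block_mx !adjmxM mulmx_block /comp_form.
  rewrite /evmx map_block_mx scale_block_mx -!/(evmx _ _) !evmxZ evmxM gramE.
  rewrite hornerM hornerX -scalemxAl !scalerA.
  have -> : V^t* *m D1^t* *m (D1 *m V) = H.
    by rewrite -mulmxA [D1^t* *m (_ *m _)]mulmxA D1u mul1mx.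
  have -> : V^t* *m D2^t* *m (D2 *m V) = H.
    by rewrite -mulmxA [D2^t* *m (_ *m _)]mulmxA D2u mul1mx.
  have -> : V^t* *m (D1 *m V) + V^t* *m (D2 *m V) = V^t* *m S *m V.
    by rewrite -mulmxDr -mulmxDl D12 mulmxA.
  have -> : V^t* *m D1^t* *m V + V^t* *m D2^t* *m V = p^-1 *: (V^t* *m S *m V).
    by rewrite -mulmxDl -mulmxDr -adjmxD D12 SJ -scalemxAr -scalemxAl.
  rewrite -HT -/H.
  have pd0 : p ^+ d != 0 by rewrite expf_neq0.
  have two : (2 : {poly C}).[p] = 2 by rewrite hornerMn hornerC.
  rewrite exprS two; move: (p ^+ d) pd0 => q q0.
  have c2 : (p * q)^-1 * (2 * p) * q = 2 by field; rewrite q0 p0.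
  have c1 : (p * q)^-1 * p * q = 1 by field; rewrite q0 p0.
  have c3 : (p * q)^-1 * q = p^-1 by field; rewrite q0 p0.
  by rewrite c1 c2 c3 scale1r scaler_nat mulr2n.
- rewrite tr_block_mx map_block_mx !trmx0 !map_mx0 mulmx_block.
  by rewrite !(mul0mx, mulmx0, addr0, add0r) D1u D2u -scalar_mx_block.
rewrite /comp_root1 /evmx map_block_mx -!/(evmx _ _) mulmx_block.
rewrite [RHS]mulmx_block !(mul0mx, add0r, addr0).
have -> : evmx p (0 : 'M_d) = 0 by rewrite /evmx map_mx0.
have -> : evmx p (1%:M : 'M_d) = 1%:M by rewrite /evmx map_mx1.
have -> : evmx p (- 'X%:M : 'M_d) = - p%:M.
  by rewrite -[- 'X%:M]scaleN1r evmxZ evmx_scalar hornerX hornerN hornerC scaleN1r.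
rewrite !(mulmx0, mulmx1, add0r) mulmxN mul_mx_scalar -!mulmxA VT.
rewrite !mulmxA -D12 !mulmxDr !mulmxDl.
have -> : D2 *m D1 = p%:M.
  rewrite -D1D2 !mulmx_diag; congr diag_mx; apply/rowP => i.
  by rewrite [LHS]mxE [RHS]mxE mulrC.
by rewrite D1D2 mul_scalar_mx addrCA addNr addr0 addKr.
Qed.

End AtPoint.
End CompanionForm.

Lemma fibre_eq_poly (C : numClosedFieldType) (f g : {poly {poly C}}) (c : {poly C}) :
  c != 0 -> (forall p, c.[p] != 0 -> fibre p f = fibre p g) -> f = g.
Proof.
move=> c0 H; apply/polyP => i; apply: (mulfI c0).
apply/eqP; rewrite -subr_eq0; apply/eqP.
apply: (poly_eq0_inj_seq (u := fun n => n%:R)) => [m n /eqP|n].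
  by rewrite eqr_nat => /eqP.
rewrite hornerD hornerN !hornerM; have [->|cn] := eqVneq c.[n%:R] 0.
  by rewrite !mul0r subrr.
by have /polyP/(_ i) := H _ cn; rewrite !coef_fibre => ->; rewrite subrr.
Qed.

Section IrreduciblePencil.
Variable C : numClosedFieldType.
Hypothesis scalar_fejer_riesz : forall (a : {poly C}) (m K : nat), a != 0 ->
  generic_circle (fun p => 0 <= a.[p] * p ^+ m * p ^- K) ->
  exists2 e, e != 0 & generic_circle (fun p => `|a.[p]| = `|e.[p]| ^+ 2).
Hypothesis circle_divide : forall d f g : {poly C}, d != 0 ->
  (forall a, `|a| < 1 -> d.[a] != 0) ->
  generic_circle (fun p => p * d.[p] * f.[p]^* = d.[p]^* * g.[p]) ->
  generic_circle (fun p => `|f.[p]| <= `|d.[p]|) ->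
  exists f' g', f = d * f' /\ g = d * g'.

Lemma irreducible_pencil (f : {poly {poly C}}) :
  f \is monic -> irreducible_poly f -> f != royal C ->
  (forall z w, `|z * w| = 1 -> f.[z + w, z * w] = 0 -> `|z| = 1 /\ `|w| = 1) ->
  exists n (P U : 'M[C]_n), [/\ (0 < n)%N, orthogonal_projection P,
    U \is unitarymx & det_variety (pencil_mx P U) = zero_set f].
Proof.
move=> fm irr nroyal torus; have sf := irr.1.
have [c1 c10 sep] := generic_separable fm irr.
have [c2 c20 off] := generic_not_royal fm irr nroyal.
have gram : generic_circle (fun p => exists E D,
    [/\ \det E != 0,
        E^t* *m E = p ^- (size f).-1.+1 *: evmx p (comp_form f),
        D^t* *m D = 1%:M & E *m evmx p (comp_root1 f) = D *m E]).
  have := generic_circleI (generic_circle_neq0 c10) (generic_circle_neq0 c20).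
  apply: generic_circle_mono => p p1 [/sep[l ul el] c2p].
  apply: (comp_form_gram fm sf p1 el ul) => [z w zw fz|z zl].
    by apply: torus; rewrite zw.
  apply: off => //; rewrite hornerXY_fibre el; apply/rootP.
  by rewrite root_prod_XsubC.
have [|X0 [c [X00 c0 X0E]]] := @matrix_fejer_riesz C scalar_fejer_riesz _
    (comp_form f) (size f).-1.+1.
  apply: generic_circle_mono gram => p p1 [E [D [E0 <- _ _]]].
  exact: posdefmx_gram.
have [X [XD XX0]] := remove_zeros X00.
have Xn0 : \det X != 0.
  have := XD 0; rewrite normr0 ltr01 => /(_ isT).
  by apply: contraNneq => ->; rewrite horner0.
have iso : generic_circle (fun p =>
    (evmx p (X *m comp_root1 f))^t* *m evmx p (X *m comp_root1 f) =
    (evmx p X)^t* *m evmx p X).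
  apply: generic_circle_mono (generic_circleI gram X0E) => p p1.
  move=> [[E [D [E0 EE DD ED]]] eX].
  have XE : (evmx p X)^t* *m evmx p X = `|c.[p]| ^+ 2 *: (E^t* *m E).
    by rewrite XX0 // eX EE scalerA.
  rewrite evmxM adjmxM -mulmxA [(evmx p X)^t* *m _]mulmxA XE.
  rewrite -scalemxAl -scalemxAr; congr (_ *: _).
  by rewrite -mulmxA ED !mulmxA -adjmxM ED adjmxM -!mulmxA [D^t* *m _]mulmxA DD mul1mx.
have [P [U [Pp Uu FX]]] := @pencil_realization C circle_divide _ X _ _ Xn0 XD
  (comp_root12 f) (comp_root21 f) iso.
exists ((size f).-1 + (size f).-1)%N, P, U; split=> //.
  by move: sf; case: (size f) => [|[|n]].
(* On the doubled module [z + w] acts as [s] on each of the two copies, so its characteristic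
   polynomial is the square. *)
have -> : zero_set f = zero_set (f * f) by rewrite zero_setM setUid.
rewrite det_varietyE; congr zero_set; apply: (fibre_eq_poly Xn0) => p Xp.
rewrite fibre_pencil_poly -char_poly_comp_root_sum //.
by apply: (char_poly_intertwine (X := evmx p X)); rewrite ?det_evmx.
Qed.

End IrreduciblePencil.

(** * Direct sums of pencils and the curve [s^2 = 4 p] *)

Section DirectSum.
Variable C : numClosedFieldType.

Lemma orthogonal_projection_sum m n (P1 : 'M[C]_m) (P2 : 'M[C]_n) :
  orthogonal_projection P1 -> orthogonal_projection P2 ->
  orthogonal_projection (block_mx P1 0 0 P2 : 'M_(m + n)).
Proof.
move=> [PP1 Ps1] [PP2 Ps2]; split.
  by rewrite mulmx_block !(mul0mx, mulmx0, addr0, add0r) PP1 PP2.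
by rewrite tr_block_mx map_block_mx !trmx0 !map_mx0 Ps1 Ps2.
Qed.

Lemma unitarymx_sum m n (U1 : 'M[C]_m) (U2 : 'M[C]_n) :
  U1 \is unitarymx -> U2 \is unitarymx ->
  (block_mx U1 0 0 U2 : 'M_(m + n)) \is unitarymx.
Proof.
move=> /unitarymxP u1 /unitarymxP u2; apply/unitarymxP.
rewrite tr_block_mx map_block_mx !trmx0 !map_mx0 mulmx_block.
by rewrite !(mul0mx, mulmx0, addr0, add0r) u1 u2 -scalar_mx_block.
Qed.

Lemma det_variety_sum m n (P1 U1 : 'M[C]_m) (P2 U2 : 'M[C]_n) :
  det_variety (pencil_mx (block_mx P1 0 0 P2 : 'M_(m + n)) (block_mx U1 0 0 U2)) =
  det_variety (pencil_mx P1 U1) `|` det_variety (pencil_mx P2 U2).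
Proof.
have -> : pencil_mx (block_mx P1 0 0 P2 : 'M_(m + n)) (block_mx U1 0 0 U2) =
    block_mx (pencil_mx P1 U1) 0 0 (pencil_mx P2 U2).
  rewrite /pencil_mx scalar_mx_block opp_block_mx add_block_mx !oppr0 !addr0.
  rewrite tr_block_mx map_block_mx !trmx0 !map_mx0 !mulmx_block add_block_mx.
  by rewrite !(mul0mx, mulmx0, addr0, add0r).
have detE s p : \det ((block_mx (pencil_mx P1 U1) 0 0 (pencil_mx P2 U2))^t* +
      p *: block_mx (pencil_mx P1 U1) 0 0 (pencil_mx P2 U2) - s%:M) =
    \det ((pencil_mx P1 U1)^t* + p *: pencil_mx P1 U1 - s%:M) *
    \det ((pencil_mx P2 U2)^t* + p *: pencil_mx P2 U2 - s%:M).
  rewrite tr_block_mx map_block_mx !trmx0 !map_mx0 scale_block_mx add_block_mx.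
  rewrite scalar_mx_block opp_block_mx add_block_mx.
  by rewrite !(oppr0, addr0, scaler0) det_ublock.
apply/seteqP; split=> -[s p]; rewrite /det_variety /= detE.
  by move/eqP; rewrite mulf_eq0 => /orP[]/eqP; [left|right].
by case=> ->; rewrite ?mul0r ?mulr0.
Qed.

Lemma pencil_mx_swap n :
  pencil_mx (block_mx 1%:M 0 0 0 : 'M[C]_(n + n)) (block_mx 0 1%:M 1%:M 0) =
    block_mx 0 (2%:M) 0 0.
Proof.
rewrite /pencil_mx scalar_mx_block opp_block_mx add_block_mx !oppr0 !addr0 subrr.
rewrite tr_block_mx map_block_mx !trmx0 !map_mx0 adjmx1 !mulmx_block add_block_mx.
rewrite !(mul0mx, mulmx0, mulmx1, mul1mx, addr0, add0r).
by rewrite -raddfD.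
Qed.

Lemma det_block11 (a b c d : C) :
  \det (block_mx a%:M b%:M c%:M d%:M : 'M_(1 + 1)) = a * d - b * c.
Proof.
rewrite (expand_det_row _ (lshift 1 ord0)) big_split_ord !big_ord1 /=.
rewrite block_mxEul block_mxEur /cofactor !det_mx11 !mxE /=.
have -> : lift (lshift 1 (ord0 : 'I_1)) (ord0 : 'I_1) = rshift 1 ord0 :> 'I_(1 + 1).
  exact/val_inj.
have -> : lift (rshift 1 (ord0 : 'I_1)) (ord0 : 'I_1) = lshift 1 ord0 :> 'I_(1 + 1).
  exact/val_inj.
rewrite -[rshift 1 ord0]/(unsplit (inr ord0)) -[lshift 1 ord0]/(unsplit (inl ord0)).
rewrite !unsplitK /= !row_mxEl !row_mxEr !mxE /= !mulr1n expr0 expr1.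
by rewrite mul1r mulN1r mulrN.
Qed.

(** Where [z = w] the matrix [E] of [comp_form_gram] is singular, so this curve is done by hand: [F]
    is nilpotent with single entry [2], and the determinant is [s^2 - 4 p]. *)
Lemma royal_pencil : exists P U : 'M[C]_(1 + 1), [/\ orthogonal_projection P,
  U \is unitarymx & det_variety (pencil_mx P U) = zero_set (royal C)].
Proof.
exists (block_mx 1%:M 0 0 0), (block_mx 0 1%:M 1%:M 0).
split.
- split; last by rewrite tr_block_mx map_block_mx !trmx0 !map_mx0 adjmx1.
  by rewrite mulmx_block !(mul0mx, mulmx0, mulmx1, addr0, add0r).
- apply/unitarymxP; rewrite tr_block_mx map_block_mx !trmx0 !map_mx0 adjmx1.
  rewrite mulmx_block !(mul0mx, mulmx0, mulmx1, addr0, add0r).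
  by rewrite -scalar_mx_block.
have detE s p : \det ((block_mx 0 2%:M 0 0 : 'M[C]_(1 + 1))^t* +
    p *: block_mx 0 2%:M 0 0 - s%:M) = s ^+ 2 - 4 * p.
  have -> : (block_mx 0 2%:M 0 0 : 'M[C]_(1 + 1))^t* +
    p *: block_mx 0 2%:M 0 0 - s%:M =
    (block_mx (- s)%:M (p * 2)%:M 2%:M (- s)%:M : 'M_(1 + 1)).
    rewrite tr_block_mx map_block_mx !trmx0 !map_mx0 tr_scalar_mx map_scalar_mx.
    rewrite scale_block_mx add_block_mx scalar_mx_block opp_block_mx add_block_mx.
    rewrite !(oppr0, addr0, add0r, scaler0) /= conjC_nat scale_scalar_mx.
    by rewrite -raddfN.
  by rewrite det_block11; ring.
apply/seteqP; split=> -[s p]; rewrite /zero_set /det_variety /= royalE.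
  by rewrite pencil_mx_swap detE.
by rewrite pencil_mx_swap detE.
Qed.

End DirectSum.

Section ProductPencil.
Variable R : realType.
Local Notation C := R[i].

Lemma product_pencil (s : seq {poly {poly C}}) : s != [::] ->
  (forall f, f \in s -> [/\ f \is monic, irreducible_poly f &
    forall z w, `|z * w| = 1 -> f.[z + w, z * w] = 0 -> `|z| = 1 /\ `|w| = 1]) ->
  exists n (P U : 'M[C]_n), [/\ (0 < n)%N, orthogonal_projection P,
    U \is unitarymx & det_variety (pencil_mx P U) = zero_set (\prod_(f <- s) f)].
Proof.
have single f : f \is monic -> irreducible_poly f ->
    (forall z w, `|z * w| = 1 -> f.[z + w, z * w] = 0 -> `|z| = 1 /\ `|w| = 1) ->
    exists n (P U : 'M[C]_n), [/\ (0 < n)%N, orthogonal_projection P,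
    U \is unitarymx & det_variety (pencil_mx P U) = zero_set f].
  move=> fm irr torus; have [->|nr] := eqVneq f (royal C).
    by have [P [U [PP UU WE]]] := royal_pencil C; exists (1 + 1)%N, P, U.
  exact: (irreducible_pencil (@scalar_fejer_riesz R) (@circle_divide R) fm irr nr torus).
elim: s => [//|f s IHs] _ sP.
have [fm irr tf] := sP f (mem_head _ _).
have [n [P [U [n0 PP UU WE]]]] := single f fm irr tf.
have [s0|s0] := eqVneq s [::].
  by exists n, P, U; split; rewrite // s0 big_seq1.
have [|m [Q [V [m0 QQ VV XE]]]] := IHs s0.
  by move=> g gs; apply: sP; rewrite inE gs orbT.
exists (n + m)%N, (block_mx P 0 0 Q), (block_mx U 0 0 V); split.
- by rewrite addn_gt0 n0.
- exact: orthogonal_projection_sum.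
- exact: unitarymx_sum.
- by rewrite det_variety_sum WE XE big_cons zero_setM.
Qed.

End ProductPencil.

(** * Means over roots of unity and polynomials on the disk *)

Section RootsOfUnity.
Variable C : numClosedFieldType.
Implicit Types (z w : C) (n M : nat).

Lemma prim_root_exists n : (0 < n)%N -> exists w : C, n.-primitive_root w.
Proof.
move=> n0; have [r rE] := closed_field_poly_normal ('X^n - 1 : {poly C}).
rewrite (monicP _) ?monicXnsubC // scale1r in rE.
have rn : all n.-unity_root r by apply/allP => z; rewrite -root_prod_XsubC -rE.
have sr : (n <= size r)%N.
  by rewrite -ltnS -(size_prod_XsubC r id) -rE size_XnsubC.
have [|w _ wn] := hasP (has_prim_root n0 rn _ sr); last by exists w.
by rewrite -separable_prod_XsubC -rE separable_Xn_sub_1 // pnatr_eq0 -lt0n.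
Qed.

Lemma prim_root_sum n w m : n.-primitive_root w ->
  \sum_(i < n) w ^+ (i * m) = if (n %| m)%N then n%:R else 0.
Proof.
move=> wn; under eq_bigr do rewrite mulnC exprM.
case: ifPn; rewrite (prim_order_dvd wn).
  move=> /eqP ->; under eq_bigr do rewrite expr1n.
  by rewrite sumr_const card_ord.
move=> wm1; have := subrX1 (w ^+ m) n.
rewrite -exprM mulnC exprM (prim_expr_order wn) expr1n subrr => /esym/eqP.
by rewrite mulf_eq0 subr_eq0 (negPf wm1) => /eqP.
Qed.

Lemma prim_root_norm n w : n.-primitive_root w -> `|w| = 1.
Proof.
move=> wn; apply/eqP; rewrite -(pexpr_eq1 (prim_order_gt0 wn)) ?normr_ge0 //.
by rewrite -normrX (prim_expr_order wn) normr1.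
Qed.

(** Discrete Fourier inversion: [M - i] stands for the exponent [- i], and [size S <= M] prevents
    aliasing. *)
Lemma prim_root_fourier M w (S : {poly C}) (r : C) i : M.-primitive_root w ->
  (size S <= M)%N -> (i < M)%N ->
  \sum_(k < M) w ^+ (k * (M - i)) * S.[r * w ^+ k] = M%:R * (S`_i * r ^+ i).
Proof.
move=> wM sS iM.
transitivity (\sum_(m < M) S`_m * r ^+ m * \sum_(k < M) w ^+ (k * (M - i + m))).
  under [RHS]eq_bigr do rewrite mulr_sumr; rewrite exchange_big /=.
  apply: eq_bigr => k _; rewrite (horner_coef_wide _ sS) mulr_sumr.
  apply: eq_bigr => m _; rewrite exprMn -exprM mulnDr exprD.
  by rewrite mulrC -!mulrA; do 2!congr (_ * _); rewrite mulrC.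
rewrite (bigD1 (Ordinal iM)) //= subnK ?(ltnW iM) // (prim_root_sum _ wM) dvdnn.
rewrite big1 ?addr0 => [|m mi]; first by rewrite mulrC.
rewrite (prim_root_sum _ wM) ifF ?mulr0 //; apply/negP => /dvdnP[k kE].
have mM := ltn_ord m; have mi' : nat_of_ord m != i by [].
by case: k kE => [|[|k]] kE; nia.
Qed.

(** For real [r] the function [p^l conj(S(p))] has only frequencies at most [l]; the bound
    [size S + i <= M] keeps the negative ones from wrapping around to [i]. *)
Lemma prim_root_fourier_reflect M w (S : {poly C}) (r : C) l i :
  M.-primitive_root w -> r^* = r -> (size S + i <= M)%N -> (l < i)%N -> (i < M)%N ->
  \sum_(k < M) w ^+ (k * (M - i)) * ((r * w ^+ k) ^+ l * (S.[r * w ^+ k])^*) = 0.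
Proof.
move=> wM rr sS li iM; apply: (can_inj (@conjCK C)); rewrite conjC0.
have wJ m n : (m <= M)%N -> (w ^+ (n * m))^* = w ^+ (n * (M - m)).
  move=> mM; have w1 : `|w ^+ (n * m)| = 1 by rewrite normrX (prim_root_norm wM) expr1n.
  rewrite (norm1_conjC w1); apply: (mulfI (_ : w ^+ (n * m) != 0)).
    by rewrite -normr_gt0 w1.
  rewrite divff; last by rewrite -normr_gt0 w1.
  by rewrite -exprD -mulnDr subnKC // mulnC exprM (prim_expr_order wM) expr1n.
rewrite rmorph_sum /=.
transitivity (r ^+ l * \sum_(k < M) w ^+ (k * (M - (M - (i - l)))) * S.[r * w ^+ k]).
  rewrite mulr_sumr; apply: eq_bigr => k _.
  rewrite [RHS]mulrA exprMn -exprM mulrA rmorphM /= conjCK; congr (_ * _).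
  rewrite [w ^+ _ * _]mulrC -mulrA -exprD -mulnDr rmorphM /= rmorphXn /= rr; congr (_ * _).
  rewrite wJ; last by lia.
  by congr (w ^+ (k * _)); lia.
rewrite (prim_root_fourier _ wM) ?nth_default ?mul0r ?mulr0 //; try lia.
by apply: leq_trans (_ : (M - i <= _)%N); [rewrite leq_subRL ?(ltnW iM) // addnC | lia].
Qed.

End RootsOfUnity.

(** * Uniform approximation by polynomials on smaller disks *)

Section DiskApproximation.
Variable R : realType.
Local Notation C := R[i].
Implicit Types (F G : C -> C) (q : {poly C}) (r : R).

(** Required for all [r < 1], this plays the part of holomorphy in the unit disk. *)
Definition disk_approx r F := forall eps : R, 0 < eps ->
  exists q : {poly C}, forall p, modulus p <= r -> modulus (F p - q.[p]) < eps.

Lemma poly_bounded q r :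
  exists2 B : R, 0 < B & forall p, modulus p <= r -> modulus q.[p] <= B.
Proof.
elim/poly_ind: q => [|q c [B B0 qB]].
  by exists 1 => // p _; rewrite horner0 modulus0.
have c0 := modulus_ge0 c.
exists (B * (`|r| + 1) + modulus c); first by rewrite ltr_wpDr // mulr_gt0 ?ltr_wpDl.
move=> p pr; rewrite hornerMXaddC (le_trans (modulusD _ _)) // lerD2r modulusM.
apply: ler_pM; rewrite ?modulus_ge0 ?qB // (le_trans pr) //.
by rewrite (le_trans (ler_norm r)) // lerDl.
Qed.

Lemma disk_approx_bounded r F : disk_approx r F ->
  exists2 B : R, 0 < B & forall p, modulus p <= r -> modulus (F p) <= B.
Proof.
move=> /(_ 1 ltr01)[q Fq]; have [B B0 qB] := poly_bounded q r.
exists (1 + B); first by rewrite addr_gt0.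
move=> p pr; rewrite -[F p](subrK q.[p]) (le_trans (modulusD _ _)) //.
by rewrite lerD ?qB // ltW ?Fq.
Qed.

Lemma disk_approx_eq r F G : (forall p, modulus p <= r -> F p = G p) ->
  disk_approx r F -> disk_approx r G.
Proof.
move=> FG Fr eps /Fr[q qF]; exists q => p pr.
by rewrite -(FG _ pr) qF.
Qed.

Lemma disk_approx_horner r q : disk_approx r (fun p => q.[p]).
Proof. by move=> eps e0; exists q => p _; rewrite subrr modulus0. Qed.

Lemma disk_approx_cst r c : disk_approx r (fun=> c).
Proof. by apply: disk_approx_eq (disk_approx_horner r c%:P) => p _; rewrite hornerC. Qed.

Lemma disk_approxD r F G : disk_approx r F -> disk_approx r G ->
  disk_approx r (fun p => F p + G p).
Proof.
move=> Fr Gr eps e0; have e2 : 0 < eps / 2 by rewrite divr_gt0.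
have [q qF] := Fr _ e2; have [s sG] := Gr _ e2; exists (q + s) => p pr.
have -> : F p + G p - (q + s).[p] = (F p - q.[p]) + (G p - s.[p]).
  by rewrite hornerD; ring.
rewrite (le_lt_trans (modulusD _ _)) // [ltRHS](splitr eps).
by rewrite ltrD ?qF ?sG.
Qed.

Lemma disk_approxM r F G : disk_approx r F -> disk_approx r G ->
  disk_approx r (fun p => F p * G p).
Proof.
move=> Fr Gr eps e0; have [B B0 FB] := disk_approx_bounded Fr.
have [|s sG] := Gr (eps / 2 / B); first by rewrite !divr_gt0.
have [D D0 sD] := poly_bounded s r.
have [|q qF] := Fr (eps / 2 / D); first by rewrite !divr_gt0.
exists (q * s) => p pr.
have -> : F p * G p - (q * s).[p] = F p * (G p - s.[p]) + (F p - q.[p]) * s.[p].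
  by rewrite hornerM; ring.
rewrite (le_lt_trans (modulusD _ _)) // [ltRHS](splitr eps) !modulusM ler_ltD //.
  have -> : eps / 2 = B * (eps / 2 / B) by rewrite [RHS]mulrC divfK ?gt_eqF.
  by rewrite ler_pM ?modulus_ge0 ?FB // ltW ?sG.
have -> : eps / 2 = eps / 2 / D * D by rewrite divfK ?gt_eqF.
apply: (le_lt_trans (y := modulus (F p - q.[p]) * D)).
  by rewrite ler_wpM2l ?modulus_ge0 ?sD.
by rewrite ltr_pM2r ?qF.
Qed.

Lemma disk_approx_sum (I : Type) (s : seq I) r (F : I -> C -> C) :
  (forall i, disk_approx r (F i)) ->
  disk_approx r (fun p => \sum_(i <- s) F i p).
Proof.
move=> Fr; elim: s => [|i s IHs].
  by apply: disk_approx_eq (disk_approx_cst r 0) => p _; rewrite big_nil.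
by apply: disk_approx_eq (disk_approxD (Fr i) IHs) => p _; rewrite big_cons.
Qed.

Lemma disk_approx_lim r F : (forall eps : R, 0 < eps ->
    exists2 G, disk_approx r G &
      forall p, modulus p <= r -> modulus (F p - G p) < eps) ->
  disk_approx r F.
Proof.
move=> FG eps e0; have e2 : 0 < eps / 2 by rewrite divr_gt0.
have [G /(_ _ e2)[q Gq] FGe] := FG _ e2; exists q => p pr.
have -> : F p - q.[p] = (F p - G p) + (G p - q.[p]) by ring.
rewrite (le_lt_trans (modulusD _ _)) // [ltRHS](splitr eps).
by rewrite ltrD ?Gq ?FGe.
Qed.

Lemma expr_small (t eps : R) : 0 <= t < 1 -> 0 < eps ->
  exists N, forall n, (N <= n)%N -> t ^+ n < eps.
Proof.
move=> /andP[t0 t1] e0; have t1' : `|t| < 1 by rewrite ger0_norm.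
have /cvgrPdist_lt/(_ _ e0)[N _ HN] := cvg_expr t1'.
exists N => n Nn; have := HN n Nn.
by rewrite sub0r normrN ger0_norm // exprn_ge0.
Qed.

(** Truncated geometric series in [p / b], with remainder [(p / b)^N / (p - b)]. *)
Lemma disk_approx_invlin r (b : C) : 0 <= r -> r < modulus b ->
  disk_approx r (fun p => (p - b)^-1).
Proof.
move=> r0 rb eps e0; have b0 : 0 < modulus b := le_lt_trans r0 rb.
have b0' : b != 0 by rewrite -modulus_gt0.
have t01 : 0 <= r / modulus b < 1.
  by rewrite (divr_ge0 r0 (ltW b0)) /= ltr_pdivrMr // mul1r.
have br : 0 < modulus b - r by rewrite subr_gt0.
have [|N HN] := expr_small t01 (eps := eps * (modulus b - r)).
  by rewrite mulr_gt0.
exists (- b^-1 *: \sum_(i < N) (b^-1 *: 'X) ^+ i) => p pr.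
have pb : b - p != 0.
  rewrite -modulus_gt0 (lt_le_trans br) // (le_trans _ (modulusB_ge _ _)) //.
  by rewrite lerD2l lerN2.
have -> : (p - b)^-1 - (- b^-1 *: \sum_(i < N) (b^-1 *: 'X) ^+ i).[p] =
    (p / b) ^+ N / (p - b).
  rewrite hornerZ horner_sum; under eq_bigr do rewrite horner_exp hornerZ hornerX.
  have := subrX1 (b^-1 * p) N; rewrite [b^-1 * p]mulrC; set S := \sum_(i < N) _.
  move=> e; have pb' : p - b != 0 by rewrite -opprB oppr_eq0.
  have -> : (p / b) ^+ N = 1 + (p / b - 1) * S by rewrite -e; ring.
  by field; rewrite b0' pb'.
rewrite modulusM modulusV ltr_pdivrMr; last by rewrite modulusBC modulus_gt0.
have pN : modulus ((p / b) ^+ N) <= (r / modulus b) ^+ N.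
  by rewrite modulusX modulusM modulusV lerXn2r ?nnegrE ?ler_wpM2r ?mulr_ge0 ?invr_ge0 ?modulus_ge0.
rewrite (le_lt_trans pN) // (lt_le_trans (HN N (leqnn N))) //.
rewrite ler_pM2l // modulusBC (le_trans _ (modulusB_ge _ _)) //.
by rewrite lerD2l lerN2.
Qed.

Lemma disk_approx_invpoly r q : 0 <= r -> r < 1 ->
  (forall p, modulus p < 1 -> q.[p] != 0) -> disk_approx r (fun p => (q.[p])^-1).
Proof.
move=> r0 r1 q0; have [s qE] := closed_field_poly_normal q.
have qn0 : q != 0.
  by apply/eqP => qz; move: (q0 0); rewrite qz horner0 modulus0 ltr01 eqxx => /(_ isT).
have sb b : b \in s -> r < modulus b.
  move=> bs; apply: (lt_le_trans r1); rewrite leNgt; apply/negP => /q0 /eqP; apply.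
  by apply/rootP; rewrite qE rootZ ?root_prod_XsubC // lead_coef_eq0.
have H : disk_approx r (fun p => (\prod_(b <- s) (p - b))^-1).
  elim: s {qE} sb => [_|b s IHs sb].
    by apply: disk_approx_eq (disk_approx_cst r 1) => p _; rewrite big_nil invr1.
  have Hb := disk_approx_invlin r0 (sb b (mem_head _ _)).
  have Hs : disk_approx r (fun p => (\prod_(b <- s) (p - b))^-1).
    by apply: IHs => c cs; apply: sb; rewrite inE cs orbT.
  apply: disk_approx_eq (disk_approxM Hb Hs) => p _.
  by rewrite big_cons invfM.
apply: disk_approx_eq (disk_approxM (disk_approx_cst r (lead_coef q)^-1) H) => p _.
rewrite [in RHS]qE hornerZ horner_prod invfM; congr (_ * _^-1).
by apply: eq_bigr => b _; rewrite hornerXsubC.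
Qed.
End DiskApproximation.

Section ReflectionCriterion.
Variable R : realType.
Local Notation C := R[i].
Implicit Types (F P : C -> C) (q S : {poly C}) (r : R).

(** Averaging against the frequency [- i] over the circle of radius [r] keeps the coefficient [i] of
    [S] and kills the reflected term. *)
Lemma reflection_coef S l r eta i : 0 < r -> (l < i)%N ->
  (forall p, modulus p = r -> modulus (S.[p] - p ^+ l * (S.[p])^*) <= eta) ->
  modulus S`_i * r ^+ i <= eta.
Proof.
move=> r0 li HS; pose M := (size S + i).+1.
have [w wM] := prim_root_exists C (ltn0Sn (size S + i)).
have w1 : modulus w = 1 by apply/norm_eq1; exact: prim_root_norm wM.
have iM : (i < M)%N by rewrite ltnS leq_addl.
pose x (k : nat) : C := (r%:C)%C * w ^+ k.
have xr k : modulus (x k) = r.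
  by rewrite modulusM modulusX w1 expr1n mulr1 modulus_realc gtr0_norm.
have e : \sum_(k < M) w ^+ (k * (M - i)) * (S.[x k] - x k ^+ l * (S.[x k])^*) =
    M%:R * (S`_i * (r%:C)%C ^+ i).
  under eq_bigr do rewrite mulrBr.
  rewrite sumrB (prim_root_fourier _ wM) //; last by rewrite leqW // leq_addr.
  rewrite (prim_root_fourier_reflect wM) ?subr0 ?leqnSn //.
  exact: conjc_real.
have M0 : 0 < M%:R :> R by rewrite ltr0n.
rewrite -(ler_pM2l M0).
have -> : M%:R * (modulus S`_i * r ^+ i) = modulus (M%:R * (S`_i * (r%:C)%C ^+ i)).
  rewrite !modulusM modulusX modulus_realc (gtr0_norm r0); congr (_ * _).
  by rewrite -[M%:R in RHS](rmorph_nat (@real_complex R)) modulus_realc gtr0_norm.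
rewrite -e (le_trans (modulus_sum _ _ _)) //.
apply: (le_trans (y := \sum_(k < M) eta)); last first.
  by rewrite sumr_const card_ord mulr_natl.
by apply: ler_sum => k _; rewrite modulusM modulusX w1 expr1n mul1r HS.
Qed.

(** The limit is the Lagrange interpolant of [P] at [n + 1] nodes. An approximant of bounded degree
    is its own interpolant, so its errors at the nodes bound its distance to that interpolant
    elsewhere. *)
Lemma poly_uniform_limit n (a : R) P : 0 < a ->
  (forall r : R, r < a -> forall eps : R, 0 < eps -> exists2 q : {poly C}, (size q <= n.+1)%N &
     forall p, modulus p <= r -> modulus (P p - q.[p]) < eps) ->
  exists2 q : {poly C}, (size q <= n.+1)%N & forall p, modulus p < a -> P p = q.[p].
Proof.
move=> a0 H; pose x (i : nat) : C := ((a / 2 / i.+1%:R)%:C)%C.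
have a2 : 0 < a / 2 by rewrite divr_gt0.
have xI : injective x.
  move=> i j /complexI /(mulfI (lt0r_neq0 a2)) /invr_inj /eqP.
  by rewrite eqr_nat => /eqP[].
have xa i : modulus (x i) <= a / 2.
  rewrite modulus_realc gtr0_norm; last by rewrite divr_gt0.
  by rewrite ler_pdivrMr // ler_peMr ?ler1n // ltW.
pose L i := tnth (lagrange n.+1 x) i : {poly C}.
pose q : {poly C} := \sum_(i < n.+1) (P (x i))%:P * L i.
have qs : (size q <= n.+1)%N.
  rewrite (leq_trans (size_sum _ _ _)) //; apply/bigmax_leqP => i _.
  rewrite mul_polyC (leq_trans (size_scale_leq _ _)) // size_lagrange_ //.
exists q => // p pa; apply/eqP; rewrite -subr_eq0 -modulus_eq0.
rewrite eq_le modulus_ge0 andbT; apply/ler_addgt0Pr => e e0; rewrite add0r.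
pose B : R := 1 + \sum_(i < n.+1) modulus (L i).[p].
have B0 : 0 < B by rewrite ltr_pwDl // sumr_ge0 // => i _; exact: modulus_ge0.
have ra : Num.max (a / 2) (modulus p) < a by rewrite gt_max pa andbT; lra.
have [|q0 sq0 Pq0] := H _ ra (e / B); first by rewrite divr_gt0.
have Lq0 : q0 = \sum_(i < n.+1) (q0.[x i])%:P * L i by exact: lagrange_gen.
have -> : P p - q.[p] =
    (P p - q0.[p]) + \sum_(i < n.+1) (q0.[x i] - P (x i)) * (L i).[p].
  have hq : q.[p] = \sum_(i < n.+1) P (x i) * (L i).[p].
    by rewrite horner_sum; apply: eq_bigr => i _; rewrite hornerM hornerC.
  have hq0 : q0.[p] = \sum_(i < n.+1) q0.[x i] * (L i).[p].
    by rewrite {1}Lq0 horner_sum; apply: eq_bigr => i _; rewrite hornerM hornerC.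
  under eq_bigr do rewrite mulrBl.
  by rewrite sumrB -hq -hq0; ring.
rewrite (le_trans (modulusD _ _)) //.
have -> : e = e / B + \sum_(i < n.+1) e / B * modulus (L i).[p].
  by rewrite -mulr_sumr -[X in X + _]mulr1 -mulrDr divfK ?gt_eqF.
apply: lerD; first by rewrite ltW // Pq0 // le_max lexx orbT.
rewrite (le_trans (modulus_sum _ _ _)) // ler_sum // => i _.
rewrite modulusM ler_wpM2r ?modulus_ge0 // ltW // modulusBC Pq0 //.
by rewrite le_max xa.
Qed.

Lemma one_minus_expr_le r n : 0 <= r <= 1 -> 1 - r ^+ n <= n%:R * (1 - r).
Proof.
move=> /andP[r0 r1]; elim: n => [|n IHn]; first by rewrite expr0 subrr mul0r.
have rn : r ^+ n <= 1 by rewrite exprn_ile1.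
have rn0 : 0 <= r ^+ n by rewrite exprn_ge0.
have -> : 1 - r ^+ n.+1 = (1 - r ^+ n) + r ^+ n * (1 - r) by rewrite exprSr; ring.
rewrite -natr1 mulrDl mul1r lerD // ler_piMl // subr_ge0 //.
Qed.

Lemma geometric_sum_le (t : R) n : 0 <= t < 1 -> \sum_(i < n) t ^+ i <= (1 - t)^-1.
Proof.
move=> /andP[t0 t1]; have t1' : 0 < 1 - t by rewrite subr_gt0.
rewrite -(ler_pM2l t1') divff ?gt_eqF //.
have := subrX1 t n; set S := \sum_(i < n) _ => e.
have -> : (1 - t) * S = 1 - t ^+ n by rewrite -[1 - t]opprB mulNr -e opprB.
by rewrite gerBl exprn_ge0.
Qed.

Lemma poly_tail_le S l r r0 (eta t : R) p : 0 < r -> 0 <= eta -> 0 <= t < 1 ->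
  r0 <= r * t -> (forall i, (l < i)%N -> modulus S`_i * r ^+ i <= eta) ->
  modulus p <= r0 -> modulus (S.[p] - (\poly_(i < l.+1) S`_i).[p]) <= eta / (1 - t).
Proof.
move=> rgt0 eta0 t01 r0t HS pr0; rewrite -hornerN -hornerD.
set D := S - _; rewrite horner_coef (le_trans (modulus_sum _ _ _)) //.
rewrite (le_trans _ (ler_wpM2l eta0 (geometric_sum_le (size D) t01))) //.
rewrite mulr_sumr ler_sum // => i _; rewrite modulusM modulusX.
have /andP[t0 _] := t01.
rewrite coefB coef_poly; case: ltnP => il.
  by rewrite subrr modulus0 mul0r mulr_ge0 ?exprn_ge0.
rewrite subr0 (le_trans (y := modulus S`_i * (r * t) ^+ i)) //.
  rewrite ler_wpM2l ?modulus_ge0 // lerXn2r ?nnegrE ?modulus_ge0 //.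
    by rewrite mulr_ge0 // ltW.
  exact: le_trans pr0 r0t.
by rewrite exprMn mulrA ler_wpM2r ?exprn_ge0 ?HS.
Qed.

(* On circles of radius close to [1], [P] nearly equals [p ^+ l * (P p)^*], whose
   Fourier coefficients of index above [l] vanish for polynomial approximants. *)
Lemma reflection_poly P l (D : R) : 0 <= D ->
  (forall r, 0 < r < 1 -> disk_approx r P) ->
  (forall p, modulus p < 1 ->
     modulus (P p - p ^+ l * (P p)^*) <= D * (1 - modulus p ^+ (2 * l))) ->
  exists2 q : {poly C}, (size q <= l.+1)%N & forall p, modulus p < 1 -> P p = q.[p].
Proof.
move=> D0 Pr PD; apply: (poly_uniform_limit ltr01) => r0' r0'1 eps e0.
pose r0 := Num.max 0 r0'.
have r00 : 0 <= r0 by rewrite le_max lexx.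
have r01 : r0 < 1 by rewrite gt_max ltr01.
have r0'r0 : r0' <= r0 by rewrite le_max lexx orbT.
(* Chosen with [r0 = t (1 + r0) / 2], so that every [r >= (1 + r0) / 2] gives [r0 <= r t]: on the
   smaller disk the tail decays like [t^i]. *)
pose t := 2 * r0 / (1 + r0).
have r0p : 0 < 1 + r0 by lra.
have t01 : 0 <= t < 1.
  by rewrite divr_ge0 ?mulr_ge0 ?(ltW r0p) //= ltr_pdivrMr // mul1r; lra.
have /andP[t0 t1] := t01.
(* The coefficients above [l] suffer three errors of size [e1]: the approximation error twice, and
   the reflection defect made small by [h]. The tail is then at most
   [3 * e1 / (1 - t) = 3 * eps / 8]. *)
pose e1 := eps * (1 - t) / 8.
have e10 : 0 < e1 by rewrite divr_gt0 // mulr_gt0 // subr_gt0.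
pose K := D * (2 * l)%:R + 1.
have K0 : 0 < K by rewrite ltr_wpDl // mulr_ge0.
pose h := Num.min ((1 - r0) / 2) (e1 / K).
have h0 : 0 < h by rewrite lt_min divr_gt0 ?subr_gt0 // divr_gt0.
have h1 : h <= (1 - r0) / 2 by rewrite ge_min lexx.
have hK : K * h <= e1 by rewrite mulrC -ler_pdivlMr // ge_min lexx orbT.
pose r := 1 - h.
have rr : (1 + r0) / 2 <= r by rewrite /r; lra.
have rgt0 : 0 < r by rewrite (lt_le_trans _ rr) // divr_gt0.
have r1 : r < 1 by rewrite /r; lra.
have [|S HS] := Pr r _ e1 e10; first by rewrite rgt0.
exists (\poly_(i < l.+1) S`_i); first exact: size_poly.
move=> p pr0'.
have pr0 : modulus p <= r0 := le_trans pr0' r0'r0.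
have r0t : r0 <= r * t.
  have -> : r0 = (1 + r0) / 2 * t by rewrite /t; field; lra.
  by rewrite ler_wpM2r.
have pr : modulus p <= r.
  by rewrite (le_trans pr0) // (le_trans r0t) // ler_piMr // ltW.
have eta0 : 0 <= 3 * e1 by rewrite mulr_ge0 // ltW.
have coefS i : (l < i)%N -> modulus S`_i * r ^+ i <= 3 * e1.
  move=> li; apply: (reflection_coef rgt0 li) => x xr.
  have x1 : modulus x < 1 by rewrite xr.
  have xr' : modulus x <= r by rewrite xr.
  have xl1 : modulus (x ^+ l) <= 1.
    by rewrite modulusX exprn_ile1 ?modulus_ge0 // ltW.
  have -> : S.[x] - x ^+ l * (S.[x])^* = - (P x - S.[x]) +
      (P x - x ^+ l * (P x)^*) + x ^+ l * (P x - S.[x])^*.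
    by rewrite rmorphB /=; ring.
  have a1 := HS x xr'; have a2 := PD x x1.
  have a3 : modulus (x ^+ l * (P x - S.[x])^*) <= e1.
    rewrite modulusM modulusJ (le_trans _ (ltW a1)) // ler_piMl ?modulus_ge0 //.
  have a4 : D * (1 - modulus x ^+ (2 * l)) <= e1.
    have /one_minus_expr_le -/(_ (2 * l)%N) : 0 <= modulus x <= 1.
      by rewrite modulus_ge0 ltW.
    rewrite {2}xr [1 - r]subKr => b; rewrite (le_trans _ hK) //.
    rewrite (le_trans (ler_wpM2l D0 b)) // mulrA ler_wpM2r ?(ltW h0) //.
    by rewrite lerDl.
  rewrite (le_trans (modulusD _ _)) // (le_trans (lerD (modulusD _ _) a3)) //.
  rewrite modulusN; lra.
have := poly_tail_le rgt0 eta0 t01 r0t coefS pr0.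
rewrite -[P p](subrK S.[p]) -addrA => a1.
rewrite (le_lt_trans (modulusD _ _)) // (le_lt_trans (lerD (ltW (HS p pr)) a1)) //.
have -> : 3 * e1 / (1 - t) = 3 * (eps / 8) by rewrite /e1; field; lra.
have : e1 <= eps / 8.
  by rewrite /e1 ler_pM2r ?invr_gt0 // ler_piMr ?(ltW e0) //; lra.
lra.
Qed.

End ReflectionCriterion.

(** * Root sums inside the bidisk *)

Section CircleKernel.
Variable C : numClosedFieldType.
Implicit Types (z v w s p : C) (l a M : nat).

(** For [a < M], the mean of [u^a u / (u - z)] over the [M]-th roots of unity [u]; it tends to [z^a]
    when [|z| < 1]. *)
Definition pole_mean M a z : C := z ^+ a / (1 - z ^+ M).

Lemma prim_root_exp_sub M w z k : M.-primitive_root w -> z ^+ M != 1 ->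
  w ^+ k - z != 0.
Proof.
move=> wM; apply: contraNneq => /subr0_eq <-.
by rewrite -exprM mulnC exprM (prim_expr_order wM) expr1n.
Qed.

Lemma prim_root_exp_neq0 M w k : M.-primitive_root w -> w ^+ k != 0.
Proof. by move=> wM; rewrite -normr_gt0 normrX (prim_root_norm wM) expr1n. Qed.

Lemma pole_meanE M w a z : M.-primitive_root w -> z ^+ M != 1 -> (a < M)%N ->
  \sum_(k < M) (w ^+ k) ^+ a * (w ^+ k / (w ^+ k - z)) = M%:R * pole_mean M a z.
Proof.
move=> wM zM aM; have z1 : 1 - z ^+ M != 0 by rewrite subr_eq0 eq_sym.
rewrite /pole_mean mulrA; apply: (canRL (mulfK z1)); rewrite mulr_suml.
transitivity (\sum_(m < M) z ^+ m * \sum_(k < M) w ^+ (k * (M - m + a))).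
  under [RHS]eq_bigr do rewrite mulr_sumr; rewrite exchange_big /=.
  apply: eq_bigr => k _; have wz := prim_root_exp_sub k wM zM.
  have wk : (w ^+ k) ^+ M = 1.
    by rewrite -exprM mulnC exprM (prim_expr_order wM) expr1n.
  rewrite -{1}wk subrXX.
  transitivity ((w ^+ k) ^+ a * w ^+ k * \sum_(i < M) (w ^+ k) ^+ (M.-1 - i) * z ^+ i).
    by field.
  rewrite mulr_sumr; apply: eq_bigr => m _.
  rewrite mulrA mulrC; congr (_ * _); rewrite -exprSr -exprD exprM.
  by congr (_ ^+ _); have := ltn_ord m; lia.
rewrite (bigD1 (Ordinal aM)) //= subnK ?(ltnW aM) // (prim_root_sum _ wM) dvdnn.
rewrite big1 ?addr0 => [|m mi]; first by rewrite mulrC.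
rewrite (prim_root_sum _ wM) ifF ?mulr0 //; apply/negP => /dvdnP[k kE].
have mM := ltn_ord m; have mi' : nat_of_ord m != a by [].
by case: k kE => [|[|k]] kE; nia.
Qed.

(** The logarithmic derivative [u d/du] of [u + p / u - s] at [u = w]: the share of one root in that
    of [f(u + p / u, p)]. *)
Definition log_kernel (w p s : C) : C := (w - p / w) / (w + p / w - s).

Lemma log_kernelE w z v : w != 0 -> w - z != 0 -> w - v != 0 ->
  log_kernel w (z * v) (z + v) = w / (w - z) + w / (w - v) - 1.
Proof.
move=> w0 wz wv; rewrite /log_kernel.
have -> : w + z * v / w - (z + v) = (w - z) * (w - v) / w by field.
by field; rewrite wz wv.
Qed.

Lemma log_kernel_sum M w a z v : M.-primitive_root w -> z ^+ M != 1 ->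
  v ^+ M != 1 -> (a < M)%N ->
  \sum_(k < M) (w ^+ k) ^+ a * log_kernel (w ^+ k) (z * v) (z + v) =
  M%:R * (pole_mean M a z + pole_mean M a v - (a == 0%N)%:R).
Proof.
move=> wM zM vM aM.
under eq_bigr => k _.
  rewrite log_kernelE ?(prim_root_exp_sub k wM) ?(prim_root_exp_neq0 k wM) //.
  rewrite mulrBr mulrDr mulr1; over.
rewrite sumrB big_split /= !pole_meanE // mulrBr mulrDr; congr (_ - _).
under eq_bigr do rewrite -exprM; rewrite (prim_root_sum _ wM).
case: a aM => [|a] aM; first by rewrite dvdn0 mulr1.
by rewrite gtnNdvd //= mulr0.
Qed.

(** On [M]-th roots of unity this is [w^l + (p / w)^l], with [M - l] standing for [- l]. At [l = 0]
    the value [1] instead of [2] makes each root count once. *)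
Definition circle_weight M l p w : C :=
  if l == 0%N then 1 else w ^+ l + p ^+ l * w ^+ (M - l).

Definition kernel_mean M w l p s : C :=
  M%:R^-1 * \sum_(k < M) circle_weight M l p (w ^+ k) * log_kernel (w ^+ k) p s.

Lemma kernel_mean0 M w z v : M.-primitive_root w -> z ^+ M != 1 ->
  v ^+ M != 1 -> (0 < M)%N ->
  kernel_mean M w 0 (z * v) (z + v) = pole_mean M 0 z + pole_mean M 0 v - 1.
Proof.
move=> wM zM vM M0; rewrite /kernel_mean.
have := log_kernel_sum wM zM vM M0.
under eq_bigr do rewrite expr0; rewrite /circle_weight /= => ->.
by rewrite mulKf // pnatr_eq0 -lt0n.
Qed.

Lemma kernel_meanS M w l z v : M.-primitive_root w -> z ^+ M != 1 ->
  v ^+ M != 1 -> (0 < l < M)%N ->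
  kernel_mean M w l (z * v) (z + v) = pole_mean M l z + pole_mean M l v +
    (z * v) ^+ l * (pole_mean M (M - l) z + pole_mean M (M - l) v).
Proof.
move=> wM zM vM /andP[l0 lM]; rewrite /kernel_mean /circle_weight.
rewrite -[l == 0%N]negbK -lt0n l0 /=.
under eq_bigr do rewrite mulrDl -mulrA; rewrite big_split /= -mulr_sumr.
have h1 : (M - l < M)%N by lia.
rewrite !(log_kernel_sum wM zM vM) // subn_eq0 leqNgt lM.
rewrite -[l == 0%N]negbK -lt0n l0 !subr0 mulrCA -mulrDr mulKf //.
by rewrite pnatr_eq0 -lt0n; lia.
Qed.

Lemma pole_mean_inv M a z : z != 0 -> z ^+ M != 1 -> (a <= M)%N ->
  pole_mean M a z = - pole_mean M (M - a) z^-1.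
Proof.
move=> z0 zM aM; rewrite /pole_mean exprVn.
have -> : z ^- (M - a) = z ^+ a / z ^+ M.
  by rewrite -{2}(subnK aM) exprD; field; rewrite !expf_neq0.
by rewrite exprVn; field; rewrite expf_neq0 // subr_eq0 zM subr_eq0 eq_sym zM.
Qed.

Lemma pole_mean_sub M a z : z ^+ M != 1 ->
  pole_mean M a z - z ^+ a = pole_mean M (M + a) z.
Proof.
move=> zM; have z1 : 1 - z ^+ M != 0 by rewrite subr_eq0 eq_sym.
by rewrite /pole_mean exprD; field.
Qed.

(** The power sum [z^l + w^l] as a polynomial in [s = z + w] and [p = z w]. *)
Fixpoint lucas l s p : C :=
  match l with
  | 0 => 2
  | 1 => s
  | (l'.+1 as l1).+1 => s * lucas l1 s p - p * lucas l' s p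
  end.

Lemma lucasE l z v : lucas l (z + v) (z * v) = z ^+ l + v ^+ l.
Proof.
suff [] : lucas l (z + v) (z * v) = z ^+ l + v ^+ l /\
  lucas l.+1 (z + v) (z * v) = z ^+ l.+1 + v ^+ l.+1 by [].
elim: l => [|l [IH1 IH2]]; first by rewrite !expr0 !expr1.
split=> //; have -> : lucas l.+2 (z + v) (z * v) =
  (z + v) * lucas l.+1 (z + v) (z * v) - z * v * lucas l (z + v) (z * v) by [].
by rewrite IH1 IH2 !exprSr; ring.
Qed.

Definition lucas_count l s p : C := if l == 0%N then 1 else lucas l s p.

(** The exponents on the right are [M + l] and [M - l], so the error decays with [M] when both
    points are inside the disk. *)
Lemma kernel_mean_sub M w l z v : M.-primitive_root w -> z ^+ M != 1 ->
  v ^+ M != 1 -> (l < M)%N ->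
  kernel_mean M w l (z * v) (z + v) - lucas_count l (z + v) (z * v) =
  pole_mean M (M + l) z + pole_mean M (M + l) v + (l != 0%N)%:R * (z * v) ^+ l *
    (pole_mean M (M - l) z + pole_mean M (M - l) v).
Proof.
move=> wM zM vM lM; have M0 : (0 < M)%N by apply: leq_ltn_trans lM.
rewrite -!pole_mean_sub // /lucas_count; case: posnP => [l0|l0] /=.
  by rewrite l0 kernel_mean0 // !expr0; ring.
rewrite kernel_meanS ?l0 // lucasE mul1r.
by move: (pole_mean M l z) (pole_mean M l v) ((z * v) ^+ l) => *; ring.
Qed.

(* For [|z| > 1 > |v|] all the terms are small since they only involve [z^-1]
   and [v]: the contributions [v ^+ l] and [(z * v) ^+ l * z ^- l] cancel. *)
Lemma kernel_mean_inv M w l z v : M.-primitive_root w -> z != 0 -> z ^+ M != 1 ->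
  v ^+ M != 1 -> (l < M)%N ->
  kernel_mean M w l (z * v) (z + v) =
  - pole_mean M (M - l) z^-1 + pole_mean M (M + l) v + (l != 0%N)%:R * (z * v) ^+ l *
    (- pole_mean M (M + l) z^-1 + pole_mean M (M - l) v).
Proof.
move=> wM z0 zM vM lM; have M0 : (0 < M)%N by apply: leq_ltn_trans lM.
have uM : z^-1 ^+ M != 1 by rewrite exprVn invr_eq1.
rewrite -!pole_mean_sub //; case: posnP => [l0|l0] /=.
  rewrite l0 kernel_mean0 // (pole_mean_inv z0 zM) // subn0 expr0.
  by move: (pole_mean M M _) (pole_mean M 0 _) => *; ring.
rewrite kernel_meanS ?l0 // (pole_mean_inv z0 zM (ltnW lM)).
rewrite (pole_mean_inv z0 zM (leq_subr l M)) subKn ?(ltnW lM) // mul1r.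
rewrite exprVn exprMn.
move: (pole_mean M l _) (pole_mean M l _) (pole_mean M (M - l) _) (pole_mean M (M - l) _).
by move=> *; field; rewrite expf_neq0.
Qed.

End CircleKernel.

(** * Uniform distance of the roots from the circle *)

Section RootGap.
Variable R : realType.
Local Notation C := R[i].
Implicit Types (f : {poly {poly C}}) (z v w s p : C) (r rho : R).

Lemma pole_mean_le M a m z rho : modulus z <= rho -> 0 <= rho < 1 ->
  (m <= a)%N -> (0 < M)%N ->
  modulus (pole_mean M a z) <= rho ^+ m / (1 - rho ^+ M).
Proof.
move=> zr /andP[r0 r1] ma M0.
have rM : 0 < 1 - rho ^+ M by rewrite subr_gt0 exprn_ilt1 // -lt0n.
have zM : modulus z ^+ M <= rho ^+ M by rewrite lerXn2r ?nnegrE ?modulus_ge0.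
have den : 1 - rho ^+ M <= modulus (1 - z ^+ M).
  rewrite (le_trans _ (modulusB_ge _ _)) // modulus1 modulusX.
  by rewrite lerD2l lerN2.
rewrite /pole_mean modulusM modulusV ler_pM ?invr_ge0 ?modulus_ge0 //.
  rewrite modulusX (le_trans (y := rho ^+ a)) //.
    by rewrite lerXn2r ?nnegrE ?modulus_ge0.
  by rewrite ler_wiXn2l ?(ltW r1).
by rewrite lef_pV2 // posrE // (lt_le_trans rM).
Qed.

Lemma modulus_lt1_exp_neq1 M z : modulus z < 1 -> (0 < M)%N -> z ^+ M != 1.
Proof.
move=> z1 M0; apply/eqP => /(congr1 (@modulus R)); rewrite modulusX modulus1.
by apply/eqP; rewrite lt_eqF // exprn_ilt1 ?modulus_ge0 // -lt0n.
Qed.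

Lemma modulus_gt1_exp_neq1 M z : 1 < modulus z -> (0 < M)%N -> z ^+ M != 1.
Proof.
move=> z1 M0; apply/eqP => /(congr1 (@modulus R)); rewrite modulusX modulus1.
by apply/eqP; rewrite gt_eqF // exprn_egt1 // -lt0n.
Qed.

Lemma four_terms_le (x1 x2 x3 x4 q : C) (e : R) : modulus q <= 1 ->
  modulus x1 <= e -> modulus x2 <= e -> modulus x3 <= e -> modulus x4 <= e ->
  modulus (x1 + x2 + q * (x3 + x4)) <= 4 * e.
Proof.
move=> q1 h1 h2 h3 h4.
have h34 : modulus (q * (x3 + x4)) <= e + e.
  rewrite modulusM (le_trans (ler_piMl (modulus_ge0 _) q1)) //.
  by rewrite (le_trans (modulusD _ _)) ?lerD.
rewrite (le_trans (modulusD _ _)) // (le_trans (lerD (modulusD _ _) h34)) //.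
lra.
Qed.

Lemma modulus_bool_le1 (b : bool) z : modulus z <= 1 -> modulus (b%:R * z) <= 1.
Proof. by case: b => [|_]; rewrite ?mul1r ?mul0r // modulus0 ler01. Qed.

Lemma kernel_mean_inside M w l z v rho : M.-primitive_root w -> (l < M)%N ->
  0 <= rho < 1 -> modulus z <= rho -> modulus v <= rho ->
  modulus (kernel_mean M w l (z * v) (z + v) - lucas_count l (z + v) (z * v)) <=
  4 * (rho ^+ (M - l) / (1 - rho ^+ M)).
Proof.
move=> wM lM r01 zr vr; have /andP[r0 r1] := r01; have M0 : (0 < M)%N by lia.
have zM := modulus_lt1_exp_neq1 (le_lt_trans zr r1) M0.
have vM := modulus_lt1_exp_neq1 (le_lt_trans vr r1) M0.
have mM : (M - l <= M + l)%N by rewrite (leq_trans (leq_subr l M)) ?leq_addr.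
rewrite kernel_mean_sub //; apply: four_terms_le; try exact: pole_mean_le.
apply: modulus_bool_le1; rewrite modulusX exprn_ile1 ?modulus_ge0 //.
rewrite modulusM mulr_ile1 ?modulus_ge0 //; first exact: le_trans zr (ltW r1).
exact: le_trans vr (ltW r1).
Qed.

Lemma kernel_mean_outside M w l z v rho : M.-primitive_root w -> (l < M)%N ->
  0 <= rho < 1 -> 1 < modulus z -> modulus z^-1 <= rho -> modulus v <= rho ->
  modulus (z * v) <= 1 ->
  modulus (kernel_mean M w l (z * v) (z + v)) <=
  4 * (rho ^+ (M - l) / (1 - rho ^+ M)).
Proof.
move=> wM lM r01 z1 ur vr zv1; have /andP[r0 r1] := r01.
have M0 : (0 < M)%N by lia.
have z0 : z != 0 by rewrite -modulus_gt0 (lt_trans ltr01).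
have zM := modulus_gt1_exp_neq1 z1 M0.
have uM := modulus_lt1_exp_neq1 (le_lt_trans ur r1) M0.
have vM := modulus_lt1_exp_neq1 (le_lt_trans vr r1) M0.
have mM : (M - l <= M + l)%N by rewrite (leq_trans (leq_subr l M)) ?leq_addr.
rewrite kernel_mean_inv //; apply: four_terms_le.
- by apply: modulus_bool_le1; rewrite modulusX exprn_ile1 ?modulus_ge0.
- by rewrite modulusN; apply: pole_mean_le.
- exact: pole_mean_le.
- by rewrite modulusN; apply: pole_mean_le.
- exact: pole_mean_le.
Qed.

Lemma hornerXY_bounded f (B : R) : exists2 L : R, 0 < L &
  forall s p, modulus s <= B -> modulus p <= B -> modulus f.[s, p] <= L.
Proof.
elim/poly_ind: f => [|f c [L L0 fL]].
  by exists 1 => // s p _ _; rewrite !horner0 modulus0.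
have [K K0 cK] := poly_bounded c B.
exists (L * (`|B| + 1) + K); first by rewrite addr_gt0 // mulr_gt0 ?ltr_wpDl.
move=> s p sB pB; rewrite hornerMXaddC hornerD hornerM hornerC.
rewrite (le_trans (modulusD _ _)) //.
rewrite lerD ?cK // modulusM ler_pM ?modulus_ge0 ?fL //.
by rewrite (le_trans sB) // (le_trans (ler_norm B)) // lerDl.
Qed.

Lemma hornerXY_lipschitz f (B : R) : exists2 L : R, 0 < L &
  forall s s' p, modulus s <= B -> modulus s' <= B -> modulus p <= B ->
  modulus (f.[s, p] - f.[s', p]) <= L * modulus (s - s').
Proof.
elim/poly_ind: f => [|f c [L L0 fL]].
  exists 1 => // s s' p _ _ _; rewrite !horner0 subrr modulus0.
  by rewrite mul1r modulus_ge0.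
have [K K0 fK] := hornerXY_bounded f B.
exists (L * (`|B| + 1) + K); first by rewrite addr_gt0 // mulr_gt0 ?ltr_wpDl.
move=> s s' p sB sB' pB; rewrite !hornerMXaddC !hornerD !hornerM !hornerC.
have -> : f.[s, p] * s + c.[p] - (f.[s', p] * s' + c.[p]) =
  (f.[s, p] - f.[s', p]) * s + f.[s', p] * (s - s') by ring.
rewrite (le_trans (modulusD _ _)) // [leRHS]mulrDl !modulusM lerD //; last first.
  by rewrite ler_wpM2r ?modulus_ge0 ?fK.
rewrite mulrAC ler_pM ?modulus_ge0 ?fL //.
by rewrite (le_trans sB) // (le_trans (ler_norm B)) // lerDl.
Qed.

Lemma size_horner_poly_bound f : exists N, forall q : {poly C}, (size q <= 2)%N ->
  (size f.[q] <= N)%N.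
Proof.
elim/poly_ind: f => [|f c [N fN]]; first by exists 0%N => q _; rewrite horner0 size_poly0.
exists (maxn N.+1 (size c)) => q sq; rewrite hornerMXaddC.
rewrite (leq_trans (size_polyD _ _)) // geq_max !leq_max leqnn orbT andbT.
apply/orP; left; rewrite (leq_trans (size_polyMleq _ _)) //.
by have := fN q sq; lia.
Qed.

(* The Harnack inequality for a polynomial without zeros in the unit disk. *)
Lemma zero_free_lower_bound (q : {poly C}) N r : (size q <= N.+1)%N -> 0 <= r < 1 ->
  (forall p, modulus p < 1 -> q.[p] != 0) ->
  forall p, modulus p <= r -> modulus q.[0] * (1 - r) ^+ N <= modulus q.[p].
Proof.
move=> sq /andP[r0 r1] q0 p pr.
have qn0 : q != 0.
  by apply/eqP => qz; move: (q0 0); rewrite qz horner0 modulus0 ltr01 eqxx => /(_ isT).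
have [s qE] := closed_field_poly_normal q.
have sb b : b \in s -> 1 <= modulus b.
  move=> bs; rewrite leNgt; apply/negP => /q0 /eqP; apply.
  by apply/rootP; rewrite qE rootZ ?root_prod_XsubC // lead_coef_eq0.
have ss : (size s <= N)%N.
  by move: sq; rewrite qE size_scale ?lead_coef_eq0 // size_prod_XsubC ltnS.
have r01 : 0 <= 1 - r <= 1 by lra.
have /andP[r2 r3] := r01.
apply: (le_trans (y := modulus q.[0] * (1 - r) ^+ size s)).
  by rewrite ler_wpM2l ?modulus_ge0 // ler_wiXn2l.
rewrite qE !hornerZ !modulusM -mulrA ler_wpM2l ?modulus_ge0 // !horner_prod.
elim: s sb {qE ss} => [|b s IHs] sb; first by rewrite !big_nil expr0 mulr1.
rewrite !big_cons /= exprS !modulusM !hornerXsubC.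
have -> : modulus (0 - b) * modulus (\prod_(z <- s) ('X - z%:P).[0]) *
    ((1 - r) * (1 - r) ^+ size s) =
  (modulus b * (1 - r)) * (modulus (\prod_(z <- s) ('X - z%:P).[0]) * (1 - r) ^+ size s).
  by rewrite sub0r modulusN; ring.
have b1 := sb b (mem_head _ _).
apply: ler_pM.
- by rewrite mulr_ge0 ?modulus_ge0.
- by rewrite mulr_ge0 ?modulus_ge0 ?exprn_ge0.
- rewrite modulusBC (le_trans _ (modulusB_ge _ _)) // mulrBr mulr1 lerD2l lerN2.
  by rewrite (le_trans pr) // ler_peMl.
by apply: IHs => c cs; apply: sb; rewrite inE cs orbT.
Qed.

Definition circle_line (w : C) : {poly C} := w%:P + w^-1 *: 'X.

Lemma circle_line_horner w p : (circle_line w).[p] = w + p / w.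
Proof. by rewrite !hornerE mulrC. Qed.

Lemma size_circle_line w : (size (circle_line w) <= 2)%N.
Proof.
rewrite (leq_trans (size_polyD _ _)) // geq_max size_polyC.
rewrite (leq_trans (size_scale_leq _ _)) ?size_polyX //.
by case: (w != 0).
Qed.

Lemma horner_circle_line f w p : f.[circle_line w].[p] = f.[w + p / w, p].
Proof.
rewrite hornerXY_fibre -circle_line_horner.
by have := horner_map (horner_eval p) f (circle_line w); rewrite /= /horner_eval => ->.
Qed.

Section Gap.
Variable f : {poly {poly C}}.
Hypothesis torus : forall z v, f.[z + v, z * v] = 0 ->
  modulus z = 1 -> modulus v <= 1 -> modulus v = 1.

Lemma circle_line_neq0 w p : modulus w = 1 -> modulus p < 1 ->
  f.[w + p / w, p] != 0.
Proof.
move=> w1 p1; have w0 : w != 0 by rewrite -modulus_gt0 w1.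
apply/eqP => fw; have v1 : modulus (p / w) = modulus p.
  by rewrite modulusM modulusV w1 invr1 mulr1.
have := torus (z := w) (v := p / w); rewrite mulrCA divff // mulr1 => /(_ fw w1).
by rewrite v1 => /(_ (ltW p1)) pe; rewrite pe ltxx in p1.
Qed.

Lemma fibre_neq0 p : modulus p < 1 -> fibre p f != 0.
Proof.
move=> p1; apply/eqP => f0; have := circle_line_neq0 (modulus1 R) p1.
by rewrite hornerXY_fibre f0 horner0 eqxx.
Qed.

(** Uniformity in [w] comes without compactness. Along the line of [w] the Harnack bound reduces to
    [p = 0], where [f(w, 0)] is bounded below through the distances of the roots of a single
    polynomial to the circle. *)
Lemma circle_line_lower_bound r : 0 <= r < 1 -> exists2 c : R, 0 < c &
  forall w p, modulus w = 1 -> modulus p <= r -> c <= modulus f.[w + p / w, p].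
Proof.
move=> r01; have [N fN] := size_horner_poly_bound f.
have m0 : modulus (0 : C) < 1 by rewrite modulus0.
have [s fE] := closed_field_poly_normal (fibre 0 f).
have f0 := fibre_neq0 m0.
pose c0 := modulus (lead_coef (fibre 0 f)) * \prod_(b <- s) `|1 - modulus b|.
have c00 : 0 < c0.
  rewrite mulr_gt0 ?modulus_gt0 ?lead_coef_eq0 // big_seq prodr_gt0 // => b bs.
  rewrite normr_gt0 subr_eq0; apply/eqP => b1.
  have := circle_line_neq0 (esym b1) m0; rewrite mul0r addr0 hornerXY_fibre.
  by rewrite (rootP _) ?eqxx // fE rootZ ?root_prod_XsubC // lead_coef_eq0.
have /andP[r0 r1] := r01.
exists (c0 * (1 - r) ^+ N); first by rewrite mulr_gt0 // exprn_gt0 // subr_gt0.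
move=> w p w1 pr; rewrite -horner_circle_line.
apply: (le_trans (y := modulus f.[circle_line w].[0] * (1 - r) ^+ N)).
  rewrite ler_wpM2r ?exprn_ge0 ?subr_ge0 ?(ltW r1) //.
  rewrite horner_circle_line mul0r addr0 hornerXY_fibre fE hornerZ modulusM.
  rewrite ler_wpM2l ?modulus_ge0 // horner_prod modulus_prod.
  apply: ler_prod => b _; rewrite normr_ge0 hornerXsubC /=.
  rewrite ler_norml -w1 modulusB_ge andbT lerNl opprB modulusBC.
  exact: modulusB_ge.
apply: zero_free_lower_bound => //.
  by rewrite leqW // fN // size_circle_line.
by move=> x x1; rewrite horner_circle_line circle_line_neq0.
Qed.

(** If [|z|] were close to [1], moving [z] radially to [w] on the circle with [p] fixed would barely
    change [s], hence [f], against the lower bound at [(w + p / w, p)]. *)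
Lemma root_gap r : 0 <= r < 1 -> exists2 rho : R, 0 < rho < 1 &
  forall z v, f.[z + v, z * v] = 0 -> modulus (z * v) <= r ->
  modulus z <= rho \/ 1 < modulus z /\ modulus z^-1 <= rho.
Proof.
move=> r01; have [c c0 fc] := circle_line_lower_bound r01.
have [L L0 fL] := hornerXY_lipschitz f 4.
have /andP[r0 r1] := r01.
(* [d <= 1 / 2] gives [|v| <= 2], so [s] moves by at most [(|v| + 1) d <= 3 d], and [f] by at most
   [3 L d < c]. *)
pose d := Num.min (1 / 2) (c / (4 * L)).
have d0 : 0 < d by rewrite lt_min !divr_gt0 ?mulr_gt0.
have d2 : d <= 1 / 2 by rewrite ge_min lexx.
have dL : L * (3 * d) < c.
  have : d <= c / (4 * L) by rewrite ge_min lexx orbT.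
  rewrite ler_pdivlMr ?mulr_gt0 // => h.
  have : 0 < d * L by rewrite mulr_gt0.
  nra.
have d1 : 0 < 1 + d by lra.
exists (1 + d)^-1; first by rewrite invr_gt0 d1 /= invf_lt1 // ltrDl.
move=> z v fz zvr.
have [zd|zd] := leP (modulus z) (1 - d).
  left; rewrite (le_trans zd) // -div1r ler_pdivlMr //; nra.
have [dz|dz] := leP (1 + d) (modulus z).
  right; split; first by rewrite (lt_le_trans _ dz) // ltrDl.
  by rewrite modulusV lef_pV2 ?posrE // (lt_le_trans d1).
exfalso.
have mz : 0 < modulus z by lra.
have z0 : z != 0 by rewrite -modulus_gt0.
pose m : C := ((modulus z)%:C)%C.
have mm : modulus m = modulus z by rewrite modulus_realc gtr0_norm.
have m0 : m != 0 by rewrite -modulus_gt0 mm.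
pose w := z / m.
have w1 : modulus w = 1 by rewrite modulusM modulusV mm divff // gt_eqF.
have w0 : w != 0 by rewrite mulf_neq0 // invr_neq0.
have pw : z * v / w = v * m by rewrite /w; field; rewrite z0 m0.
have v2 : modulus v <= 2.
  have : modulus z * modulus v <= r by rewrite -modulusM.
  have := modulus_ge0 v; nra.
have m1 : modulus (1 - m) <= d.
  have -> : 1 - m = ((1 - modulus z)%:C)%C by rewrite rmorphB rmorph1.
  by rewrite modulus_realc ler_norml; lra.
have := fc _ _ w1 zvr; rewrite leNgt => /negP; apply.
have -> : modulus f.[w + z * v / w, z * v] =
    modulus (f.[z + v, z * v] - f.[w + z * v / w, z * v]).
  by rewrite fz sub0r modulusN.
apply: le_lt_trans dL; rewrite (le_trans (fL _ _ _ _ _ _)) //.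
- by rewrite (le_trans (modulusD _ _)) //; lra.
- rewrite pw (le_trans (modulusD _ _)) // w1 modulusM mm.
  have := modulus_ge0 v; nra.
- by rewrite (le_trans zvr) //; lra.
rewrite ler_pM2l // pw.
have -> : z + v - (w + v * m) = v * (1 - m) - w * (1 - m).
  by rewrite /w; field.
rewrite (le_trans (modulusB _ _)) // [modulus (v * _)]modulusM.
rewrite [modulus (w * _)]modulusM w1 mul1r.
have := modulus_ge0 (1 - m); have := modulus_ge0 v; nra.
Qed.

End Gap.

End RootGap.

Section RootSums.
Variable C : numClosedFieldType.
Implicit Types (rs : seq C).

Lemma prod_XsubC_log_deriv rs (x : C) : x \notin rs ->
  (\prod_(s <- rs) ('X - s%:P))^`().[x] =
  (\prod_(s <- rs) ('X - s%:P)).[x] * \sum_(s <- rs) (x - s)^-1.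
Proof.
elim: rs => [|s rs IHs]; first by rewrite !big_nil derivC horner0 mulr0.
rewrite inE negb_or => /andP[xs /IHs e]; have xs0 : x - s != 0 by rewrite subr_eq0.
rewrite !big_cons derivM derivXsubC mul1r hornerD !hornerM e !hornerXsubC.
by move: (\sum_(j <- rs) _) => S; field.
Qed.

(** Newton's identities in one formula. With [q] the product, the case [j > 0] is the coefficient
    [j - 1] of [q' = sum_s (q - q(s)) / (X - s)], and [j = 0] sums [q(s) = 0] over the roots. *)
Lemma prod_XsubC_newton rs n j : (size rs < n)%N ->
  \sum_(i < n) (\prod_(s <- rs) ('X - s%:P))`_(i + j) * (\sum_(s <- rs) s ^+ i) =
  j%:R * (\prod_(s <- rs) ('X - s%:P))`_j.
Proof.
elim: rs j => [|s rs IHs] j sn.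
  rewrite !big_nil big1 => [|i _]; last by rewrite big_nil mulr0.
  by rewrite coef1; case: j => [|j]; rewrite ?mul0r ?mulr0.
have {}IHs := IHs ^~ (ltnW sn).
case: j => [|j].
  rewrite mul0r; set q := \prod_(x <- _) _.
  transitivity (\sum_(i < n) \sum_(x <- s :: rs) q`_i * x ^+ i).
    by apply: eq_bigr => i _; rewrite addn0 mulr_sumr.
  rewrite exchange_big /= big_seq big1 // => x xrs.
  rewrite /q -horner_coef_wide; last by rewrite size_prod_XsubC.
  by apply/eqP; rewrite -/(root _ x) root_prod_XsubC.
rewrite big_cons; set q := \prod_(x <- rs) ('X - x%:P) in IHs *.
have coefq i : (('X - s%:P) * q)`_i.+1 = q`_i - s * q`_i.+1.
  by rewrite mulrBl coefB coefXM coefCM.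
have tele : \sum_(i < n) (q`_(i + j) - s * q`_(i + j).+1) * s ^+ i = q`_j.
  pose a i := q`_(i + j) * s ^+ i.
  have aE i : (q`_(i + j) - s * q`_(i + j).+1) * s ^+ i = - (a i.+1 - a i).
    by rewrite /a addSn exprS; ring.
  under eq_bigr do rewrite aE.
  rewrite sumrN -(big_mkord xpredT (fun i => a i.+1 - a i)) telescope_sumr //.
  rewrite /a add0n expr0 mulr1 nth_default ?mul0r ?sub0r ?opprK //.
  by rewrite size_prod_XsubC; move: sn => /=; lia.
under eq_bigr do rewrite addnS coefq big_cons mulrDr.
rewrite big_split /= tele coefq.
under eq_bigr do rewrite mulrBl -mulrA.
rewrite sumrB -mulr_sumr IHs.
have := IHs j.+1; under eq_bigr do rewrite addnS; move=> ->.
by rewrite -natr1; ring.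
Qed.

End RootSums.

Section BidiskRoots.
Variable R : realType.
Local Notation C := R[i].
Variable f : {poly {poly C}}.
Hypothesis torus : forall z v, f.[z + v, z * v] = 0 ->
  modulus z = 1 -> modulus v <= 1 -> modulus v = 1.
Implicit Types (z v w s p : C) (r rho : R).

Definition fibre_roots p : seq C := sval (closed_field_poly_normal (fibre p f)).

Lemma fibre_rootsE p : fibre p f =
  lead_coef (fibre p f) *: \prod_(s <- fibre_roots p) ('X - s%:P).
Proof. by rewrite /fibre_roots; case: closed_field_poly_normal. Qed.

Definition bidisk_roots p : seq C :=
  [seq s <- fibre_roots p | `[< sym_bidisk C (s, p) >]].

Lemma mem_fibre_roots p s : modulus p < 1 ->
  (s \in fibre_roots p) = (f.[s, p] == 0).
Proof.
move=> p1; rewrite hornerXY_fibre -/(root _ s) [in RHS]fibre_rootsE.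
by rewrite rootZ ?root_prod_XsubC // lead_coef_eq0 (fibre_neq0 torus).
Qed.

Lemma size_fibre_roots p : modulus p < 1 -> (size (fibre_roots p) <= size f)%N.
Proof.
move=> p1; have : (size (fibre p f) <= size f)%N by rewrite /fibre /map_poly size_poly.
rewrite {1}fibre_rootsE size_scale ?lead_coef_eq0 ?(fibre_neq0 torus) //.
by rewrite size_prod_XsubC => /ltnW.
Qed.

(* The mean over the [M]-th roots of unity [u] of [u^l + (p / u)^l] (of [1] for
   [l = 0]) times [u d/du log f(u + p / u, p)]; it is rational in [p] and tends to
   [lucas_sum l p] as [M] grows. *)
Definition log_mean M w l p : C := M%:R^-1 *
  \sum_(k < M) circle_weight M l p (w ^+ k) * ((w ^+ k - p / w ^+ k) *
    (f^`().[w ^+ k + p / w ^+ k, p] / f.[w ^+ k + p / w ^+ k, p])).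

Lemma fibre_deriv p : fibre p f^`() = (fibre p f)^`().
Proof. by rewrite /fibre deriv_map. Qed.

Lemma log_meanE M w l p : M.-primitive_root w -> modulus p < 1 ->
  log_mean M w l p = \sum_(s <- fibre_roots p) kernel_mean M w l p s.
Proof.
move=> wM p1; rewrite /log_mean /kernel_mean -mulr_sumr; congr (_ * _).
rewrite exchange_big /=; apply: eq_bigr => k _; rewrite -mulr_sumr; congr (_ * _).
rewrite /log_kernel -mulr_sumr; congr (_ * _).
have w1 : modulus (w ^+ k) = 1.
  by apply/norm_eq1; rewrite normrX (prim_root_norm wM) expr1n.
have := circle_line_neq0 torus w1 p1; set x := w ^+ k + _ => fx.
have xs : x \notin fibre_roots p by rewrite mem_fibre_roots.
rewrite !hornerXY_fibre fibre_deriv fibre_rootsE derivZ !hornerZ.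
rewrite (prod_XsubC_log_deriv xs).
have := fx; rewrite hornerXY_fibre {1}fibre_rootsE hornerZ mulf_eq0 negb_or.
move: (lead_coef _) => a; move: ((\prod_(s <- _) _).[x]) => b.
move: (\sum_(s <- _) _) => c /andP[a0 b0].
by field; rewrite a0 b0.
Qed.

(** As a function of [p], each denominator is [f] on a [circle_line], without zeros in the unit
    disk. *)
Lemma log_mean_approx M w l r : M.-primitive_root w -> 0 <= r < 1 ->
  disk_approx r (log_mean M w l).
Proof.
move=> wM /andP[r0 r1]; apply: disk_approxM; first exact: disk_approx_cst.
apply: disk_approx_sum => k.
have w1 : modulus (w ^+ k) = 1.
  by apply/norm_eq1; rewrite normrX (prim_root_norm wM) expr1n.
have w0 : w ^+ k != 0 by rewrite -modulus_gt0 w1.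
apply: disk_approxM.
  rewrite /circle_weight; case: (l == 0%N); first exact: disk_approx_cst.
  pose q : {poly C} := ((w ^+ k) ^+ l)%:P + (w ^+ k) ^+ (M - l) *: 'X^l.
  apply: disk_approx_eq (disk_approx_horner r q) => p _.
  by rewrite /q hornerD hornerC hornerZ hornerXn [_ * p ^+ l]mulrC.
apply: disk_approxM.
  apply: disk_approx_eq (disk_approx_horner r ((w ^+ k)%:P - (w ^+ k)^-1 *: 'X)) => p _.
  by rewrite !hornerE mulrC.
apply: disk_approxM.
  apply: disk_approx_eq (disk_approx_horner r f^`().[circle_line (w ^+ k)]) => p _.
  exact: horner_circle_line.
have lineN0 p : modulus p < 1 -> f.[circle_line (w ^+ k)].[p] != 0.
  by move=> p1; rewrite horner_circle_line circle_line_neq0.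
apply: disk_approx_eq (disk_approx_invpoly r0 r1 lineN0) => p _.
by rewrite horner_circle_line.
Qed.

Definition lucas_sum l p : C := \sum_(s <- bidisk_roots p) lucas_count l s p.

(** By the gap each of the two parameters is well inside or well outside the circle, and a product
    of modulus below [1] excludes both being outside. With both inside the mean approximates the
    power sum; with one outside it is small. *)
Lemma kernel_mean_root M w l p s r rho : M.-primitive_root w -> (l < M)%N ->
  0 < rho < 1 -> r < 1 ->
  (forall z v, f.[z + v, z * v] = 0 -> modulus (z * v) <= r ->
     modulus z <= rho \/ 1 < modulus z /\ modulus z^-1 <= rho) ->
  modulus p <= r -> f.[s, p] = 0 ->
  modulus ((if `[< sym_bidisk C (s, p) >] then lucas_count l s p else 0) -
    kernel_mean M w l p s) <= 4 * (rho ^+ (M - l) / (1 - rho ^+ M)).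
Proof.
move=> wM lM /andP[rho0 rho1] r1 gap pr fs.
have rho01 : 0 <= rho < 1 by rewrite ltW.
have [[z v] zvE] := symmetrizationP s p.
move: (zvE); rewrite /symmetrization /= => -[sE pE].
have zv1 : modulus (z * v) <= 1 by rewrite pE (le_trans pr) // ltW.
have fz : f.[z + v, z * v] = 0 by rewrite sE pE.
have fv : f.[v + z, v * z] = 0 by rewrite addrC mulrC.
have bidiskP : sym_bidisk C (s, p) <-> modulus z < 1 /\ modulus v < 1.
  by rewrite -zvE; exact: sym_bidisk_mem.
have zvr : modulus (z * v) <= r by rewrite pE.
have vzr : modulus (v * z) <= r by rewrite mulrC.
have [zi|[z1 zo]] := gap z v fz zvr.
  have [vi|[v1 vo]] := gap v z fv vzr.
    rewrite asboolT; last by apply/bidiskP; rewrite !(le_lt_trans _ rho1).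
    by rewrite modulusBC -sE -pE; exact: kernel_mean_inside.
  rewrite asboolF; last by move=> /bidiskP[_]; rewrite ltNge ltW.
  rewrite sub0r modulusN -sE -pE addrC mulrC.
  by apply: kernel_mean_outside => //; rewrite mulrC.
have [vi|[v1 vo]] := gap v z fv vzr.
  rewrite asboolF; last by move=> /bidiskP[]; rewrite ltNge ltW.
  by rewrite sub0r modulusN -sE -pE; apply: kernel_mean_outside.
by move: zv1; rewrite leNgt modulusM mulr_egt1.
Qed.

Lemma lucas_sum_approx l r : 0 <= r < 1 -> disk_approx r (lucas_sum l).
Proof.
move=> r01; have /andP[r0 r1] := r01; apply: disk_approx_lim => eps e0.
have [rho rho01 gap] := root_gap torus r01; have /andP[rho0 rho1] := rho01.
have rho1' : 0 < 1 - rho by rewrite subr_gt0.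
(* There are at most [size f] roots, each with error at most [4 rho^(M - l) / (1 - rho)]. *)
pose K : R := 4 * (size f).+1%:R / (1 - rho).
have K0 : 0 < K by rewrite divr_gt0 // mulr_gt0.
have rho01' : 0 <= rho < 1 by rewrite ltW.
have [n hn] := expr_small rho01' (divr_gt0 e0 K0).
pose M := (n + l).+1; have lM : (l < M)%N by rewrite ltnS leq_addl.
have [w wM] := prim_root_exists C (ltn0Sn (n + l)).
exists (log_mean M w l); first exact: log_mean_approx.
move=> p pr; have p1 : modulus p < 1 := le_lt_trans pr r1.
rewrite (log_meanE _ wM) // /lucas_sum /bidisk_roots big_filter big_mkcond /=.
rewrite -sumrB (le_lt_trans (modulus_sum _ _ _)) //.
pose e := rho ^+ (M - l) / (1 - rho ^+ M).
apply: (le_lt_trans (y := \sum_(s <- fibre_roots p) 4 * e)).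
  rewrite big_seq [leRHS]big_seq; apply: ler_sum => s.
  rewrite mem_fibre_roots // => /eqP fs.
  exact: (kernel_mean_root wM lM rho01 r1 gap pr fs).
have nM : (n <= M - l)%N by rewrite /M subSn ?leq_addl // addnK leqnSn.
have hM : rho ^+ (M - l) < eps / K := hn _ nM.
have eK : e <= rho ^+ (M - l) / (1 - rho).
  rewrite /e ler_wpM2l ?exprn_ge0 ?(ltW rho0) // lef_pV2 ?posrE //.
    rewrite lerD2l lerN2 -[leRHS]expr1 ler_wiXn2l ?(ltW rho0) ?(ltW rho1) //.
  by rewrite subr_gt0 exprn_ilt1 ?(ltW rho0) // rho1.
have e00 : 0 <= rho ^+ (M - l) / (1 - rho).
  by rewrite divr_ge0 ?exprn_ge0 // ltW.
rewrite big_const_seq count_predT iter_addr_0 -[_ *+ size _]mulr_natr.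
apply: (le_lt_trans (y := 4 * (rho ^+ (M - l) / (1 - rho)) * (size f).+1%:R)).
  apply: ler_pM => //.
  - rewrite mulr_ge0 // divr_ge0 ?exprn_ge0 ?(ltW rho0) // subr_ge0.
    by rewrite exprn_ile1 // ltW.
  - by rewrite ler_pM2l.
  - by rewrite ler_nat leqW // size_fibre_roots.
have -> : 4 * (rho ^+ (M - l) / (1 - rho)) * (size f).+1%:R = rho ^+ (M - l) * K.
  by rewrite /K; ring.
by rewrite -ltr_pdivlMr.
Qed.

(** For [l > 0] the difference is [z^l (1 - |v|^(2 l)) + v^l (1 - |z|^(2 l))], and each term is at
    most [1 - |z v|^(2 l)]. *)
Lemma lucas_count_reflect l s p : sym_bidisk C (s, p) ->
  modulus (lucas_count l s p - p ^+ l * (lucas_count l s p)^*) <=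
  2 * (1 - modulus p ^+ (2 * l)).
Proof.
have [[z v] zvE] := symmetrizationP s p; rewrite -{1}zvE => /sym_bidisk_mem /= [z1 v1].
move: zvE; rewrite /symmetrization /= => -[<- <-].
rewrite /lucas_count; case: eqP => [->|_].
  by rewrite expr0 mul1r rmorph1 muln0 expr0 !subrr modulus0 mulr0.
rewrite lucasE rmorphD !rmorphXn /=.
have -> : z ^+ l + v ^+ l - (z * v) ^+ l * (z^* ^+ l + v^* ^+ l) =
    z ^+ l * (1 - (v * v^*) ^+ l) + v ^+ l * (1 - (z * z^*) ^+ l).
  by rewrite !exprMn; ring.
have H x y : modulus x < 1 -> modulus y < 1 ->
    modulus (x ^+ l * (1 - (y * y^*) ^+ l)) <= 1 - modulus (x * y) ^+ (2 * l).
  move=> x1 y1; have x0 := modulus_ge0 x; have y0 := modulus_ge0 y.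
  have -> : 1 - (y * y^*) ^+ l = ((1 - modulus y ^+ (2 * l))%:C)%C.
    by rewrite mulJ_modulus -rmorphXn -exprM rmorphB rmorph1.
  rewrite [modulus (x ^+ l * _)]modulusM.
  have y2 : 0 <= 1 - modulus y ^+ (2 * l).
    by rewrite subr_ge0 exprn_ile1 // ltW.
  rewrite modulus_realc ger0_norm //.
  rewrite (le_trans (y := 1 - modulus y ^+ (2 * l))) //.
    by rewrite ler_piMl // modulusX exprn_ile1 // ltW.
  rewrite lerD2l lerN2 modulusM exprMn ler_piMl ?exprn_ge0 //.
  by rewrite exprn_ile1 // ltW.
rewrite (le_trans (modulusD _ _)) // mulr_natl mulr2n lerD ?H //.
by rewrite [z * v]mulrC H.
Qed.

Lemma lucas_sum_poly l : exists2 q : {poly C}, (size q <= l.+1)%N &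
  forall p, modulus p < 1 -> lucas_sum l p = q.[p].
Proof.
apply: (reflection_poly (D := 2 * (size f)%:R)); first by rewrite mulr_ge0.
  by move=> r /andP[r0 r1]; apply: lucas_sum_approx; rewrite ltW.
move=> p p1; rewrite /lucas_sum rmorph_sum mulr_sumr -sumrB.
rewrite (le_trans (modulus_sum _ _ _)) //.
have p2 : 0 <= 1 - modulus p ^+ (2 * l).
  by rewrite subr_ge0 exprn_ile1 ?modulus_ge0 // ltW.
apply: (le_trans (y := \sum_(s <- bidisk_roots p) 2 * (1 - modulus p ^+ (2 * l)))).
  rewrite big_seq [leRHS]big_seq; apply: ler_sum => s.
  by rewrite mem_filter => /andP[/asboolP sp _]; exact: lucas_count_reflect.
rewrite big_const_seq count_predT iter_addr_0 -[_ *+ size _]mulr_natr mulrAC.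
rewrite ler_wpM2r // ler_wpM2l // ler_nat.
rewrite (leq_trans _ (size_fibre_roots p1)) //.
by rewrite size_filter count_size.
Qed.

End BidiskRoots.

(** * The monic factor carrying the roots in the bidisk *)

Section DiskPolynomials.
Variable R : realType.
Local Notation C := R[i].
Implicit Types (F G : C -> C).

Definition disk_poly F := exists q : {poly C}, forall p, modulus p < 1 -> F p = q.[p].

Lemma disk_poly_eq F G : (forall p, modulus p < 1 -> F p = G p) ->
  disk_poly F -> disk_poly G.
Proof. by move=> FG [q Fq]; exists q => p p1; rewrite -FG ?Fq. Qed.

Lemma disk_poly_horner (q : {poly C}) : disk_poly (fun p => q.[p]).
Proof. by exists q. Qed.

Lemma disk_polyD F G : disk_poly F -> disk_poly G -> disk_poly (fun p => F p + G p).
Proof. by move=> [q Fq] [s Gs]; exists (q + s) => p p1; rewrite hornerD Fq ?Gs. Qed.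

Lemma disk_polyM F G : disk_poly F -> disk_poly G -> disk_poly (fun p => F p * G p).
Proof. by move=> [q Fq] [s Gs]; exists (q * s) => p p1; rewrite hornerM Fq ?Gs. Qed.

Lemma disk_poly_sum n (F : 'I_n -> C -> C) : (forall i, disk_poly (F i)) ->
  disk_poly (fun p => \sum_(i < n) F i p).
Proof.
elim: n F => [|n IHn] F HF.
  by exists 0 => p _; rewrite big_ord0 horner0.
have IH := IHn (fun i => F (widen_ord (leqnSn n) i)) (fun i => HF _).
by apply: disk_poly_eq (disk_polyD IH (HF ord_max)) => p _; rewrite big_ord_recr.
Qed.

Lemma disk_poly_cst c : disk_poly (fun=> c).
Proof. by exists c%:P => p _; rewrite hornerC. Qed.

Lemma disk_poly0 (q : {poly C}) : (forall p, modulus p < 1 -> q.[p] = 0) -> q = 0.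
Proof.
move=> q0; pose u (n : nat) : C := n.+2%:R^-1.
apply: (@poly_eq0_inj_seq C u) => [m n /invr_inj /eqP|n].
  by rewrite eqr_nat => /eqP[].
apply: q0; rewrite /u modulusV -(rmorph_nat (@real_complex R)) modulus_realc.
by rewrite ger0_norm ?ler0n // invf_lt1 ?ltr1n ?ltr0n.
Qed.

End DiskPolynomials.

Section BidiskFactor.
Variable R : realType.
Local Notation C := R[i].
Variable f : {poly {poly C}}.
Hypothesis torus : forall z v, f.[z + v, z * v] = 0 ->
  modulus z = 1 -> modulus v <= 1 -> modulus v = 1.

(** At [l = 0], [lucas_sum] counts roots, and [lucas_sum_poly] makes it a constant polynomial. *)
Lemma size_bidisk_roots p : modulus p < 1 ->
  size (bidisk_roots f p) = size (bidisk_roots f 0).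
Proof.
move=> p1; have [q sq qE] := lucas_sum_poly torus 0.
have lE x : lucas_sum f 0 x = (size (bidisk_roots f x))%:R.
  by rewrite /lucas_sum /lucas_count /= big_const_seq count_predT iter_addr_0.
apply/eqP; rewrite -(eqr_nat C) -!lE !qE ?modulus0 //.
by rewrite (size1_polyC sq) !hornerC.
Qed.

(** The recurrence [s L_(l+1) = L_(l+2) + p L_l] trades powers of [s] for other indices, down to
    [a = 0]. *)
Lemma bidisk_sum_lucas a l :
  disk_poly (fun p => \sum_(s <- bidisk_roots f p) s ^+ a * lucas l s p).
Proof.
elim: a l => [|a IHa] l.
  case: l => [|l].
    pose k : C := 2 * (size (bidisk_roots f 0))%:R.
    apply: disk_poly_eq (disk_poly_cst k) => p p1.
    under eq_bigr do rewrite expr0 mul1r /=.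
    by rewrite big_const_seq count_predT iter_addr_0 size_bidisk_roots // /k mulr_natr.
  have [q _ qE] := lucas_sum_poly torus l.+1; exists q => p p1.
  by rewrite -qE // /lucas_sum; apply: eq_bigr => s _; rewrite expr0 mul1r.
case: l => [|l].
  apply: disk_poly_eq (disk_polyM (disk_poly_cst 2) (IHa 1%N)) => p p1.
  by rewrite mulr_sumr; apply: eq_bigr => s _; rewrite /= exprSr; ring.
have IHX := disk_polyM (disk_poly_horner 'X) (IHa l).
apply: disk_poly_eq (disk_polyD (IHa l.+2) IHX) => p p1.
rewrite hornerX mulr_sumr -big_split; apply: eq_bigr => s _.
have -> : lucas l.+2 s p = s * lucas l.+1 s p - p * lucas l s p by [].
by rewrite exprSr; move: (lucas l.+1 s p) => b /=; ring.
Qed.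

Lemma bidisk_power_sum a : disk_poly (fun p => \sum_(s <- bidisk_roots f p) s ^+ a).
Proof.
apply: disk_poly_eq (disk_polyM (disk_poly_cst 2^-1) (bidisk_sum_lucas a 0)) => p p1.
by rewrite mulr_sumr; apply: eq_bigr => s _ /=; field.
Qed.

Definition bidisk_prod p : {poly C} := \prod_(s <- bidisk_roots f p) ('X - s%:P).

Lemma size_bidisk_prod p : modulus p < 1 ->
  size (bidisk_prod p) = (size (bidisk_roots f 0)).+1.
Proof. by move=> p1; rewrite size_prod_XsubC size_bidisk_roots. Qed.

(** Descending induction by Newton's identities: [(j - k) q_j] is a combination of higher
    coefficients with power sums, and [j - k] is a nonzero constant. *)
Lemma bidisk_prod_coef j : disk_poly (fun p => (bidisk_prod p)`_j).
Proof.
set k := size (bidisk_roots f 0).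
have [m] := ubnP (k - j)%N; elim: m => // m IHm in j *; rewrite ltnS => km.
have sk p : modulus p < 1 -> size (bidisk_prod p) = k.+1 by exact: size_bidisk_prod.
have [jk|] := ltnP j k; last first.
  rewrite leq_eqVlt => /orP[/eqP <-|kj].
    apply: disk_poly_eq (disk_poly_cst 1) => p p1.
    have /monicP := monic_prod_XsubC (bidisk_roots f p) xpredT id.
    by rewrite lead_coefE -/(bidisk_prod p) sk.
  apply: disk_poly_eq (disk_poly_cst 0) => p p1.
  by rewrite nth_default // sk.
have kj0 : j%:R - k%:R != 0 :> C by rewrite subr_eq0 eqr_nat ltn_eqF.
have IH : disk_poly (fun p => \sum_(i < k.+1) (bidisk_prod p)`_(i.+1 + j) *
    (\sum_(s <- bidisk_roots f p) s ^+ i.+1)).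
  apply: disk_poly_sum => i; apply: disk_polyM (bidisk_power_sum _).
  by apply: IHm; lia.
apply: disk_poly_eq (disk_polyM (disk_poly_cst (j%:R - k%:R)^-1) IH) => p p1.
have sr : size (bidisk_roots f p) = k by exact: size_bidisk_roots.
have := @prod_XsubC_newton C (bidisk_roots f p) k.+2 j.
rewrite sr -/(bidisk_prod p) leqW // => /(_ isT).
rewrite big_ord_recl /= add0n.
have -> : \sum_(s <- bidisk_roots f p) s ^+ 0 = k%:R.
  by under eq_bigr do rewrite expr0; rewrite big_const_seq count_predT iter_addr_0 sr.
set S := \sum_(i < k.+1) _.
move=> e; have -> : S = (j%:R - k%:R) * (bidisk_prod p)`_j.
  by apply: (addrI ((bidisk_prod p)`_j * k%:R)); rewrite e; ring.
by rewrite mulKf.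
Qed.

Lemma bidisk_monic_factor : exists2 g : {poly {poly C}}, g \is monic &
  forall p, modulus p < 1 -> fibre p g = bidisk_prod p.
Proof.
set k := size (bidisk_roots f 0).
have [c cE] := choice bidisk_prod_coef.
have sg : (size (\poly_(j < k) c j) < size ('X^k : {poly {poly C}}))%N.
  by rewrite size_polyXn ltnS size_poly.
exists ('X^k + \poly_(j < k) c j).
  by rewrite monicE lead_coefDl // lead_coefXn.
move=> p p1; apply/polyP => j; rewrite coef_fibre coefD coefXn coef_poly.
have sk : size (bidisk_prod p) = k.+1 by exact: size_bidisk_prod.
case: (ltngtP j k) => [jk|kj|->].
- by rewrite add0r cE.
- by rewrite addr0 horner0 nth_default // sk.
- have /monicP := monic_prod_XsubC (bidisk_roots f p) xpredT id.
  by rewrite lead_coefE -/(bidisk_prod p) sk addr0 hornerC.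
Qed.

(** Divide [f] by the monic [g]. Over the disk the fibre of [g] divides that of [f], so the
    remainder vanishes there, hence identically; the fibre of [h] keeps only the roots outside the
    symmetrized bidisk. *)
Lemma bidisk_factorization : exists g h : {poly {poly C}},
  [/\ g \is monic, f = h * g,
    forall s p, modulus p < 1 -> g.[s, p] = 0 -> sym_bidisk C (s, p) &
    forall s p, sym_bidisk C (s, p) -> h.[s, p] != 0].
Proof.
have [g gm gE] := bidisk_monic_factor.
have fibE p : fibre p f = (lead_coef (fibre p f) *:
    \prod_(s <- fibre_roots f p | ~~ `[< sym_bidisk C (s, p) >]) ('X - s%:P)) *
    bidisk_prod p.
  rewrite {1}fibre_rootsE -scalerAl (bigID (fun s => `[< sym_bidisk C (s, p) >])) /=.
  by rewrite /bidisk_prod /bidisk_roots big_filter mulrC.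
have := Pdiv.RingMonic.rdivp_eq gm f.
set h := Pdiv.Ring.rdivp f g; set t := Pdiv.Ring.rmodp f g => fE.
have st : (size t < size g)%N by exact: Pdiv.Ring.ltn_rmodpN0 (monic_neq0 gm).
have t0 : t = 0.
  apply/polyP => j; rewrite coef0; apply: disk_poly0 => p p1.
  have : bidisk_prod p %| fibre p t.
    have -> : fibre p t = fibre p f - fibre p h * fibre p g.
      by rewrite [in RHS]fE fibreD fibreM addrC addKr.
    by rewrite dvdp_sub ?gE ?dvdp_mull // fibE dvdp_mull.
  move=> /dvdp_leq lt; rewrite -coef_fibre; have [->|/lt] := eqVneq (fibre p t) 0.
    by rewrite coef0.
  rewrite -gE // size_fibre_monic // leqNgt (leq_ltn_trans _ st) //.
  by rewrite /fibre /map_poly size_poly.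
exists g, h; split=> //.
- by rewrite [LHS]fE t0 addr0.
- move=> s p p1; rewrite hornerXY_fibre gE // => /rootP.
  by rewrite root_prod_XsubC mem_filter => /andP[/asboolP].
move=> s p sG; have p1 : modulus p < 1.
  have [[z v] zvE] := symmetrizationP s p; move: sG; rewrite -zvE.
  move=> /sym_bidisk_mem[z1 v1]; move: zvE => [_ <-].
  by rewrite modulusM mulr_ilt1 ?modulus_ge0.
have : fibre p h * bidisk_prod p = fibre p f.
  by rewrite -gE // -fibreM [in RHS]fE t0 addr0.
rewrite [fibre p f]fibE => /(mulIf (monic_neq0 (monic_prod_XsubC _ _ _))).
rewrite hornerXY_fibre => ->.
rewrite hornerZ mulf_neq0 ?lead_coef_eq0 ?(fibre_neq0 torus) //.
rewrite -big_filter -/(root _ s) root_prod_XsubC mem_filter.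
by rewrite (asboolT sG).
Qed.

End BidiskFactor.

(** * Distinguished varieties *)

Section DistinguishedRealization.
Variable R : realType.
Local Notation C := R[i].
Implicit Types (f g : {poly {poly C}}) (s p z v : C).

Lemma distinguished_torus f :
  zero_set f `&` boundary (sym_bidisk C) =
    zero_set f `&` dist_boundary_sym_bidisk C ->
  forall z v, f.[z + v, z * v] = 0 -> modulus z = 1 -> modulus v <= 1 ->
  modulus v = 1.
Proof.
move=> fB z v fz z1 v1.
have : (zero_set f `&` boundary (sym_bidisk C)) (symmetrization (z, v)).
  split=> //; apply/boundary_sym_bidisk_mem; rewrite /= z1; split=> [//|[]].
  by rewrite ltxx.
by rewrite fB => -[_ /dist_boundary_mem[]].
Qed.

(** [|g(s, p')|] is the product of the distances from [s] to the roots over [p']; if all were at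
    least [eps], it could not be small. *)
Lemma fibre_root_near g s p (eps : R) : g \is monic -> g.[s, p] = 0 -> 0 < eps ->
  exists2 del : R, 0 < del & forall p', modulus (p' - p) < del ->
    exists2 s', g.[s', p'] = 0 & modulus (s - s') < eps.
Proof.
move=> gm gs e0; have ek0 : 0 < eps ^+ (size g).-1 by rewrite exprn_gt0.
have [del del0 Hdel] := horner_continuous g.[s%:P] p ek0.
exists del => // p' /Hdel; rewrite gs subr0 => small.
apply/not_exists2P => far.
have [rs gE] := closed_field_poly_normal (fibre p' g).
have fm : fibre p' g \is monic := fibre_monic p' gm.
rewrite (monicP fm) scale1r in gE.
have srs : size rs = (size g).-1.
  by rewrite -(size_fibre_monic p' gm) gE size_prod_XsubC.
move: small; apply/negP; rewrite -leNgt hornerXY_fibre gE horner_prod modulus_prod.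
rewrite -srs -(card_ord (size rs)) -prodr_const (big_nth 0) big_mkord.
apply: ler_prod => i _; rewrite (ltW e0) /= hornerXsubC leNgt; apply/negP.
have [|//] := far rs`_i; case; rewrite hornerXY_fibre; apply/rootP.
by rewrite gE root_prod_XsubC mem_nth.
Qed.

(** Approach [p = z v] radially from inside: nearby roots lie in the symmetrized bidisk, so the
    point is in its closure. Then [|z|] and [|v|] are at most [1] with product [1]. *)
Lemma monic_factor_torus g : g \is monic ->
  (forall s p, modulus p < 1 -> g.[s, p] = 0 -> sym_bidisk C (s, p)) ->
  forall z v, `|z * v| = 1 -> g.[z + v, z * v] = 0 -> `|z| = 1 /\ `|v| = 1.
Proof.
move=> gm gG z v /norm_eq1 zv1 gz.
have cl : closure (sym_bidisk C) (symmetrization (z, v)).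
  apply/closure_pairP => _ /gt0c_real[e e0 ->].
  have [del del0 near] := fibre_root_near gm gz e0.
  pose h := Num.min (1 / 2) (Num.min (del / 2) (e / 2)).
  have h0 : 0 < h by rewrite !lt_min !divr_gt0.
  have hh : h <= 1 / 2 by rewrite ge_min lexx.
  have hd : h < del.
    have : h <= del / 2 by rewrite !ge_min lexx !orbT.
    lra.
  have he : h < e.
    have : h <= e / 2 by rewrite !ge_min lexx !orbT.
    lra.
  pose p' : C := ((1 - h)%:C)%C * (z * v).
  have pp : modulus (p' - z * v) = h.
    have -> : p' - z * v = - ((h%:C)%C * (z * v)).
      by rewrite /p' rmorphB rmorph1; ring.
    by rewrite modulusN modulusM zv1 mulr1 modulus_realc gtr0_norm.
  have p'1 : modulus p' < 1.
    by rewrite modulusM zv1 mulr1 modulus_realc ger0_norm; lra.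
  have [|s' gs' ss'] := near p'; first by rewrite pp.
  exists s', p'; split; rewrite ?norm_lt_modulus //; first exact: gG.
  by rewrite modulusBC pp.
have z1 := closure_sym_bidisk_le1 cl.
have v1 : modulus v <= 1.
  apply: (@closure_sym_bidisk_le1 R (v, z)).
  by move: cl; rewrite /symmetrization /= addrC mulrC.
rewrite /= in z1; rewrite modulusM in zv1.
have z0 := modulus_ge0 z; have v0 := modulus_ge0 v.
rewrite (norm_eq1 z) (norm_eq1 v); split; nra.
Qed.

Lemma irreducible_variety1 (x : C * C) : irreducible_variety [set x].
Proof.
split.
- have -> : [set x] = zero_set ('X - (x.1%:P)%:P) `&` zero_set ('X - x.2%:P)%:P.
    case: x => s p; apply/seteqP; split=> [_ ->|[s' p'] []];
      rewrite /zero_set /= !hornerE ?subrr //.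
    by move=> /subr0_eq -> /subr0_eq ->.
  by apply: algebraic_varietyI; exact: zero_set_algebraic.
- by exists x.
move=> V1 V2 _ _ e; have : [set x] x by [].
rewrite {1}e => -[Vx|Vx]; [left|right]; apply/seteqP; split=> y.
- by move=> ->.
- by move=> Vy; rewrite e; left.
- by move=> ->.
- by move=> Vy; rewrite e; right.
Qed.

Lemma distinguished_realization (W : set (C * C)) :
  distinguished_variety W ->
  (forall V, irreducible_component W V -> V `&` sym_bidisk C !=set0) ->
  exists (d : nat) (P U : 'M[C]_d),
    [/\ (0 < d)%N, orthogonal_projection P, U \is unitarymx,
        completely_nonunitary (pencil_mx P U) &
        W = det_variety (pencil_mx P U)].
Proof.
move=> dW comps; have [[f WE] [x [Wx Gx]] WB] := dW.
rewrite WE in WB; have torus := distinguished_torus WB.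
have [g [h [gm fE gG hG]]] := bidisk_factorization torus.
have WU : W = zero_set h `|` zero_set g by rewrite WE fE zero_setM.
have Wg : W = zero_set g.
  apply/seteqP; split=> y Wy; last by rewrite WU; right.
  have [V Vc yV] : exists2 V, irreducible_component W V & [set y] `<=` V.
    apply: irreducible_component_exists (irreducible_variety1 y) _.
      by rewrite WE; exact: zero_set_algebraic.
    by move=> _ ->.
  have [irr VW _] := Vc.
  (* A component inside [zero_set h] would miss the symmetrized bidisk, so the one through [y] lies
     in [zero_set g]. *)
  have [] : V `<=` zero_set h \/ V `<=` zero_set g.
    apply: (irreducible_varietyU irr); try exact: zero_set_algebraic.
    by rewrite -WU.
    move=> Vh; have [[s p] [/Vh hs sG]] := comps V Vc.
    by have /eqP := hG s p sG.
  by apply; apply: yV.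
have [gs [gE /allP gsm gsi]] := monic_irreducible_factorization gm.
have gs0 : gs != [::].
  apply/eqP => gs0; move: Wx; rewrite Wg gE gs0 big_nil /zero_set /= !hornerC.
  by move/eqP; rewrite oner_eq0.
have [|d [P [U [d0 PP UU WdE]]]] := product_pencil gs0.
  move=> k kgs; split; [exact: gsm|exact: gsi|] => z v zv kz.
  apply: (monic_factor_torus gm gG) => //.
  by rewrite gE (big_rem k kgs) /= !hornerM kz mul0r.
exists d, P, U; have WP : W = det_variety (pencil_mx P U) by rewrite Wg gE.
split=> //; apply: pencil_distinguished_cnu.
by rewrite -WP.
Qed.

End DistinguishedRealization.

Theorem theorem2p17 (R : realType) :
  (forall (d : nat) (P U : 'M[R[i]]_d),
    (0 < d)%N -> orthogonal_projection P -> U \is unitarymx ->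
    let F := pencil_mx P U in
    let W := det_variety F in
    algebraic_variety W /\
    W `&` closed_sym_bidisk R[i] !=set0 /\
    [<-> distinguished_variety W;
         completely_nonunitary F;
         spectrum F `&` unit_circle R[i] = set0;
         ~ (exists M : {vspace 'cV[R[i]]_d},
              [/\ M != 0%VS, reducing U M &
                  (M <= mx_range P)%VS || (M <= mx_range (1%:M - P))%VS]);
         W `<=` @symmetrization R[i] @`
           ((unit_disk R[i] `*` unit_disk R[i]) `|`
            (unit_circle R[i] `*` unit_circle R[i]) `|`
            (exterior_disk R[i] `*` exterior_disk R[i]));
         forall V, irreducible_component W V ->
           V `&` sym_bidisk R[i] !=set0]) /\
  (forall W : set (R[i] * R[i]),
    distinguished_variety W ->
    (forall V, irreducible_component W V -> V `&` sym_bidisk R[i] !=set0) ->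
    exists (d : nat) (P U : 'M[R[i]]_d),
      [/\ (0 < d)%N, orthogonal_projection P, U \is unitarymx,
          completely_nonunitary (pencil_mx P U) &
          W = det_variety (pencil_mx P U)]).
Proof.
split=> [d P U d0 Pproj Uunit F W|W]; last exact: distinguished_realization.
split; first by rewrite /W det_varietyE; exact: zero_set_algebraic.
split; first exact: det_variety_meets_closed.
(* Needed twice in the cycle: after the absence of reducing subspaces, and to return from the
   components to the distinguished variety. *)
have noev_loc : (forall v a, ~ range_eigenvector P U v a) ->
  forall z, W (symmetrization z) ->
  [\/ modulus z.1 < 1 /\ modulus z.2 < 1, modulus z.1 = 1 /\ modulus z.2 = 1 |
      1 < modulus z.1 /\ 1 < modulus z.2].
  by move=> noev z; apply: pencil_variety_location.
tfae.
- exact: pencil_distinguished_cnu.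
- exact: pencil_cnu_spectrum.
- move=> sp0; apply/(no_eigenvector_no_reducing Pproj Uunit) => v a.
  exact: pencil_spectrum_eigenvector sp0.
- move=> nored.
  have noev := proj2 (no_eigenvector_no_reducing Pproj Uunit) nored.
  exact (proj1 (pencil_location_range P U) (noev_loc noev)).
- move=> sub V; have loc := proj2 (pencil_location_range P U) sub.
  exact: pencil_location_components.
- move=> comps; apply: pencil_location_distinguished => //; apply: noev_loc.
  by move=> v a; apply: pencil_components_no_eigenvector.
Qed.
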